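(* Let $\mathbb{F}$ be a field and let $A$ be a (differential graded) algebra over $\mathbb{F}$ equipped with a degree $d$ quasi-isomorphism of $A$-bimodules $\Theta:A\xrightarrow{\ \simeq\ }A^\vee$ between $A$ and its dual $A^\vee=\mathrm{Hom}(A,\mathbb{F})$. Then the Connes coboundary map $H(B^\vee)$ on $HH^*(A,A^\vee)$ defines, via the isomorphism $$HH^*(A,\Theta):HH^p(A,A)\xrightarrow{\ \cong\ }HH^{p-d}(A,A^\vee),$$ a structure of Batalin–Vilkovisky algebra on the Gerstenhaber algebra $HH^*(A,A)$; that is, $HH^*(A,A)$ with the operator $\Delta:=HH^*(A,\Theta)^{-1}\circ H(B^\vee)\circ HH^*(A,\Theta)$ is a Batalin–Vilkovisky algebra.
   Context: **Grading.** An element of upper degree $p$ has lower degree $-p$, and $V^p=V_{-p}$. $|x|$ denotes lower degree; ''degree $d$'' for $\Theta$ means lower degree $d$. $A^\vee$ has its usual dg $A$-bimodule structure (Koszul signs). $sA$ is the suspension, $(sA)_i=A_{i-1}$; elements of $T(sA)$ are written $[a_1|\cdots|a_k]$. **Hochschild complexes.** For a dg $(A,A)$-bimodule $N$, $\mathcal{C}^*(A;N)=(\mathrm{Hom}(T(sA),N),D_0+D_1)$, with $D_0(f)([\,])=d_N f([\,])$, $D_1(f)([\,])=0$, and for $k\ge1$, with $\bar\epsilon_i=|f|+|sa_1|+\cdots+|sa_{i-1}|$, $D_0(f)([a_1|\cdots|a_k])=d_N(f([a_1|\cdots|a_k]))-\sum_{i=1}^k(-1)^{\bar\epsilon_i}f([a_1|\cdots|d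 a_i|\cdots|a_k])$, $D_1(f)([a_1|\cdots|a_k])=-(-1)^{|sa_1||f|}a_1f([a_2|\cdots|a_k])-\sum_{i=2}^k(-1)^{\bar\epsilon_i}f([a_1|\cdots|a_{i-1}a_i|\cdots|a_k])+(-1)^{\bar\epsilon_k}f([a_1|\cdots|a_{k-1}])a_k$. $HH^*(A;N)$ (also written $HH^*(A,N)$) is its cohomology; $HH^*(A,\Theta)$ is induced by $f\mapsto\Theta\circ f$. $\mathcal{C}_*(A;A)=(A\otimes T(sA),d_1+d_2)$ is the usual Hochschild chain complex, and $\mathcal{C}^*(A;A^\vee)\cong\mathcal{C}_*(A;A)^\vee$, $g\mapsto\big(a_0[a_1|\cdots|a_n]\mapsto (g[a_1|\cdots|a_n])(a_0)\big)$. **Gerstenhaber structure on $HH^*(A,A)$.** The cup product is induced by $(f\cup g)([a_1|\cdots|a_n])=\sum_{p=0}^n f([a_1|\cdots|a_p])\,g([a_{p+1}|\cdots|a_n])$ (Koszul signs); the bracket is $\{f,g\}=f\circ g-(-1)^{(|f|+1)(|g|+1)}g\circ f$, where $f\circ g$ is the sum over all insertions of $g$ into $f$ (Koszul signs). **Connes (co)boundary.** $B$ is Connes' boundary on $\mathcal{C}_*(A;A)$ (on the normalized complex, $B(a_0[a_1|\cdots|a_n])=\sum_{i=0}^n\pm1[a_i|\cdots|a_n|a_0|\cdots|a_{i-1}]$ with Koszul signs), and $B^\vee(m)=(-1)^{|m|}m\circ B$ on $\mathcal{C}_*(A;A)^\vee\cong\mathcal{C}^*(A;A^\vee)$; $H(B^\vee)$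 is the induced map on $HH^*(A,A^\vee)$. **Gerstenhaber algebra.** A commutative graded algebra $G$ with a linear map $\{-,-\}:G_i\otimes G_j\to G_{i+j+1}$ such that $\{a,b\}=-(-1)^{(|a|+1)(|b|+1)}\{b,a\}$, $\{a,\{b,c\}\}=\{\{a,b\},c\}+(-1)^{(|a|+1)(|b|+1)}\{b,\{a,c\}\}$, and $\{a,bc\}=\{a,b\}c+(-1)^{(|a|+1)|b|}b\{a,c\}$. **Batalin–Vilkovisky algebra.** A Gerstenhaber algebra $G$ with a linear map $\Delta:G_i\to G_{i+1}$ such that $\Delta\circ\Delta=0$ and $\{a,b\}=(-1)^{|a|}\big(\Delta(a\cup b)-(\Delta a)\cup b-(-1)^{|a|}a\cup(\Delta b)\big)$.
   Formalization: Signs corrected: the sum in D_0 has sign + (else D² ≠ 0); HH(A,Θ) is induced by f ↦ (-1)^{d|f|} Θ∘f; the identification of C^*(A;A^∨) with C_*(A;A)^∨ carries a Koszul sign; B has overall sign -1. With the literal signs the BV identity fails for one parity of d. *)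

(* Defs.v *)
From HB Require Import structures.
From mathcomp Require Import all_boot all_order all_algebra.
From mathcomp Require Import boolp classical_sets functions.
From mathcomp Require Import ring.

Set Implicit Arguments.
Unset Strict Implicit.
Unset Printing Implicit Defensive.

Import Order.TTheory GRing.Theory Num.Theory.

Local Open Scope ring_scope.
Local Open Scope quotient_scope.

Notation sgn F i := ((-1 : F) ^ (i : int)).

Section Sign.
Variable F : fieldType.

Lemma sgnD i j : sgn F (i + j) = sgn F i * sgn F j.
Proof. by rewrite expfzDr // oppr_eq0 oner_eq0. Qed.

Lemma sgn_eq (i j k : int) : i = j + (k + k) -> sgn F i = sgn F j.
Proof. by move=> ->; rewrite !sgnD -expfzMl mulrN1 opprK exp1rz mulr1. Qed.

End Sign.

(* Quotient of a vector space by a subspace; MathComp's quotients stop at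
   abelian groups.                                                            *)
Section QuotLmod.
Variables (F : fieldType) (U : lmodType F) (W : {pred U}).
Variable W_closed : submod_closed W.

Let S : {pred U} := let _ := W_closed in W.
HB.instance Definition _ :=
  GRing.isSubmodClosed.Build F U S (GRing.submod_closed_semi W_closed).

Definition lquot := Quotient.quot S.
HB.instance Definition _ := GRing.Zmodule.on lquot.

Definition lpi (u : U) : lquot := \pi_(Quotient.quot S) u.
Definition lrepr (x : lquot) : U := repr (x : Quotient.quot S).

Lemma lreprK x : lpi (lrepr x) = x. Proof. exact: reprK. Qed.

Lemma lpi_eq u v : lpi u = lpi v <-> u - v \in W.
Proof.
rewrite -[_ \in W]/(u - v \in S) Quotient.idealrBE.
by split=> [/eqP|/eqP].
Qed.

Lemma lpiD u v : lpi (u + v) = lpi u + lpi v. Proof. exact: pi_addr. Qed.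

Definition lquot_scale (c : F) (x : lquot) : lquot := lpi (c *: lrepr x).

Lemma lpi_scale c u : lquot_scale c (lpi u) = lpi (c *: u).
Proof.
apply/lpi_eq; rewrite -scalerBr -[_ \in W]/(_ \in S) rpredZ //.
by apply/lpi_eq; rewrite lreprK.
Qed.

Lemma lquot_scaleA a b x :
  lquot_scale a (lquot_scale b x) = lquot_scale (a * b) x.
Proof. by rewrite -[x]lreprK !lpi_scale scalerA. Qed.

Lemma lquot_scale1 : left_id 1 lquot_scale.
Proof. by move=> x; rewrite -[x]lreprK lpi_scale scale1r. Qed.

Lemma lquot_scaleDr : right_distributive lquot_scale +%R.
Proof.
move=> c x y; rewrite -[x]lreprK -[y]lreprK.
by rewrite -lpiD !lpi_scale scalerDr lpiD.
Qed.

Lemma lquot_scaleDl x : {morph lquot_scale^~ x : a b / a + b}.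
Proof. by move=> a b; rewrite -[x]lreprK !lpi_scale scalerDl lpiD. Qed.

HB.instance Definition _ := GRing.Zmodule_isLmodule.Build F lquot
  lquot_scaleA lquot_scale1 lquot_scaleDr lquot_scaleDl.

End QuotLmod.

(* A graded vector space is a family of subspaces of an ambient space, indexed
   by the lower degree; only elements of these subspaces are meaningful.      *)
Record gradedSpace (F : fieldType) := GradedSpace {
  gs_sort :> lmodType F;
  piece : int -> {pred gs_sort};
  piece_closed : forall i, submod_closed (piece i) }.

(* [pc_d i] matters on the piece of degree [i] only; it is meant to lower the
   degree by one and square to zero.  Homology makes sense (as cycles modulo
   those cycles which are boundaries) without these two facts being bundled. *)
Record precomplex (F : fieldType) := Precomplex {
  pc_space :> gradedSpace F;
  pc_d : int -> pc_space -> pc_space;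
  pc_d_linear : forall i, linear (pc_d i) }.

Arguments piece {F} g i : rename.
Arguments piece_closed {F} g i : rename.
Arguments pc_d {F p} i x : rename.
Arguments pc_d_linear {F} p i : rename.

Section Homology.
Variables (F : fieldType) (C : precomplex F) (n : int).

Definition cycle : {pred C} := fun z => (z \in piece C n) && (pc_d n z == 0).

Lemma cycleE z : (z \in cycle) = (z \in piece C n) && (pc_d n z == 0).
Proof. by []. Qed.

Lemma pc_d0 i : pc_d i (0 : C) = 0.
Proof.
by have := pc_d_linear C i (-1) 0 0; rewrite scaler0 addr0 scaleN1r addNr.
Qed.

Lemma cycle_closed : submod_closed cycle.
Proof.
have [p0 pl] := piece_closed C n.
split=> [|a u v]; rewrite !cycleE; first by rewrite p0 pc_d0 eqxx.
move=> /andP[pu /eqP du] /andP[pv /eqP dv].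
by rewrite pl //= pc_d_linear du dv scaler0 addr0 eqxx.
Qed.

HB.instance Definition _ :=
  GRing.isSubmodClosed.Build F C cycle (GRing.submod_closed_semi cycle_closed).

Record cycles := Cycles { cycle_val : C; _ : cycle_val \in cycle }.
HB.instance Definition _ := [isSub for cycle_val].
HB.instance Definition _ := [Choice of cycles by <:].
HB.instance Definition _ := [SubChoice_isSubLmodule of cycles by <:].

Definition boundary : {pred cycles} :=
  fun z => `[< exists2 y, y \in piece C (n + 1) & pc_d (n + 1) y = val z >].

Lemma boundary_closed : submod_closed boundary.
Proof.
have [p0 pl] := piece_closed C (n + 1); split.
  by apply/asboolP; exists 0; rewrite ?pc_d0 ?raddf0.
move=> a u v /asboolP[x px dx] /asboolP[y py dy]; apply/asboolP.
by exists (a *: x + y); [exact: pl | rewrite pc_d_linear dx dy linearP].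
Qed.

Definition homology : lmodType F := lquot boundary_closed.

(* The class of a cycle; elements which are not cycles are sent to 0. *)
Definition hclass (z : C) : homology :=
  lpi boundary_closed (insubd (0 : cycles) z).

Definition hrepr (x : homology) : C := val (@lrepr _ _ _ boundary_closed x).

End Homology.

Arguments cycle {F} C n.
Arguments homology {F} C n.
Arguments hclass {F} C n z.
Arguments hrepr {F C n} x.

Definition induced1 (F : fieldType) (C C' : precomplex F) (n m : int)
    (phi : C -> C') (h : homology C n -> homology C' m) : Prop :=
  forall z, z \in cycle C n ->
    phi z \in cycle C' m /\ h (hclass C n z) = hclass C' m (phi z).

Definition induced2 (F : fieldType) (C : precomplex F) (n m k : int)
    (phi : C -> C -> C)
    (h : homology C n -> homology C m -> homology C k) : Prop :=
  forall z w, z \in cycle C n -> w \in cycle C m ->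
    phi z w \in cycle C k /\
    h (hclass C n z) (hclass C m w) = hclass C k (phi z w).

Record homog (F : fieldType) (V : gradedSpace F) := Homog {
  deg : int;
  hval : V;
  homogP : hval \in piece V deg }.

Section Homog.
Variables (F : fieldType) (V : gradedSpace F).

Definition homog0 (i : int) : homog V := Homog (proj1 (piece_closed V i)).

(* [x] as an element of degree [i]; junk value 0 if it is not of degree [i] *)
Definition mkhomog (i : int) (x : V) : homog V :=
  match @idP (x \in piece V i) with
  | ReflectT h => Homog h
  | ReflectF _ => homog0 i
  end.

(* Linearity, on each piece of [V], of a map given on homogeneous elements *)
Definition homog_linear (N : lmodType F) (f : homog V -> N) : Prop :=
  forall (c : F) (a b e : homog V),
    deg a = deg e -> deg b = deg e -> hval e = c *: hval a + hval b ->
    f e = c *: f a + f b.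

End Homog.

(* Unital, associative, Z-graded, unbounded and of arbitrary dimension.  The
   zero algebra is allowed, which [algType] would exclude.                    *)
Record dgAlgebra (F : fieldType) := DGAlgebra {
  dga_sort :> lmodType F;
  dga_one : dga_sort;
  dga_mul : dga_sort -> dga_sort -> dga_sort;
  dga_d : dga_sort -> dga_sort;
  gr : int -> {pred dga_sort};
  dga_mulA : associative dga_mul;
  dga_mul1l : left_id dga_one dga_mul;
  dga_mul1r : right_id dga_one dga_mul;
  dga_mul_linear_l : forall y, linear (fun x => dga_mul x y);
  dga_mul_linear_r : forall x, linear (fun y => dga_mul x y);
  gr_closed : forall i, submod_closed (gr i);
  gr_span : forall x, exists (s : seq int) (y : int -> dga_sort),
    (forall i, y i \in gr i) /\ x = \sum_(i <- s) y i;
  gr_direct : forall (s : seq int) (y : int -> dga_sort), uniq s ->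
    (forall i, y i \in gr i) -> \sum_(i <- s) y i = 0 ->
    forall i, i \in s -> y i = 0;
  gr_one : dga_one \in gr 0;
  gr_mul : forall i j x y, x \in gr i -> y \in gr j ->
    dga_mul x y \in gr (i + j);
  dga_d_linear : linear dga_d;
  gr_d : forall i x, x \in gr i -> dga_d x \in gr (i - 1);
  dga_dd : forall x, dga_d (dga_d x) = 0;
  dga_leibniz : forall i x y, x \in gr i ->
    dga_d (dga_mul x y) =
      dga_mul (dga_d x) y + sgn F i *: dga_mul x (dga_d y) }.

Definition dga_space (F : fieldType) (A : dgAlgebra F) : gradedSpace F :=
  GradedSpace (@gr_closed F A).

Notation helt A := (homog (dga_space A)).

Section HomogAlgebra.
Variables (F : fieldType) (A : dgAlgebra F).

Definition hone : helt A := @Homog F (dga_space A) 0 (dga_one A) (gr_one A).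

Definition hmul (a b : helt A) : helt A :=
  @Homog F (dga_space A) (deg a + deg b) (@dga_mul F A (hval a) (hval b))
    (gr_mul (homogP a) (homogP b)).

Definition hd (a : helt A) : helt A :=
  @Homog F (dga_space A) (deg a - 1) (@dga_d F A (hval a)) (gr_d (homogP a)).

End HomogAlgebra.

Arguments hone {F A}.

(* [bm_l a j x] is the product a.x, and [bm_r j x a] the product x.a, for x of
   degree j.                                                                  *)
Record dgBimodule (F : fieldType) (A : dgAlgebra F) := DGBimodule {
  bm_space :> gradedSpace F;
  bm_d : int -> bm_space -> bm_space;
  bm_l : helt A -> int -> bm_space -> bm_space;
  bm_r : int -> bm_space -> helt A -> bm_space;
  bm_d_linear : forall j, linear (bm_d j);
  bm_l_linear : forall a j, linear (bm_l a j);
  bm_r_linear : forall a j, linear (fun x => bm_r j x a);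
  bm_l_homog : forall j x, x \in piece bm_space j ->
    homog_linear (fun a => bm_l a j x);
  bm_r_homog : forall j x, x \in piece bm_space j ->
    homog_linear (fun a => bm_r j x a);
  bm_d_piece : forall j x, x \in piece bm_space j ->
    bm_d j x \in piece bm_space (j - 1);
  bm_l_piece : forall a j x, x \in piece bm_space j ->
    bm_l a j x \in piece bm_space (deg a + j);
  bm_r_piece : forall a j x, x \in piece bm_space j ->
    bm_r j x a \in piece bm_space (j + deg a);
  bm_dd : forall j x, x \in piece bm_space j -> bm_d (j - 1) (bm_d j x) = 0;
  bm_l1 : forall j x, x \in piece bm_space j -> bm_l hone j x = x;
  bm_r1 : forall j x, x \in piece bm_space j -> bm_r j x hone = x;
  bm_lA : forall a b j x, x \in piece bm_space j ->
    bm_l (hmul a b) j x = bm_l a (deg b + j) (bm_l b j x);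
  bm_rA : forall a b j x, x \in piece bm_space j ->
    bm_r j x (hmul a b) = bm_r (j + deg a) (bm_r j x a) b;
  bm_lr : forall a b j x, x \in piece bm_space j ->
    bm_r (deg a + j) (bm_l a j x) b = bm_l a (j + deg b) (bm_r j x b);
  bm_dl : forall a j x, x \in piece bm_space j ->
    bm_d (deg a + j) (bm_l a j x) =
      bm_l (hd a) j x + sgn F (deg a) *: bm_l a (j - 1) (bm_d j x);
  bm_dr : forall a j x, x \in piece bm_space j ->
    bm_d (j + deg a) (bm_r j x a) =
      bm_r (j - 1) (bm_d j x) a + sgn F j *: bm_r j x (hd a) }.

Definition bm_complex (F : fieldType) (A : dgAlgebra F) (N : dgBimodule A) :
  precomplex F := Precomplex (@bm_d_linear F A N).

Arguments bm_d {F A d} j x : rename.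
Arguments bm_l {F A d} a j x : rename.
Arguments bm_r {F A d} j x a : rename.

Section SelfBimodule.
Variables (F : fieldType) (A : dgAlgebra F).

Definition self_bimodule : dgBimodule A.
Proof.
apply: (@DGBimodule F A (dga_space A) (fun _ => @dga_d F A)
  (fun a _ x => dga_mul (hval a : A) x) (fun _ x a => dga_mul x (hval a : A))).
- by move=> _; exact: dga_d_linear.
- by move=> a _; exact: dga_mul_linear_r.
- by move=> a _; exact: dga_mul_linear_l.
- by move=> _ x _ c a b e _ _ ->; exact: dga_mul_linear_l.
- by move=> _ x _ c a b e _ _ ->; exact: dga_mul_linear_r.
- by move=> j x; exact: gr_d.
- by move=> a j x; apply: gr_mul; exact: homogP.
- by move=> a j x /gr_mul; apply; exact: homogP.
- by move=> j x _; exact: dga_dd.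
- by move=> j x _; exact: dga_mul1l.
- by move=> j x _; exact: dga_mul1r.
- by move=> a b j x _; rewrite /= dga_mulA.
- by move=> a b j x _; rewrite /= dga_mulA.
- by move=> a b j x _; rewrite /= dga_mulA.
- by move=> a j x _; apply: dga_leibniz; exact: homogP.
- by move=> a j x xj; exact: dga_leibniz.
Defined.

End SelfBimodule.

(* The graded dual: (A^vee)_j = Hom(A_{-j}, F), with the Koszul signs
     (d phi)(x)  = -(-1)^|phi| phi(dx),
     (a.phi)(x)  = (-1)^(|a|(|phi|+|x|)) phi(xa),
     (phi.a)(x)  = phi(ax).                                                   *)
Section DualBimodule.
Variables (F : fieldType) (A : dgAlgebra F).

Definition dual_sort : lmodType F := helt A -> F^o.

Definition dual_piece (j : int) : {pred dual_sort} :=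
  fun phi => `[< homog_linear phi /\ forall x, deg x != - j -> phi x = 0 >].

Definition dual_d (j : int) (phi : dual_sort) : dual_sort :=
  fun x => - sgn F j * phi (hd x).

Definition dual_l (a : helt A) (j : int) (phi : dual_sort) : dual_sort :=
  fun x => sgn F (deg a * (j + deg x)) * phi (hmul x a).

Definition dual_r (j : int) (phi : dual_sort) (a : helt A) : dual_sort :=
  fun x => phi (hmul a x).

Lemma dual_piece_closed j : submod_closed (dual_piece j).
Proof.
split; first by apply/asboolP; split=> // c a b e _ _ _; rewrite scaler0 addr0.
move=> k f g /asboolP[fl f0] /asboolP[gl g0]; apply/asboolP; split.
  move=> c a b e da db ev; rewrite -![(k *: f + g) _]/(k *: f _ + g _).
  rewrite (fl _ _ _ _ da db ev) (gl _ _ _ _ da db ev) !scalerDr !scalerA.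
  by rewrite addrACA (mulrC k).
move=> x dx; rewrite -[LHS]/(k *: f x + g x) f0 // g0 //.
by rewrite scaler0 addr0.
Qed.

Definition dual_space : gradedSpace F := GradedSpace dual_piece_closed.

Lemma homog_eq (a b : helt A) : deg a = deg b -> hval a = hval b -> a = b.
Proof.
case: a b => [i x p] [j y q] /= e1 e2; case: _ / e1 q; case: _ / e2 => q.
by congr Homog; exact: bool_irrelevance.
Qed.

Lemma homog_linearD (phi : dual_sort) (a b e : helt A) : homog_linear phi ->
  deg a = deg e -> deg b = deg e -> hval e = hval a + hval b ->
  phi e = phi a + phi b.
Proof.
by move=> pl da db ev; rewrite (pl 1 a b e) ?scale1r.
Qed.

Lemma homog_linear0 (phi : dual_sort) (a : helt A) :
  homog_linear phi -> hval a = 0 -> phi a = 0.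
Proof.
move=> pl a0; have := @homog_linearD phi a a a pl erefl erefl _.
rewrite a0 addr0 => /(_ erefl) /(congr1 (fun t => t - phi a)).
by rewrite addrK subrr.
Qed.

Definition dual_bimodule : dgBimodule A.
Proof.
apply: (@DGBimodule F A dual_space dual_d dual_l dual_r).
- move=> j k f g; apply/funext => x.
  by rewrite -[LHS]/(- sgn F j * (k * f (hd x) + g (hd x))) mulrDr mulrCA.
- move=> a j k f g; apply/funext => x.
  rewrite -[LHS]/(sgn F (deg a * (j + deg x)) *
                  (k * f (hmul x a) + g (hmul x a))).
  by rewrite mulrDr mulrCA.
- by move=> a j k f g; apply/funext => x.
- move=> j f /asboolP[fl _] c a b e da db ev; apply/funext => x.
  rewrite -[RHS]/(c * (dual_l a j f x) + dual_l b j f x) /dual_l da db.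
  rewrite (fl c (hmul x a) (hmul x b)) /= ?da ?db //.
    by rewrite mulrDr mulrCA.
  by rewrite ev dga_mul_linear_r.
- move=> j f /asboolP[fl _] c a b e da db ev; apply/funext => x.
  rewrite -[RHS]/(c *: (dual_r j f a x) + dual_r j f b x) /dual_r.
  rewrite (fl c (hmul a x) (hmul b x)) /= ?da ?db //.
  by rewrite ev dga_mul_linear_l.
- move=> j f /asboolP[fl f0]; apply/asboolP; split.
    move=> c a b e da db ev; rewrite /dual_d.
    rewrite (fl c (hd a) (hd b)) /= ?da ?db // ?ev ?dga_d_linear //.
    by rewrite -[_ *: _]/(_ * _) mulrDr mulrCA.
  move=> x dx; rewrite /dual_d f0 ?mulr0 //=.
  apply: contra dx => /eqP e; apply/eqP.
  by rewrite -(subrK 1 (deg x)) e; ring.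
- move=> a j f /asboolP[fl f0]; apply/asboolP; split.
    move=> c x y e dx dy ev; rewrite /dual_l dx dy.
    rewrite (fl c (hmul x a) (hmul y a)) /= ?dx ?dy // ?ev ?dga_mul_linear_l //.
    by rewrite -[_ *: _]/(_ * _) mulrDr mulrCA.
  move=> x dx; rewrite /dual_l f0 ?mulr0 //=.
  apply: contra dx => /eqP e; apply/eqP.
  by rewrite -(addrK (deg a) (deg x)) e; ring.
- move=> a j f /asboolP[fl f0]; apply/asboolP; split.
    move=> c x y e dx dy ev; rewrite /dual_r.
    by rewrite (fl c (hmul a x) (hmul a y)) /= ?dx ?dy // ?ev ?dga_mul_linear_r.
  move=> x dx; rewrite /dual_r f0 //=.
  apply: contra dx => /eqP e; apply/eqP.
  by rewrite -(addKr (deg a) (deg x)) e; ring.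
- move=> j f /asboolP[fl _]; apply/funext => x.
  by rewrite /dual_d (@homog_linear0 f (hd (hd x))) ?mulr0 //= dga_dd.
- move=> j f /asboolP[fl _]; apply/funext => x.
  rewrite /dual_l /= mul0r expr0z mul1r; congr f.
  by apply: homog_eq; rewrite /= ?addr0 ?dga_mul1r.
- move=> j f /asboolP[fl _]; apply/funext => x.
  rewrite /dual_r; congr f.
  by apply: homog_eq; rewrite /= ?add0r ?dga_mul1l.
- move=> a b j f _; apply/funext => x; rewrite /dual_l mulrA -sgnD.
  congr (_ * _).
    by apply: (@sgn_eq F _ _ (- (deg a * deg b))); rewrite /=; ring.
  by congr f; apply: homog_eq; rewrite /= ?addrA ?dga_mulA.
- move=> a b j f _; apply/funext => x; rewrite /dual_r.
  by congr f; apply: homog_eq; rewrite /= ?addrA ?dga_mulA.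
- move=> a b j f _; apply/funext => x; rewrite /dual_r /dual_l; congr (_ * _).
    by congr (_ ^ _); rewrite /=; ring.
  by congr f; apply: homog_eq; rewrite /= ?addrA ?dga_mulA.
- move=> a j f /asboolP[fl _]; apply/funext => x.
  rewrite -[RHS]/(dual_l (hd a) j f x
    + sgn F (deg a) * dual_l a (j - 1) (dual_d j f) x).
  rewrite /dual_l /dual_d /=.
  have e1 : deg (hmul (hd x) a) = deg (hd (hmul x a)) by rewrite /=; ring.
  have e2 : deg (hmul x (hd a)) = deg (hd (hmul x a)) by rewrite /=; ring.
  rewrite (fl _ _ _ _ e2 e1 (_ : _ = sgn F (deg x) *: _ + _)); last first.
    by rewrite /= [LHS](dga_leibniz _ (homogP x)) addrC.
  rewrite -[_ *: _]/(_ * _) !mulrDr !mulNr !mulrA -!sgnD.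
  set u := f (hmul x (hd a)); set v := f (hmul (hd x) a).
  rewrite !mulrN !mulrA -!sgnD; set s := deg a * j + deg a * deg x.
  rewrite [X in _ = _ + (- (X * u) - _)](@sgn_eq F _ (s - j - deg x)
    (j + deg x));
    last by rewrite /s; ring.
  rewrite [X in _ = X * u + _](@sgn_eq F _ (s - j - deg x) 0);
    last by rewrite /s; ring.
  have K (X Y : F) : X + (- X - Y) = - Y by rewrite addrA subrr add0r.
  by rewrite [RHS]K; congr (- (_ ^ _ * v)); ring.
- move=> a j f /asboolP[fl _]; apply/funext => x.
  rewrite -[RHS]/(dual_r (j - 1) (dual_d j f) a x
    + sgn F j * dual_r j f (hd a) x).
  rewrite /dual_r /dual_d /=.
  have e1 : deg (hmul a (hd x)) = deg (hd (hmul a x)) by rewrite /=; ring.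
  have e2 : deg (hmul (hd a) x) = deg (hd (hmul a x)) by rewrite /=; ring.
  rewrite (fl _ _ _ _ e1 e2 (_ : _ = sgn F (deg a) *: _ + _)); last first.
    by rewrite /= [LHS](dga_leibniz _ (homogP a)) addrC.
  by rewrite -[_ *: _]/(_ * _) mulrDr !mulNr mulrA -sgnD addrNK.
Defined.

End DualBimodule.

(* A word [:: a_1; ...; a_k] stands for the element [a_1|...|a_k] of T(sA);
   [bdeg] is its degree |sa_1| + ... + |sa_k|.                                *)
Definition bdeg (F : fieldType) (A : dgAlgebra F) (t : seq (helt A)) : int :=
  \sum_(a <- t) (deg a + 1).

Section Hochschild.
Variables (F : fieldType) (A : dgAlgebra F) (N : dgBimodule A).

Definition hfun : lmodType F := seq (helt A) -> N.

(* Hom(T(sA), N)_n: multilinear families, homogeneous of degree n *)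
Definition hochschild_piece (n : int) : {pred hfun} := fun f => `[<
  (forall s t, homog_linear (fun a : helt A => f (s ++ a :: t))) /\
  (forall t, f t \in piece N (n + bdeg t)) >].

Lemma hochschild_piece_closed n : submod_closed (hochschild_piece n).
Proof.
split.
  apply/asboolP; split=> [s t c a b e _ _ _|t]; first by rewrite scaler0 addr0.
  exact: (proj1 (piece_closed N _)).
move=> k f g /asboolP[fl fp] /asboolP[gl gp]; apply/asboolP; split.
  move=> s t c a b e da db ev.
  rewrite -![(k *: f + g) _]/(k *: f _ + g _).
  rewrite (fl s t c a b e da db ev) (gl s t c a b e da db ev).
  by rewrite !scalerDr !scalerA addrACA (mulrC k).
by move=> t; apply: (proj2 (piece_closed N _)); [exact: fp | exact: gp].
Qed.

Definition hochschild_space : gradedSpace F :=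
  GradedSpace hochschild_piece_closed.

(* The internal differential of T(sA) acts by d(sa) = - s(da); whence the plus
   sign in front of the sum:  D_0 f = d_N o f - (-1)^|f| f o d_{T(sA)}.       *)
Definition hochschild_D0 (n : int) (f : hfun) : hfun := fun t =>
  bm_d (n + bdeg t) (f t)
  + \sum_(i < size t) sgn F (n + bdeg (take i t)) *:
      f (take i t ++ hd (nth hone t i) :: drop i.+1 t).

Definition hochschild_D1 (n : int) (f : hfun) : hfun := fun t =>
  if t is a :: u then
    - (sgn F ((deg a + 1) * n) *: bm_l a (n + bdeg u) (f u))
    - \sum_(i < size u) sgn F (n + bdeg (take i.+1 t)) *:
        f (take i t ++ hmul (nth hone t i) (nth hone t i.+1) :: drop i.+2 t)
    + sgn F (n + bdeg (belast a u)) *: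
        bm_r (n + bdeg (belast a u)) (f (belast a u)) (last a u)
  else 0.

Definition hochschild_d (n : int) (f : hochschild_space) : hochschild_space :=
  hochschild_D0 n f + hochschild_D1 n f.

Lemma hochschild_d_linear n : linear (hochschild_d n).
Proof.
have linD (P Q : hfun -> N) :
    linear P -> linear Q -> linear (fun f => P f + Q f).
  by move=> lP lQ k f g; rewrite lP lQ scalerDr addrACA.
have linZ c (P : hfun -> N) : linear P -> linear (fun f => c *: P f).
  by move=> lP k f g; rewrite lP scalerDr !scalerA mulrC.
have linN (P : hfun -> N) : linear P -> linear (fun f => - P f).
  by move=> lP k f g; rewrite lP opprD scalerN.
have linS m (P : 'I_m -> hfun -> N) : (forall i, linear (P i)) ->
    linear (fun f => \sum_(i < m) P i f).
  move=> lP k f g; rewrite scaler_sumr -big_split.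
  by apply: eq_bigr => i _; rewrite lP.
have lin_ev t : linear (fun f : hfun => f t) by [].
move=> k f g; apply/funext => t.
rewrite -[RHS]/(k *: hochschild_d n f t + hochschild_d n g t).
move: k f g; rewrite -[forall k f g, _]/(linear (fun f => hochschild_d n f t)).
apply: (linD (hochschild_D0 n ^~ t) (hochschild_D1 n ^~ t)).
  apply: (linD) => [k f g|]; first by rewrite lin_ev bm_d_linear.
  by apply: (linS) => i; apply: (linZ); apply: (lin_ev).
case: t => [|a u]; first by move=> k f g; rewrite scaler0 addr0.
apply: (linD); last first.
  by apply: (linZ) => k f g; rewrite lin_ev (bm_r_linear (last a u)).
apply: (linD).
  by apply: (linN); apply: (linZ) => k f g; rewrite lin_ev bm_l_linear.
by apply: (linN); apply: (linS) => i; apply: (linZ); apply: (lin_ev).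
Qed.

Definition hochschild : precomplex F := Precomplex hochschild_d_linear.

End Hochschild.

Notation HH N n := (homology (hochschild N) n).

Section Gerstenhaber.
Variables (F : fieldType) (A : dgAlgebra F).

Notation C := (hochschild (self_bimodule A)).

Definition hochschild_one : C :=
  fun t => if t is [::] then dga_one A else 0.

(* m is the degree of g *)
Definition hochschild_cup (m : int) (f g : C) : C := fun t =>
  \sum_(p < (size t).+1)
    sgn F (m * bdeg (take p t)) *: dga_mul (f (take p t) : A) (g (drop p t)).

(* Sum of the insertions of g, of degree m, into f: the suspension of g, of
   degree m + 1, moves past t1.                                               *)
Definition hochschild_circ (m : int) (f g : C) : C := fun t =>
  \sum_(q < (size t).+1) \sum_(p < q.+1)
    let t1 := take p t in
    let t2 := drop p (take q t) in
    let t3 := drop q t in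
    sgn F ((m + 1) * bdeg t1) *:
      f (t1 ++ mkhomog (V := dga_space A) (m + bdeg t2) (g t2) :: t3).

(* n and m are the degrees of f and g *)
Definition hochschild_bracket (n m : int) (f g : C) : C :=
  hochschild_circ m f g
  - sgn F ((n + 1) * (m + 1)) *: hochschild_circ n g f.

Definition HH_one : HH (self_bimodule A) 0 := hclass C 0 hochschild_one.

Definition HH_cup (n m : int) (x : HH (self_bimodule A) n)
    (y : HH (self_bimodule A) m) : HH (self_bimodule A) (n + m) :=
  hclass C (n + m) (hochschild_cup m (hrepr x) (hrepr y)).

Definition HH_bracket (n m : int) (x : HH (self_bimodule A) n)
    (y : HH (self_bimodule A) m) : HH (self_bimodule A) (n + m + 1) :=
  hclass C (n + m + 1) (hochschild_bracket n m (hrepr x) (hrepr y)).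

End Gerstenhaber.

Section Connes.
Variables (F : fieldType) (A : dgAlgebra F).

Notation C := (hochschild (dual_bimodule A)).

(* Functionals on A (x) T(sA); the word a_0 :: t stands for a_0[t]. *)
Definition chain_dual := seq (helt A) -> F.

(* C^*(A;A^vee) = C_*(A;A)^vee, with the Koszul sign of moving a_0 past t; this
   sign is what makes it an isomorphism of complexes.                         *)
Definition to_chain_dual (g : C) : chain_dual := fun w =>
  if w is a0 :: t then sgn F (deg a0 * bdeg t) * (g t : dual_sort A) a0 else 0.

Definition of_chain_dual (m : chain_dual) : C := fun t =>
  (fun a0 => sgn F (deg a0 * bdeg t) * m (a0 :: t)) : dual_sort A.

(* m precomposed with the rotation of words by i letters, with the Koszul sign
   of permuting the suspended letters                                         *)
Definition rot_dual (i : nat) (m : chain_dual) : chain_dual := fun w =>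
  sgn F (bdeg (take i w) * bdeg (drop i w)) * m (rot i w).

(* m |-> m o B, where B = - (1 - t) s N is Connes' boundary on the unnormalized
   complex: N is the sum of all signed rotations, s puts the unit in front of a
   word, and t is the signed rotation moving the last letter to the front.  On
   normalized chains the term in t vanishes, and
     B(a_0[a_1|...|a_n]) = - sum_i (+/-) 1[a_i|...|a_n|a_0|...|a_(i-1)].
   The overall sign is the one of a degree 1 operator passing the desuspension
   in A (x) T(sA) = s^-1 (sA (x) T(sA)).                                      *)
Definition connes_B (m : chain_dual) : chain_dual := fun w =>
  - \sum_(i < size w)
      rot_dual i (fun v => m (hone :: v) - rot_dual (size v) m (hone :: v)) w.

(* B^vee(m) = (-1)^|m| m o B, for |m| = n *)
Definition connes_coboundary (n : int) (g : C) : C :=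
  sgn F n *: of_chain_dual (connes_B (to_chain_dual g)).

Definition HH_connes (n : int) (x : HH (dual_bimodule A) n) :
    HH (dual_bimodule A) (n + 1) :=
  hclass C (n + 1) (connes_coboundary n (hrepr x)).

End Connes.

Record is_bimodule_map (F : fieldType) (A : dgAlgebra F) (M N : dgBimodule A)
    (d : int) (phi : M -> N) : Prop := IsBimoduleMap {
  bmap_linear : linear phi;
  bmap_piece : forall j x, x \in piece M j -> phi x \in piece N (j + d);
  bmap_d : forall j x, x \in piece M j ->
    bm_d (j + d) (phi x) = sgn F d *: phi (bm_d j x);
  bmap_l : forall a j x, x \in piece M j ->
    phi (bm_l a j x) = sgn F (d * deg a) *: bm_l a (j + d) (phi x);
  bmap_r : forall a j x, x \in piece M j ->
    phi (bm_r j x a) = bm_r (j + d) (phi x) a }.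

Definition homology_map (F : fieldType) (C C' : precomplex F) (n m : int)
    (phi : C -> C') (x : homology C n) : homology C' m :=
  hclass C' m (phi (hrepr x)).

Arguments homology_map {F C C' n m} phi x.

Definition is_quasi_iso (F : fieldType) (C C' : precomplex F) (d : int)
    (phi : C -> C') : Prop :=
  forall n : int, bijective (@homology_map F C C' n (n + d) phi).

Section Theta.
Variables (F : fieldType) (A : dgAlgebra F) (d : int).
Variable Theta : self_bimodule A -> dual_bimodule A.

(* f |-> Theta o f, with the Koszul sign (-1)^(d|f|) of exchanging Theta and f:
   it is then the left action f |-> f.c on the class c = Theta(1), and commutes
   with the differentials also for odd d (Theta o - anticommutes with them).
   The sign is trivial for even d; for odd d, dropping it would replace the
   operator Delta below by - Delta, which violates the sign of [bv_bracket].  *)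
Definition theta_cochain (n : int) (f : hochschild (self_bimodule A)) :
    hochschild (dual_bimodule A) :=
  sgn F (d * n) *: ((fun t => Theta (f t)) : hochschild (dual_bimodule A)).

Definition HH_theta (n : int) :
    HH (self_bimodule A) n -> HH (dual_bimodule A) (n + d) :=
  homology_map (theta_cochain n).

End Theta.

Section BV.
Variables (F : fieldType) (G : int -> lmodType F).

Definition gcast (i j : int) (e : i = j) (x : G i) : G j :=
  eq_rect i (fun k => G k) x j e.

Variables (one : G 0) (mul : forall i j, G i -> G j -> G (i + j)).
Variable br : forall i j, G i -> G j -> G (i + j + 1).
Variable Delta : forall i, G i -> G (i + 1).

Arguments mul {i j}.
Arguments br {i j}.
Arguments Delta {i}.

Record is_gerstenhaber : Prop := IsGerstenhaber {
  ger_mul_linear_l : forall i j (b : G j), linear (fun a : G i => mul a b);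
  ger_mul_linear_r : forall i j (a : G i), linear (fun b : G j => mul a b);
  ger_mulA : forall i j k (a : G i) (b : G j) (c : G k)
    (e : i + (j + k) = i + j + k),
    gcast e (mul a (mul b c)) = mul (mul a b) c;
  ger_mul1l : forall i (a : G i) (e : 0 + i = i), gcast e (mul one a) = a;
  ger_mul1r : forall i (a : G i) (e : i + 0 = i), gcast e (mul a one) = a;
  ger_mulC : forall i j (a : G i) (b : G j) (e : j + i = i + j),
    mul a b = sgn F (i * j) *: gcast e (mul b a);
  ger_br_linear_l : forall i j (b : G j), linear (fun a : G i => br a b);
  ger_br_linear_r : forall i j (a : G i), linear (fun b : G j => br a b);
  ger_br_anti : forall i j (a : G i) (b : G j) (e : j + i + 1 = i + j + 1),
    br a b = - (sgn F ((i + 1) * (j + 1)) *: gcast e (br b a));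
  ger_jacobi : forall i j k (a : G i) (b : G j) (c : G k)
    (e1 : i + j + 1 + k + 1 = i + (j + k + 1) + 1)
    (e2 : j + (i + k + 1) + 1 = i + (j + k + 1) + 1),
    br a (br b c) =
      gcast e1 (br (br a b) c)
      + sgn F ((i + 1) * (j + 1)) *: gcast e2 (br b (br a c));
  ger_poisson : forall i j k (a : G i) (b : G j) (c : G k)
    (e1 : i + j + 1 + k = i + (j + k) + 1)
    (e2 : j + (i + k + 1) = i + (j + k) + 1),
    br a (mul b c) =
      gcast e1 (mul (br a b) c)
      + sgn F ((i + 1) * j) *: gcast e2 (mul b (br a c)) }.

Record is_batalin_vilkovisky : Prop := IsBatalinVilkovisky {
  bv_gerstenhaber : is_gerstenhaber;
  bv_linear : forall i, linear (@Delta i);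
  bv_square : forall i (a : G i), Delta (Delta a) = 0;
  bv_bracket : forall i j (a : G i) (b : G j)
    (e1 : i + 1 + j = i + j + 1) (e2 : i + (j + 1) = i + j + 1),
    br a b =
      sgn F i *: (Delta (mul a b) - gcast e1 (mul (Delta a) b)
                  - sgn F i *: gcast e2 (mul a (Delta b))) }.

End BV.

Section Delta.
Variables (F : fieldType) (A : dgAlgebra F) (d : int).
Variable Theta : self_bimodule A -> dual_bimodule A.

Definition HH_theta_inv (n : int) (y : HH (dual_bimodule A) (n + d)) :
    HH (self_bimodule A) n :=
  xget 0 [set x | HH_theta d Theta x = y].

Definition HH_delta (n : int) (x : HH (self_bimodule A) n) :
    HH (self_bimodule A) (n + 1) :=
  HH_theta_inv
    (gcast (G := fun k => HH (dual_bimodule A) k) (addrAC n d 1)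
      (HH_connes (HH_theta d Theta x))).

End Delta.

(* The chain-level formulas act on cohomology classes; in particular the
   operations above do not depend on the representatives [hrepr].             *)
Record HH_operations_induced (F : fieldType) (A : dgAlgebra F) (d : int)
    (Theta : self_bimodule A -> dual_bimodule A) : Prop := HHOperationsInduced {
  HH_one_induced :
    @hochschild_one F A \in cycle (hochschild (self_bimodule A)) 0;
  HH_cup_induced : forall n m,
    induced2 (@hochschild_cup F A m) (@HH_cup F A n m);
  HH_bracket_induced : forall n m,
    induced2 (@hochschild_bracket F A n m) (@HH_bracket F A n m);
  HH_connes_induced : forall n,
    induced1 (@connes_coboundary F A n) (@HH_connes F A n);
  HH_theta_induced : forall n,
    induced1 (theta_cochain d Theta n) (@HH_theta F A d Theta n) }.

(* Main.v *)
From HB Require Import structures.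
From mathcomp Require Import all_boot all_order all_algebra.
From mathcomp Require Import boolp classical_sets functions.
From mathcomp Require Import ring zify.
From Stdlib Require Import Btauto.
Require Import Defs.

(** The differential graded algebra [A] is encoded by one cochain, [struct], and
    all the operations on cochains are sums over the ways to cut a word into pieces.
    Inserting cochains into each other satisfies the pre-Lie identity [preLie],
    and the Hochschild differential is the commutator with [struct]
    ([hochschild_d_ins]). Hence the Jacobi identity holds strictly
    ([bracket_jacobi]), the boundary of an insertion is the commutator of the cup
    product ([hochschild_d_circ]), and the boundary of the double insertion
    [f{g,h}] is the failure of the bracket to be a derivation of the cup product
    ([hochschild_d_brace]). This gives the Gerstenhaber algebra.

    The map induced by [Theta] is bijective because the mapping cone of [Theta] is
    an acyclic bimodule. Over a field an acyclic complex is contractible, and a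
    contraction of the coefficients improves a Hochschild cocycle to a coboundary
    step by step in the length of words ([hochschild_acyclic]).

    Cochains with coefficients in the dual of [A] are functionals on cyclic words
    with a marked letter; their differential inserts [struct] into a cyclic word
    ([hochschild_d_dual]). Connes' operator puts a unit in front of the word and
    sums over all rotations. It is homotopic to its nondegenerate part [connes1],
    and it squares to zero because a sum over all rotations is invariant under
    rotation.

    Since [Theta] is right linear, [(Theta x) a] is [trace (x a)] for the functional
    [trace = Theta 1]; since it is also left linear and a chain map, [trace] is a
    closed graded trace. For cocycles [f] and [g], consider the functional which
    opens a cyclic word in all possible ways and takes the trace of [f] applied to
    the result, with [g] inserted to the right of the marked letter. Its boundary
    has three parts. If the marked letter is multiplied with the value of [f] it
    is the image of the insertion of [g] into [f]; if it is multiplied with the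
    value of [g] it is the product of [g] with Connes' operator of [f]; and if the
    values of [f] and [g] are multiplied it is the half of Connes' operator of the
    product of [f] and [g] in which the marked letter is fed to [f]
    ([theta_circ_homotopy]). After antisymmetrisation the two halves add up, and
    the boundary is, up to signs, the bracket of [f] and [g] minus the failure of
    Connes' operator to be a derivation ([bv_homotopy]). As [Theta] is linear, this
    is the Batalin-Vilkovisky identity. *)

Set Implicit Arguments.
Unset Strict Implicit.
Unset Printing Implicit Defensive.

Import Order.TTheory GRing.Theory Num.Theory.

Local Open Scope ring_scope.

(** * Linear identities *)

(** Identities between linear combinations are proved by reflection: equality
    holds as soon as the coefficients of each atom agree. *)
Section LinearExpressions.
Variables (F : fieldType) (V : lmodType F).

Inductive lexp :=
  | LVar of nat
  | LZero
  | LAdd of lexp & lexp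
  | LOpp of lexp
  | LScale of F & lexp.

Fixpoint leval (env : seq V) (e : lexp) : V :=
  match e with
  | LVar i => nth 0 env i
  | LZero => 0
  | LAdd e1 e2 => leval env e1 + leval env e2
  | LOpp e1 => - leval env e1
  | LScale c e1 => c *: leval env e1
  end.

Fixpoint lcoef (i : nat) (e : lexp) : F :=
  match e with
  | LVar j => if eqn i j then 1 else 0
  | LZero => 0
  | LAdd e1 e2 => lcoef i e1 + lcoef i e2
  | LOpp e1 => - lcoef i e1
  | LScale c e1 => c * lcoef i e1
  end.

Lemma leval_lcoef env e :
  leval env e = \sum_(i < size env) lcoef i e *: env`_i.
Proof.
elim: e => [j||e1 IH1 e2 IH2|e1 IH1|c e1 IH1] /=.
- have [lt_j|ge_j] := ltnP j (size env).
    rewrite (bigD1 (Ordinal lt_j)) //= -[eqn j j]/(j == j) eqxx scale1r.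
    rewrite big1 ?addr0 // => i; rewrite -val_eqE /= => ne.
    by rewrite -[eqn i j]/((i : nat) == j) (negPf ne) scale0r.
  rewrite nth_default // big1 // => i _.
  by rewrite -[eqn i j]/((i : nat) == j) ltn_eqF ?scale0r // (leq_trans (ltn_ord i)).
- by rewrite big1 // => i _; rewrite scale0r.
- by rewrite IH1 IH2 -big_split; apply: eq_bigr => i _; rewrite scalerDl.
- by rewrite IH1 -sumrN; apply: eq_bigr => i _; rewrite scaleNr.
- by rewrite IH1 scaler_sumr; apply: eq_bigr => i _; rewrite scalerA.
Qed.

Fixpoint lgoals (n : nat) (e1 e2 : lexp) : Prop :=
  if n is n'.+1 then lcoef n' e1 = lcoef n' e2 /\ lgoals n' e1 e2 else True.

Lemma lexp_eq env e1 e2 :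
  lgoals (size env) e1 e2 -> leval env e1 = leval env e2.
Proof.
rewrite !leval_lcoef => h; apply: eq_bigr => i _; congr (_ *: _).
case: i => i /=; elim: (size env) h => //= n IH [e h].
by rewrite ltnS leq_eqVlt => /orP[/eqP ->|/IH]; last exact.
Qed.

End LinearExpressions.

Arguments LVar {F}.
Arguments LZero {F}.

Ltac lin_head t := lazymatch t with ?f _ => lin_head f | _ => t end.

(* the canonical instances hidden in two copies of a term may differ *)
Ltac lin_same x y :=
  first [ constr_eq x y
        | let f := lin_head x in let g := lin_head y in constr_eq f g; unify x y ].

Ltac lin_index x env :=
  lazymatch env with
  | ?y :: ?env' =>
    match goal with
    | _ => let _ := match goal with _ => lin_same x y end in constr:(0%N)
    | _ => let i := lin_index x env' in constr:(S i)
    end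
  end.

Ltac lin_mem x env :=
  match goal with
  | _ => let _ := lin_index x env in constr:(true)
  | _ => constr:(false)
  end.

Ltac lin_env t env :=
  lazymatch t with
  | (?a + ?b)%R => let env1 := lin_env a env in lin_env b env1
  | (- ?a)%R => lin_env a env
  | (_ *: ?a)%R => lin_env a env
  | 0%R => env
  | _ => lazymatch lin_mem t env with
         | true => env
         | false => constr:(t :: env)
         end
  end.

Ltac lin_reify t env :=
  lazymatch t with
  | (?a + ?b)%R =>
      let x := lin_reify a env in let y := lin_reify b env in
      open_constr:(LAdd x y)
  | (- ?a)%R => let x := lin_reify a env in open_constr:(LOpp x)
  | (?c *: ?a)%R => let x := lin_reify a env in open_constr:(LScale c x)
  | 0%R => open_constr:(LZero)
  | _ => let i := lin_index t env in open_constr:(LVar i)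
  end.

Ltac lin_split := lazymatch goal with
  | |- True => exact I
  | |- _ /\ _ => split; [ | lin_split ]
  | _ => idtac
  end.

Ltac linear_coefs :=
  lazymatch goal with
  | |- @eq ?T ?t1 ?t2 =>
    let env0 := constr:(@nil T) in
    let env1 := lin_env t1 env0 in
    let env := lin_env t2 env1 in
    let e1 := lin_reify t1 env in
    let e2 := lin_reify t2 env in
    apply: (@lexp_eq _ _ env e1 e2); cbn [lgoals size lcoef eqn]; lin_split
  end.

(** * Signs *)

Definition par (i : int) : bool := odd `|i|%N.

Lemma sgn_par (F : fieldType) (i : int) : sgn F i = (-1) ^+ par i.
Proof.
rewrite /par; case: (intP i) => [|n|n]; first by rewrite expr0z.
  by rewrite -exprnP absz_nat signr_odd.
by rewrite abszN absz_nat -exprz_inv invrN1 -exprnP signr_odd.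
Qed.

Lemma parD i j : par (i + j) = xorb (par i) (par j).
Proof.
apply: (@signr_inj rat); rewrite -sgn_par sgnD !sgn_par -signr_addb.
by case: (par i); case: (par j).
Qed.

Lemma parM i j : par (i * j) = par i && par j.
Proof. by rewrite /par abszM oddM. Qed.

Lemma parN i : par (- i) = par i. Proof. by rewrite /par abszN. Qed.
Lemma par0 : par 0 = false. Proof. by []. Qed.
Lemma par1 : par 1 = true. Proof. by []. Qed.

Lemma sgn_eq_par (F : fieldType) (i j : int) :
  par i = par j -> sgn F i = sgn F j.
Proof. by rewrite !sgn_par => ->. Qed.

Section Scaling.
Variables (F : fieldType) (V : lmodType F).
Implicit Types (x : V) (i j : int).

Lemma sgnZZ i j x : sgn F i *: (sgn F j *: x) = sgn F (i + j) *: x.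
Proof. by rewrite scalerA sgnD. Qed.

Lemma sgnZN i x : - (sgn F i *: x) = sgn F (1 + i) *: x.
Proof. by rewrite sgnD expr1z mulN1r scaleNr. Qed.

Lemma sgnZ0 x : sgn F 0 *: x = x.
Proof. by rewrite expr0z scale1r. Qed.

Lemma sgnZ_par i j x : par i = par j -> sgn F i *: x = sgn F j *: x.
Proof. by move=> /sgn_eq_par ->. Qed.

End Scaling.

(** * Sums over the factorisations of a word *)

Section Cuts.
Variable T : Type.
Implicit Types (s t u v : seq T) (a : T).

(** All chain level operations are sums over the ways to cut a word into pieces;
    the structural recursion makes their associativity easy to prove, unlike the
    sums over positions. *)
Fixpoint cuts (V : nmodType) (G : seq T -> seq T -> V) t : V :=
  G [::] t + if t is a :: t' then cuts (fun u v => G (a :: u) v) t' else 0.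

Variable V : zmodType.
Implicit Types (G H : seq T -> seq T -> V).

Lemma eq_cuts G H t : (forall u v, G u v = H u v) -> cuts G t = cuts H t.
Proof.
move=> e; elim: t G H e => [|a t IH] G H e //=; rewrite e //.
by congr (_ + _); apply: IH.
Qed.

Lemma cuts_big G t :
  \sum_(p < (size t).+1) G (take p t) (drop p t) = cuts G t.
Proof.
elim: t G => [|a t IH] G; first by rewrite big_ord1 /= addr0.
by rewrite big_ord_recl /= -IH.
Qed.

Lemma cutsD G H t : cuts (fun u v => G u v + H u v) t = cuts G t + cuts H t.
Proof. by elim: t G H => [|a t IH] G H /=; rewrite ?IH ?addr0 // addrACA. Qed.

Lemma cutsN G t : cuts (fun u v => - G u v) t = - cuts G t.
Proof. by elim: t G => [|a t IH] G /=; rewrite ?IH ?addr0 // opprD. Qed.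

Lemma cuts0 t : cuts (fun _ _ => 0 : V) t = 0.
Proof. by elim: t => [|a t IH] /=; rewrite ?IH addr0. Qed.

Lemma cuts_zero G t : (forall u v, G u v = 0) -> cuts G t = 0.
Proof. by move=> e; rewrite (eq_cuts _ e) cuts0. Qed.

Lemma cuts_rcons G t a :
  cuts G (rcons t a) = cuts (fun u v => G u (rcons v a)) t + G (rcons t a) [::].
Proof.
by elim: t G => [|b t IH] G /=; rewrite ?addr0 // IH addrA.
Qed.

(** A cut of a word with a marked letter falls on either side of it. *)
Lemma cuts_mark G t a s :
  cuts G (t ++ a :: s) =
    cuts (fun u v => G u (v ++ a :: s)) t + cuts (fun u v => G (t ++ a :: u) v) s.
Proof.
elim: t G => [|b t IH] G /=; first by rewrite addr0.
by rewrite IH addrA.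
Qed.

Lemma cuts_assoc (K : seq T -> seq T -> seq T -> V) t :
  cuts (fun u v => cuts (fun x y => K x y v) u) t =
  cuts (fun x r => cuts (fun y v => K x y v) r) t.
Proof.
elim: t K => [|a t IH] K /=; first by rewrite !addr0.
by rewrite addr0 cutsD addrA (IH (fun x => K (a :: x))).
Qed.

Lemma cuts_exchange (K : seq T -> seq T -> seq T -> seq T -> V) s t :
  cuts (fun u v => cuts (fun x y => K u v x y) t) s =
  cuts (fun x y => cuts (fun u v => K u v x y) s) t.
Proof.
elim: s K => [|b s IH] K /=.
  by rewrite addr0; apply: eq_cuts => x y; rewrite addr0.
by rewrite cutsD (IH (fun u => K (b :: u))).
Qed.

End Cuts.

Arguments eq_cuts {T V G} H {t} _.

Notation "\cuts_ ( u | v <- t ) E" := (cuts (fun u v => E) t)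
  (at level 41, E at level 41, u name, v name, t at level 50,
   format "'[' \cuts_ ( u  |  v  <-  t ) '/  '  E ']'") : ring_scope.
Notation "\cuts_ ( u | v | w <- t ) E" :=
  (cuts (fun u z => cuts (fun v w => E) z) t)
  (at level 41, E at level 41, u name, v name, w name, t at level 50,
   format "'[' \cuts_ ( u  |  v  |  w  <-  t ) '/  '  E ']'") : ring_scope.

Lemma cutsZ (F : fieldType) (V : lmodType F) T (G : seq T -> seq T -> V) c t :
  \cuts_(u | v <- t) (c *: G u v) = c *: cuts G t.
Proof. by elim: t G => [|a t IH] G /=; rewrite ?IH ?addr0 // scalerDr. Qed.

Lemma cuts_map (U V : zmodType) T (h : U -> V) (G : seq T -> seq T -> U) t :
  (forall x y, h (x + y) = h x + h y) ->
  h (cuts G t) = \cuts_(u | v <- t) h (G u v).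
Proof.
move=> hD; have h0 : h 0 = 0 by apply: (@addrI _ (h 0)); rewrite -hD !addr0.
by elim: t G => [|a t IH] G /=; rewrite ?addr0 // hD IH.
Qed.

Lemma cuts3_big T (V : zmodType) (G : seq T -> seq T -> seq T -> V) t :
  \sum_(q < (size t).+1) \sum_(p < q.+1)
    G (take p t) (drop p (take q t)) (drop q t) = \cuts_(p | q | r <- t) G p q r.
Proof.
rewrite -cuts_assoc -cuts_big; apply: eq_bigr => q _; rewrite -cuts_big.
have e : size (take q t) = q by rewrite size_takel // -ltnS.
rewrite e; apply: eq_bigr => p _; congr (G _ _ _).
by rewrite take_takel // -ltnS.
Qed.

Section CutsIn.
Variable T : Type.
Implicit Types (t u v : seq T).

Lemma eq_cuts_in (V : zmodType) (G H : seq T -> seq T -> V) t :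
  (forall u v, t = u ++ v -> G u v = H u v) -> cuts G t = cuts H t.
Proof.
elim: t G H => [|a t IH] G H e /=; first by rewrite (e [::] [::]).
rewrite (e [::] (a :: t)) //; congr (_ + _).
by apply: IH => u v E; apply: e; rewrite E.
Qed.

Lemma cuts_ind (V : zmodType) (P : V -> Prop) (G : seq T -> seq T -> V) t :
  P 0 -> (forall x y, P x -> P y -> P (x + y)) ->
  (forall u v, t = u ++ v -> P (G u v)) -> P (cuts G t).
Proof.
move=> P0 PD; elim: t G => [|a t IH] G PG /=; first by rewrite addr0; exact: PG.
by apply: (PD); [exact: PG | apply: IH => u v e; apply: PG; rewrite e].
Qed.

Lemma cuts3_mark (V : zmodType) (K : seq T -> seq T -> seq T -> V) t c s :
  \cuts_(p | q | r <- t ++ c :: s) K p q r =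
    \cuts_(p | q | r <- t) K p q (r ++ c :: s)
    + \cuts_(p | x <- t) \cuts_(y | r <- s) K p (x ++ c :: y) r
    + \cuts_(p | q | r <- s) K (t ++ c :: p) q r.
Proof.
rewrite cuts_mark -cutsD; congr (_ + _).
by apply: eq_cuts => u v; rewrite cuts_mark.
Qed.

End CutsIn.

Section Reassociation.
Variables (T : Type) (V : zmodType).
Variable K : seq T -> seq T -> seq T -> seq T -> seq T -> V.

(** Two successive cuts into three pieces are a cut into five pieces, wherever the
    second one takes place. *)
Lemma cuts_assocl t :
  \cuts_(p | q | r <- t) \cuts_(x | y | z <- p) K x y z q r =
  \cuts_(x | y | w <- t) \cuts_(z | q | r <- w) K x y z q r.
Proof.
under eq_cuts => p v.
  rewrite (cuts_exchange (fun q r x u => \cuts_(y | z <- u) K x y z q r)); over.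
rewrite (cuts_assoc (fun x u v => \cuts_(q | r <- v) \cuts_(y | z <- u)
  K x y z q r)); apply: eq_cuts => x w.
under eq_cuts => u v.
  rewrite (cuts_exchange (fun q r y z => K x y z q r)); over.
by rewrite (cuts_assoc (fun y z v => \cuts_(q | r <- v) K x y z q r)).
Qed.

Lemma cuts_assocm t :
  \cuts_(p | q | r <- t) \cuts_(x | y <- p) \cuts_(z | w <- r) K x y q z w =
  \cuts_(x | v | w <- t) \cuts_(y | q | z <- v) K x y q z w.
Proof.
under eq_cuts => p v.
  rewrite (cuts_exchange (fun q r x y => \cuts_(z | w <- r) K x y q z w)); over.
rewrite (cuts_assoc (fun x y v => \cuts_(q | r <- v) \cuts_(z | w <- r)
  K x y q z w)); apply: eq_cuts => x u.
under eq_cuts => y v.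
  rewrite -(cuts_assoc (fun q z w => K x y q z w)); over.
by rewrite -(cuts_assoc (fun y v w => \cuts_(q | z <- v) K x y q z w)).
Qed.

End Reassociation.

Section ConcentratedCuts.
Variables (T : Type) (V : zmodType) (G : seq T -> seq T -> V).

Lemma cuts_head t : (forall a u v, G (a :: u) v = 0) -> cuts G t = G [::] t.
Proof.
move=> G0; case: t => [|a t] /=; first by rewrite addr0.
by rewrite cuts_zero ?addr0.
Qed.

End ConcentratedCuts.

Lemma cuts_tail (T : Type) (V : zmodType) (G : seq T -> seq T -> V) t :
  (forall a u v, G u (a :: v) = 0) -> cuts G t = G t [::].
Proof.
elim: t G => [|a t IH] G G0 /=; first by rewrite addr0.
by rewrite G0 add0r IH.
Qed.

Lemma cuts_assoc4 (T : Type) (V : zmodType)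
    (K : seq T -> seq T -> seq T -> seq T -> V) t :
  \cuts_(u | w <- t) \cuts_(p | q | v <- u) K p q v w =
  \cuts_(p | q | y <- t) \cuts_(v | w <- y) K p q v w.
Proof.
rewrite [LHS](cuts_assoc (fun p y w => \cuts_(q | v <- y) K p q v w)).
by apply: eq_cuts => p z; rewrite [LHS](cuts_assoc (fun q v w => K p q v w)).
Qed.

(** * Insertion of a cochain into a function of words *)

Section Letters.
Variables (F : fieldType) (A : dgAlgebra F).
Implicit Types (s t : seq (helt A)) (a : helt A).

Lemma bdeg_nil : bdeg (A := A) [::] = 0.
Proof. by rewrite /bdeg big_nil. Qed.

Lemma bdeg_cons a t : bdeg (a :: t) = deg a + 1 + bdeg t.
Proof. by rewrite /bdeg big_cons. Qed.

Lemma bdeg_cat s t : bdeg (s ++ t) = bdeg s + bdeg t.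
Proof. by rewrite /bdeg big_cat. Qed.

Lemma bdeg_rcons s a : bdeg (rcons s a) = bdeg s + (deg a + 1).
Proof. by rewrite -cats1 bdeg_cat bdeg_cons bdeg_nil addr0. Qed.

Lemma deg_mkhomog (V : gradedSpace F) k (x : V) : deg (mkhomog k x) = k.
Proof. by rewrite /mkhomog; case: {-}_ / idP. Qed.

Lemma hval_mkhomog (V : gradedSpace F) k (x : V) :
  x \in piece V k -> hval (mkhomog k x) = x.
Proof. by rewrite /mkhomog => h; case: {-}_ / idP. Qed.

End Letters.

Section Slots.
Variables (F : fieldType) (A : dgAlgebra F) (V : lmodType F).
Variable f : helt A -> V.
Hypothesis f_lin : homog_linear f.

Let gc := @gr_closed F A.

Lemma slotP c k (x y : A) : x \in gr (d := A) k -> y \in gr (d := A) k ->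
  f (mkhomog (V := dga_space A) k (c *: x + y)) =
  c *: f (mkhomog (V := dga_space A) k x) + f (mkhomog (V := dga_space A) k y).
Proof.
move=> xk yk; apply: f_lin; rewrite ?deg_mkhomog //.
by rewrite !hval_mkhomog //; exact: (proj2 (gc k)).
Qed.

Lemma slot0 k : f (mkhomog (V := dga_space A) k 0) = 0.
Proof.
have := slotP (-1) (proj1 (gc k)) (proj1 (gc k)).
by rewrite scaler0 addr0 scaleN1r addNr.
Qed.

Lemma slotD k (x y : A) : x \in gr (d := A) k -> y \in gr (d := A) k ->
  f (mkhomog (V := dga_space A) k (x + y)) =
  f (mkhomog (V := dga_space A) k x) + f (mkhomog (V := dga_space A) k y).
Proof. by move=> xk yk; rewrite -[x in LHS]scale1r slotP // scale1r. Qed.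

Lemma slotZ k c (x : A) : x \in gr (d := A) k ->
  f (mkhomog (V := dga_space A) k (c *: x)) =
  c *: f (mkhomog (V := dga_space A) k x).
Proof.
move=> xk; rewrite -[c *: x]addr0 slotP ?slot0 ?addr0 //.
exact: (proj1 (gc k)).
Qed.

End Slots.

Section PieceClosure.
Variables (F : fieldType) (G : gradedSpace F).
Implicit Types (x y : G) (k : int).

Lemma piece0 k : (0 : G) \in piece G k.
Proof. exact: (proj1 (piece_closed G k)). Qed.

Lemma pieceP k c x y :
  x \in piece G k -> y \in piece G k -> c *: x + y \in piece G k.
Proof. exact: (proj2 (piece_closed G k)). Qed.

Lemma pieceD k x y : x \in piece G k -> y \in piece G k -> x + y \in piece G k.
Proof. by move=> px py; rewrite -[x]scale1r; apply: pieceP. Qed.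

Lemma pieceZ k c x : x \in piece G k -> c *: x \in piece G k.
Proof. by move=> px; rewrite -[_ *: _]addr0; apply: pieceP => //; exact: piece0. Qed.

Lemma pieceN k x : x \in piece G k -> - x \in piece G k.
Proof. by rewrite -scaleN1r; exact: pieceZ. Qed.

Lemma pieceB k x y : x \in piece G k -> y \in piece G k -> x - y \in piece G k.
Proof. by move=> px py; apply: pieceD => //; exact: pieceN. Qed.

Lemma piece_cast i j x : x \in piece G i -> i = j -> x \in piece G j.
Proof. by move=> + <-. Qed.

Lemma piece_cuts T k (K : seq T -> seq T -> G) t :
  (forall u v, t = u ++ v -> K u v \in piece G k) -> cuts K t \in piece G k.
Proof.
by move=> h; apply: (@cuts_ind _ _ (fun x => x \in piece G k));
  [exact: piece0 | exact: pieceD | exact: h].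
Qed.

End PieceClosure.

Lemma gr_cast (F : fieldType) (A : dgAlgebra F) i j (x : A) :
  x \in gr (d := A) i -> i = j -> x \in gr (d := A) j.
Proof. by move=> + <-. Qed.

Section Insertion.
Variables (F : fieldType) (A : dgAlgebra F).
Implicit Types (s t u v p q r : seq (helt A)) (a c : helt A).
Implicit Types (g : seq (helt A) -> A).

Local Notation gr' k := (piece (dga_space A) k).

Definition multilinear (V : lmodType F) (phi : seq (helt A) -> V) : Prop :=
  forall s t, homog_linear (fun a : helt A => phi (s ++ a :: t)).

Definition cochain (m : int) g : Prop :=
  multilinear g /\ forall t, g t \in gr' (m + bdeg t).

(** The degree is the nominal one even where [g t] vanishes, so that signs depend
    on the degree of [t] alone. *)
Definition letter (m : int) g t : helt A :=
  mkhomog (V := dga_space A) (m + bdeg t) (g t).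

Lemma deg_letter m g t : deg (letter m g t) = m + bdeg t.
Proof. exact: deg_mkhomog. Qed.

Lemma hval_letter m g t : cochain m g -> hval (letter m g t) = g t.
Proof. by case=> _ gp; exact: hval_mkhomog. Qed.

(** The codomain is arbitrary: [phi] may be a cochain with any coefficients or a
    functional on chains. *)
Definition ins (V : lmodType F) (m : int) g (phi : seq (helt A) -> V) t : V :=
  \cuts_(p | q | r <- t)
    (sgn F ((m + 1) * bdeg p) *: phi (p ++ letter m g q :: r)).

Lemma circE m (f g : seq (helt A) -> A) :
  hochschild_circ m (f : hochschild (self_bimodule A)) g = ins m g f.
Proof. by apply/funext => t; rewrite /ins -cuts3_big. Qed.

Lemma slot_cuts (V : lmodType F) (f : helt A -> V) k
    (K : seq (helt A) -> seq (helt A) -> A) t : homog_linear f ->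
  (forall u v, t = u ++ v -> K u v \in gr' k) ->
  f (mkhomog (V := dga_space A) k (cuts K t)) =
  \cuts_(u | v <- t) f (mkhomog (V := dga_space A) k (K u v)).
Proof.
move=> fl; elim: t K => [|a t IH] K Kp /=.
  by rewrite !addr0.
rewrite slotD ?IH //; first by move=> u v e; apply: Kp; rewrite e.
  exact: Kp.
by apply: (@piece_cuts _ (dga_space A)) => u v e; apply: Kp; rewrite e.
Qed.

Lemma multilinearD (V : lmodType F) (phi psi : seq (helt A) -> V) :
  multilinear phi -> multilinear psi -> multilinear (fun t => phi t + psi t).
Proof.
move=> lp lq s t c a b e da db ev.
rewrite (lp s t c a b e da db ev) (lq s t c a b e da db ev).
by rewrite scalerDr addrACA.
Qed.

Lemma multilinearZ (V : lmodType F) k (phi : seq (helt A) -> V) :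
  multilinear phi -> multilinear (fun t => k *: phi t).
Proof.
move=> lp s t c a b e da db ev.
by rewrite (lp s t c a b e da db ev) scalerDr !scalerA mulrC.
Qed.

Lemma homog_linear_cuts (V : lmodType F) (K : helt A -> seq (helt A) -> seq (helt A) -> V) t :
  (forall u v, homog_linear (fun a => K a u v)) ->
  homog_linear (fun a => cuts (K a) t).
Proof.
move=> lK c a b e da db ev.
rewrite -cutsZ -cutsD; apply: eq_cuts => u v; exact: lK.
Qed.

Lemma homog_linearZ (V : lmodType F) k (f : helt A -> V) :
  homog_linear f -> homog_linear (fun a => k *: f a).
Proof.
by move=> lf c a b e da db ev; rewrite (lf c a b e) // scalerDr !scalerA mulrC.
Qed.

Lemma homog_linear_sgn (V : lmodType F) (w : int -> int) (f : helt A -> V) :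
  homog_linear f -> homog_linear (fun a => sgn F (w (deg a)) *: f a).
Proof.
move=> lf c a b e da db ev.
by rewrite (lf c a b e) // scalerDr !scalerA mulrC da db.
Qed.

Lemma homog_linear_letter (V : lmodType F) m g (f : helt A -> V) s t :
  cochain m g -> homog_linear f ->
  homog_linear (fun a => f (letter m g (s ++ a :: t))).
Proof.
move=> [gl gp] lf c a b e da db ev.
apply: lf; rewrite ?deg_letter ?bdeg_cat ?bdeg_cons ?da ?db //.
rewrite !hval_letter //; exact: gl.
Qed.

End Insertion.

Ltac psimp :=
  rewrite ?(bdeg_rcons, bdeg_cons, bdeg_nil, bdeg_cat, deg_mkhomog, deg_letter) /=
          ?(parD, parM, parN, par0, par1) /=.
Ltac psolve := psimp; btauto.

Lemma sgn_if (F : fieldType) i : sgn F i = if par i then -1 else 1.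
Proof. by rewrite sgn_par; case: (par i). Qed.

Section SignCoefficients.
Variable F : fieldType.
Implicit Types (x y : bool).

Lemma sgn_if_mul x y : (if x then -1 else 1) * (if y then -1 else 1) =
  (if xorb x y then -1 else 1) :> F.
Proof. by case: x y => -[]; rewrite ?mulr1 ?mul1r ?mulN1r ?opprK. Qed.

Lemma sgn_if_opp x : - (if x then -1 else 1) = (if negb x then -1 else 1) :> F.
Proof. by case: x; rewrite ?opprK. Qed.

Lemma eq_sgn_if x y :
  x = y -> (if x then -1 else 1) = (if y then -1 else 1) :> F.
Proof. by move=> ->. Qed.

End SignCoefficients.

Ltac par_cases := repeat match goal with |- context [par ?x] => case: (par x) end.
(* signs are compared as boolean polynomials in the parities; sums of several
   signs are treated by cases *)
Ltac sgn_coef :=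
  rewrite ?sgn_if; psimp;
  rewrite ?(mulr0, mul0r, oppr0, addr0, add0r, subr0, sub0r, mulr1, mul1r, mulrN,
    mulNr, opprK);
  rewrite ?(sgn_if_mul, sgn_if_opp);
  first [ reflexivity | apply: eq_sgn_if; btauto
        | par_cases => /=; ring ].
Ltac linear_sgn := linear_coefs; sgn_coef.

Section PreLie.
Variables (F : fieldType) (A : dgAlgebra F) (V : lmodType F).
Implicit Types (s t u v p q r : seq (helt A)) (a c : helt A).
Implicit Types (g h : seq (helt A) -> A) (phi : seq (helt A) -> V).


Lemma homog_linearD' (f1 f2 : helt A -> V) :
  homog_linear f1 -> homog_linear f2 -> homog_linear (fun a => f1 a + f2 a).
Proof.
move=> l1 l2 c a b e da db ev.
by rewrite (l1 c a b e) // (l2 c a b e) // scalerDr addrACA.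
Qed.

Lemma ins_multilinear m g phi :
  cochain m g -> multilinear phi -> multilinear (ins m g phi).
Proof.
move=> cg lphi s t.
have -> : (fun a => ins m g phi (s ++ a :: t)) = (fun a =>
    \cuts_(p | q | r <- s) (sgn F ((m + 1) * bdeg p) *:
       phi ((p ++ letter m g q :: r) ++ a :: t))
  + \cuts_(p | x <- s) \cuts_(y | r <- t) (sgn F ((m + 1) * bdeg p) *:
       phi (p ++ letter m g (x ++ a :: y) :: r))
  + \cuts_(p | q | r <- t) (sgn F ((m + 1) * (bdeg s + (deg a + 1 + bdeg p))) *:
       phi (s ++ a :: (p ++ letter m g q :: r)))).
  apply/funext => a; rewrite /ins cuts3_mark; congr (_ + _ + _).
    by do 2!apply: eq_cuts => *; rewrite -catA.
  by do 2!apply: eq_cuts => *; rewrite -catA bdeg_cat bdeg_cons.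
apply: homog_linearD'; first apply: homog_linearD'.
- by do 2!apply: homog_linear_cuts => ? ?; apply: homog_linearZ; apply: lphi.
- do 2!apply: homog_linear_cuts => ? ?; apply: homog_linearZ.
  exact: (homog_linear_letter _ _ cg (lphi _ _)).
- do 2!apply: homog_linear_cuts => ? ?.
  apply: (homog_linear_sgn (fun i => (m + 1) * (bdeg s + (i + 1 + bdeg _)))).
  exact: lphi.
Qed.

(** The part of the double insertion in which neither of [g] and [h] is inside the
    other one. *)
Definition ins2 m g k h phi t : V :=
  \cuts_(p | q | r <- t) \cuts_(x | y | z <- r)
    (sgn F ((m + 1) * bdeg p + (k + 1) * (bdeg p + bdeg q + bdeg x)) *:
       phi (p ++ letter m g q :: x ++ letter k h y :: z)).

(** The second insertion takes place to the right of [g], to its left, or inside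
    it; the first two cases are symmetric in [g] and [h], up to sign. *)
Lemma preLie m g k h phi t : cochain m g -> cochain k h -> multilinear phi ->
  ins k h (ins m g phi) t =
    ins2 m g k h phi t + sgn F ((m + 1) * (k + 1)) *: ins2 k h m g phi t
    + ins (m + k + 1) (ins k h g) phi t.
Proof.
move=> cg ch lphi; rewrite {1}/ins.
under eq_cuts => p w do under eq_cuts => q r do
  rewrite /ins cuts3_mark !scalerDr.
under eq_cuts => p w do rewrite !cutsD.
rewrite !cutsD addrAC; congr (_ + _ + _).
- rewrite /ins2 -(cuts_assocl (fun p q x y z => sgn F _ *: phi _)).
  do 2!apply: eq_cuts => *; rewrite -cutsZ; apply: eq_cuts_in => x v ->.
  rewrite -cutsZ; apply: eq_cuts_in => y z ->.
  rewrite sgnZZ; apply: sgnZ_par; psolve.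
- rewrite /ins2 -cutsZ; apply: eq_cuts => p w; rewrite -cutsZ; apply: eq_cuts => q r.
  rewrite -!cutsZ; apply: eq_cuts => x v; rewrite -!cutsZ; apply: eq_cuts => y z.
  rewrite !sgnZZ -catA /=; apply: sgnZ_par; psolve.
- transitivity (\cuts_(p | w | r <- t) \cuts_(x | q | y <- w)
    (sgn F ((m + k + 1 + 1) * bdeg p + (k + 1) * bdeg x) *:
      phi (p ++ letter m g (x ++ letter k h q :: y) :: r))).
    rewrite -(cuts_assocm (fun p x q y r => sgn F _ *: phi _)).
    apply: eq_cuts => p w; apply: eq_cuts => q r; rewrite -cutsZ.
    apply: eq_cuts_in => x y ->; rewrite -cutsZ; apply: eq_cuts => z v.
    rewrite sgnZZ; apply: sgnZ_par; psolve.
  apply: eq_cuts => p w; apply: eq_cuts => q r.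
  rewrite [letter (m + k + 1) _ _]/letter /ins.
  rewrite (@slot_cuts _ _ _ (fun a => phi (p ++ a :: r))) => [||x u ->].
  - rewrite -cutsZ; apply: eq_cuts_in => x u ->.
    rewrite (@slot_cuts _ _ _ (fun a => phi (p ++ a :: r))) => [||y z ->].
    + rewrite -cutsZ; apply: eq_cuts_in => y z ->.
      rewrite (@slotZ _ _ _ (fun a => phi (p ++ a :: r))) //.
        rewrite sgnZZ; congr (_ *: phi (p ++ _ :: r)).
        rewrite /letter; congr mkhomog; rewrite !(bdeg_cat, bdeg_cons) deg_letter; ring.
      apply: piece_cast (proj2 cg _) _.
      by rewrite !(bdeg_cat, bdeg_cons) deg_letter; ring.
    + exact: lphi.
    + apply: (@pieceZ _ (dga_space A)); apply: piece_cast (proj2 cg _) _.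
      by rewrite !(bdeg_cat, bdeg_cons) deg_letter; ring.
  - exact: lphi.
  - apply: (@piece_cuts _ (dga_space A)) => y z ->.
    apply: (@pieceZ _ (dga_space A)); apply: piece_cast (proj2 cg _) _.
    by rewrite !(bdeg_cat, bdeg_cons) deg_letter; ring.
Qed.

End PreLie.

Lemma ins_cochain (F : fieldType) (A : dgAlgebra F) m k
    (g h : seq (helt A) -> A) :
  cochain m g -> cochain k h -> cochain (m + k + 1) (ins k h g).
Proof.
move=> cg ch; split; first by apply: ins_multilinear => //; case: cg.
move=> t; apply: (@piece_cuts _ (dga_space A)) => p w ->.
apply: (@piece_cuts _ (dga_space A)) => q r ->; apply: (@pieceZ _ (dga_space A)).
apply: piece_cast (proj2 cg _) _.
by rewrite !(bdeg_cat, bdeg_cons) deg_letter; ring.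
Qed.

(** * Products of cochains and the structure cochain *)

Section Pointwise.
Variables (F : fieldType) (A : dgAlgebra F) (N : dgBimodule A).
Implicit Types (x y : hfun N) (t : seq (helt A)).

Lemma hfunD x y t : (x + y) t = x t + y t. Proof. by []. Qed.
Lemma hfunN x t : (- x) t = - x t. Proof. by []. Qed.
Lemma hfunZ (c : F) x t : (c *: x) t = c *: x t. Proof. by []. Qed.
Lemma hfun0 t : (0 : hfun N) t = 0. Proof. by []. Qed.

Definition hfunE := (hfunD, hfunN, hfunZ, hfun0).

End Pointwise.

Section Bimodule.
Variables (F : fieldType) (A : dgAlgebra F) (N : dgBimodule A).
Implicit Types (s t u v : seq (helt A)) (a c : helt A).
Local Notation CA := (seq (helt A) -> A).
Local Notation CN := (hfun N).

Definition ncochain (n : int) (f : CN) : Prop :=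
  multilinear (f : seq (helt A) -> N) /\ forall t, f t \in piece N (n + bdeg t).

Lemma ncochainP n (f : CN) : f \in piece (hochschild_space N) n <-> ncochain n f.
Proof. by split=> [/asboolP|h]; last apply/asboolP. Qed.

Definition lcup (n m : int) (f : CA) (g : CN) : CN := fun t =>
  \cuts_(u | v <- t)
    (sgn F (m * bdeg u) *: bm_l (letter n f u) (m + bdeg v) (g v)).

Definition rcup (n m : int) (f : CN) (g : CA) : CN := fun t =>
  \cuts_(u | v <- t)
    (sgn F (m * bdeg u) *: bm_r (n + bdeg u) (f u) (letter m g v)).

Definition dcoef (n : int) (f : CN) : CN := fun t => bm_d (n + bdeg t) (f t).

(** Products with [iota] express the outer terms of the Hochschild differential
    without reference to positions in a word. *)
Definition iota : CA := fun t => if t is [:: a] then hval a else 0.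

(** The Maurer-Cartan element of the dg algebra: the Hochschild differential is
    the bracket with it. *)
Definition struct : CA := fun t =>
  match t with
  | [:: a] => dga_d (hval a)
  | [:: a; c] => sgn F (deg a) *: dga_mul (hval a : A) (hval c)
  | _ => 0
  end.

Lemma iota_cochain : cochain (-1) iota.
Proof.
split=> [|[|a [|c t]] /=].
- case=> [|x s] [|y t] k a b e da db ev; rewrite /= ?scaler0 ?addr0 //;
    by case: s => [|z s]; rewrite /= ?scaler0 ?addr0.
- exact: (@piece0 _ (dga_space A)).
- by apply: piece_cast (homogP a) _; rewrite bdeg_cons bdeg_nil; ring.
- exact: (@piece0 _ (dga_space A)).
Qed.

Lemma struct_cochain : cochain (-1 - 1) struct.
Proof.
split=> [|[|a [|c [|x t]]] /=].
- case=> [|x [|y s]] [|z [|w t]] k a b e da db ev;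
    rewrite /= ?scaler0 ?addr0 //; rewrite ?ev ?da ?db.
  + exact: dga_d_linear.
  + by rewrite (dga_mul_linear_l (hval z)) scalerDr !scalerA mulrC.
  + by rewrite (dga_mul_linear_r (hval x)) scalerDr !scalerA mulrC.
  + by case: s => [|? ?]; rewrite /= ?scaler0 ?addr0.
  + by case: s => [|? ?]; rewrite /= ?scaler0 ?addr0.
  + by case: s => [|? ?]; rewrite /= ?scaler0 ?addr0.
- exact: (@piece0 _ (dga_space A)).
- by apply: gr_cast (gr_d (homogP a)) _; rewrite bdeg_cons bdeg_nil; ring.
- apply: (@pieceZ _ (dga_space A)).
  apply: gr_cast (gr_mul (homogP a) (homogP c)) _.
  by rewrite !bdeg_cons bdeg_nil; ring.
- exact: (@piece0 _ (dga_space A)).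
Qed.

End Bimodule.

Section StructureInsertion.
Variables (F : fieldType) (A : dgAlgebra F) (V : lmodType F).
Implicit Types (t u v p q r : seq (helt A)) (a c : helt A).

Lemma cuts_letter_big (G : seq (helt A) -> helt A -> seq (helt A) -> V) x0 t :
  \sum_(i < size t) G (take i t) (nth x0 t i) (drop i.+1 t) =
  \cuts_(u | v <- t) (if v is a :: r then G u a r else 0).
Proof.
elim: t G => [|a t IH] G /=; first by rewrite big_ord0 addr0.
by rewrite big_ord_recl /= drop0 (IH (fun u => G (a :: u))).
Qed.

Lemma cuts_pair_big (G : seq (helt A) -> helt A -> helt A -> seq (helt A) -> V)
    x0 a u :
  \sum_(i < size u) G (take i (a :: u)) (nth x0 (a :: u) i)
     (nth x0 (a :: u) i.+1) (drop i.+2 (a :: u)) =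
  \cuts_(p | v <- a :: u) (if v is x :: y :: r then G p x y r else 0).
Proof.
elim: u a G => [|c u IH] a G; first by rewrite big_ord0 /= !addr0.
rewrite big_ord_recl /= drop0; congr (_ + _).
by rewrite (IH c (fun u => G (a :: u))).
Qed.

Lemma letter_iota a : letter (-1) (@iota F A) [:: a] = a.
Proof.
apply: homog_eq; rewrite ?deg_letter; last by rewrite hval_letter //; exact: iota_cochain.
by rewrite bdeg_cons bdeg_nil; ring.
Qed.

Lemma letter_struct1 a : letter (-1 - 1) (@struct F A) [:: a] = hd a.
Proof.
apply: homog_eq; last by rewrite hval_letter //; exact: struct_cochain.
by rewrite deg_letter bdeg_cons bdeg_nil /=; ring.
Qed.

Lemma slot_struct2 (f : helt A -> V) a c : homog_linear f ->
  f (letter (-1 - 1) (@struct F A) [:: a; c]) = sgn F (deg a) *: f (hmul a c).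
Proof.
move=> lf; rewrite /letter slotZ //.
  congr (_ *: f _); apply: homog_eq.
    by rewrite deg_mkhomog !bdeg_cons bdeg_nil /=; ring.
  rewrite hval_mkhomog //; apply: gr_cast (gr_mul (homogP a) (homogP c)) _.
  by rewrite !bdeg_cons bdeg_nil; ring.
apply: gr_cast (gr_mul (homogP a) (homogP c)) _.
by rewrite !bdeg_cons bdeg_nil; ring.
Qed.

Lemma slot_eq0 (f : helt A -> V) (g : seq (helt A) -> A) m t :
  homog_linear f -> g t = 0 -> f (letter m g t) = 0.
Proof. by rewrite /letter => lf ->; exact: slot0. Qed.

(** The structure cochain vanishes outside of the words of length one and two. *)
Lemma ins_struct (phi : seq (helt A) -> V) t : multilinear phi ->
  ins (-1 - 1) (@struct F A) phi t =
    \cuts_(p | v <- t) (if v is a :: r then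
       sgn F (bdeg p) *: phi (p ++ hd a :: r) else 0)
  + \cuts_(p | v <- t) (if v is a :: c :: r then
       sgn F (bdeg p + deg a) *: phi (p ++ hmul a c :: r) else 0).
Proof.
move=> lphi; rewrite -cutsD /ins; apply: eq_cuts => p w.
have l0 q r : struct q = 0 ->
    sgn F ((-1 - 1 + 1) * bdeg p) *: phi (p ++ letter (-1 - 1) (@struct F A) q :: r) = 0.
  move=> e; rewrite (@slot_eq0 (fun a => phi (p ++ a :: r))) ?scaler0 //.
case: w => [|a [|c w]] /=; rewrite (l0 [::]) ?add0r ?addr0 //.
- by rewrite letter_struct1; apply: sgnZ_par; psolve.
- rewrite letter_struct1; congr (_ + _); first by apply: sgnZ_par; psolve.
  have e2 r : sgn F ((-1 - 1 + 1) * bdeg p) *: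
      phi (p ++ letter (-1 - 1) (@struct F A) [:: a; c] :: r) =
      sgn F (bdeg p + deg a) *: phi (p ++ hmul a c :: r).
    rewrite (@slot_struct2 (fun a => phi (p ++ a :: r))) // sgnZZ.
    by apply: sgnZ_par; psolve.
  case: w => [|x w] /=; rewrite e2 ?addr0 // -[RHS]addr0; congr (_ + _).
  by apply: cuts_zero => u v; rewrite l0.
Qed.

End StructureInsertion.

Section Differential.
Variables (F : fieldType) (A : dgAlgebra F) (N : dgBimodule A).
Implicit Types (t u v p r : seq (helt A)) (a c : helt A).
Local Notation CN := (hfun N).
Local Notation iota := (@iota F A).
Local Notation struct := (@struct F A).

Lemma cuts_first (V : zmodType) (G : seq (helt A) -> seq (helt A) -> V) a t :
  (forall u v, size u != 1 -> G u v = 0) -> cuts G (a :: t) = G [:: a] t.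
Proof.
move=> G0 /=; rewrite G0 // add0r; case: t => [|c t] /=; first by rewrite addr0.
by rewrite cuts_zero ?addr0 // => u v; rewrite G0.
Qed.

Lemma cuts_last (V : zmodType) (G : seq (helt A) -> seq (helt A) -> V) a t :
  (forall u v, size v != 1 -> G u v = 0) ->
  cuts G (a :: t) = G (belast a t) [:: last a t].
Proof.
elim: t a G => [|c t IH] a G G0; first by rewrite /= [G [:: a] _]G0 ?addr0.
rewrite -[LHS]/(G [::] [:: a, c & t] + cuts (fun u v => G (a :: u) v) (c :: t)).
rewrite G0 // add0r IH // => u v; exact: G0.
Qed.

Lemma iota0 t : size t != 1 -> iota t = 0.
Proof. by case: t => [|a [|c t]]. Qed.

Lemma lcup_iota n (f : CN) t : ncochain n f ->
  lcup (-1) n iota f t =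
  if t is a :: u then sgn F (n * (deg a + 1)) *: bm_l a (n + bdeg u) (f u) else 0.
Proof.
move=> [_ fp]; rewrite /lcup.
have z u v : size u != 1 -> sgn F (n * bdeg u) *:
    bm_l (letter (-1) iota u) (n + bdeg v) (f v) = 0.
  move=> /iota0 e.
  by rewrite (@slot_eq0 _ _ _ (fun a => bm_l a _ (f v))) ?scaler0 //; apply: bm_l_homog.
case: t => [|a u]; first by rewrite /= z ?addr0.
rewrite (cuts_first _ _ z) letter_iota; apply: sgnZ_par; psolve.
Qed.

Lemma rcup_iota n (f : CN) t : ncochain n f ->
  rcup n (-1) f iota t =
  if t is a :: u then sgn F (bdeg (belast a u)) *:
    bm_r (n + bdeg (belast a u)) (f (belast a u)) (last a u) else 0.
Proof.
move=> [_ fp]; rewrite /rcup.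
have z u v : size v != 1 -> sgn F (-1 * bdeg u) *:
    bm_r (n + bdeg u) (f u) (letter (-1) iota v) = 0.
  move=> /iota0 e.
  by rewrite (@slot_eq0 _ _ _ (fun a => bm_r _ (f u) a)) ?scaler0 //; apply: bm_r_homog.
case: t => [|a u]; first by rewrite /= z ?addr0.
rewrite (cuts_last _ _ z) letter_iota; apply: sgnZ_par; psolve.
Qed.

(** The inner terms of the differential are insertions of the structure cochain,
    the outer ones are products with [iota]. *)
Lemma hochschild_dE n (f : CN) : ncochain n f ->
  hochschild_d n f =
    dcoef n f + sgn F n *: (ins (-1 - 1) struct f : CN)
    - lcup (-1) n iota f + sgn F n *: rcup n (-1) f iota.
Proof.
move=> cf; apply/funext => t.
rewrite -[LHS]/(hochschild_D0 n f t + hochschild_D1 n f t).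
rewrite -[RHS]/(dcoef n f t + sgn F n *: ins (-1 - 1) struct f t
  - lcup (-1) n iota f t + sgn F n *: rcup n (-1) f iota t).
rewrite ins_struct ?lcup_iota ?rcup_iota //; last by case: cf.
rewrite /hochschild_D0 /dcoef -!addrA; congr (_ + _).
rewrite (cuts_letter_big (fun u a r => sgn F (n + bdeg u) *: f (u ++ hd a :: r))).
rewrite scalerDr -addrA; congr (_ + _).
  rewrite -cutsZ; apply: eq_cuts => p [|a w]; rewrite ?scaler0 // sgnZZ //.
rewrite /hochschild_D1; case: t => [|a u]; first by rewrite /= !(addr0, scaler0, oppr0).
rewrite sgnZZ [RHS]addrCA -addrA; congr (_ + (_ + _)).
  by congr (- (_ *: _)); apply: sgn_eq_par; psolve.
rewrite -(cuts_pair_big (fun p a c r => sgn F (bdeg p + deg a) *: 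
  f (p ++ hmul a c :: r)) hone) -sumrN scaler_sumr.
apply: eq_bigr => i _; rewrite sgnZN sgnZZ; apply: sgnZ_par.
rewrite (take_nth hone) /=; first by psolve.
by rewrite ltnW // ltnS ltn_ord.
Qed.

End Differential.

(** * Compatibilities between products and insertions *)

Section Linear.
Variables (F : fieldType) (U V : lmodType F) (h : U -> V).
Hypothesis hl : linear h.

Lemma linD' x y : h (x + y) = h x + h y.
Proof. by rewrite -[x in LHS]scale1r hl scale1r. Qed.

Lemma lin0' : h 0 = 0.
Proof. by have := hl (-1) 0 0; rewrite scaler0 addr0 scaleN1r addNr. Qed.

Lemma linZ' c x : h (c *: x) = c *: h x.
Proof. by rewrite -[_ *: _]addr0 hl lin0' addr0. Qed.

Lemma linN' x : h (- x) = - h x.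
Proof. by rewrite -scaleN1r linZ' scaleN1r. Qed.

Lemma linB' x y : h (x - y) = h x - h y.
Proof. by rewrite linD' linN'. Qed.

Lemma lin_cuts T (G : seq T -> seq T -> U) t :
  h (cuts G t) = \cuts_(u | v <- t) h (G u v).
Proof. by apply: cuts_map => x y; exact: linD'. Qed.
End Linear.

Section Multilinear.
Variables (F : fieldType) (A : dgAlgebra F) (V : lmodType F).
Implicit Types (s t u v p q r : seq (helt A)) (a c : helt A).

Lemma multilinear_sgn (w : int -> int) (phi : seq (helt A) -> V) :
  multilinear phi -> multilinear (fun t => sgn F (w (bdeg t)) *: phi t).
Proof.
move=> lp s t c a b e da db ev.
rewrite (lp s t c a b e da db ev) !bdeg_cat !bdeg_cons da db.
by rewrite scalerDr !scalerA mulrC.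
Qed.

Lemma multilinear_cuts (K : seq (helt A) -> seq (helt A) -> V) :
  (forall v, multilinear (K^~ v)) -> (forall u, multilinear (K u)) ->
  multilinear (cuts K).
Proof.
move=> l1 l2 s t c a b e da db ev.
rewrite !cuts_mark scalerDr -!cutsZ addrACA -!cutsD.
congr (_ + _); apply: eq_cuts => u v; first exact: l2.
exact: l1.
Qed.

(** Each insertion happens on one side of the cut. *)
Lemma ins_cuts k h (K : seq (helt A) -> seq (helt A) -> V) t :
  ins k h (cuts K) t =
    \cuts_(u | v <- t) ins k h (K^~ v) u
    + \cuts_(u | v <- t) (sgn F ((k + 1) * bdeg u) *: ins k h (K u) v).
Proof.
rewrite {1}/ins.
under eq_cuts => p w do under eq_cuts => q r do rewrite cuts_mark scalerDr.
under eq_cuts => p w do rewrite cutsD.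
rewrite cutsD addrC; congr (_ + _).
  rewrite [RHS]cuts_assoc; apply: eq_cuts => p w.
  rewrite [RHS]cuts_assoc; apply: eq_cuts => q r.
  by rewrite -cutsZ.
transitivity (\cuts_(p | w <- t) \cuts_(u | v <- p) \cuts_(q | r <- w)
   (sgn F ((k + 1) * bdeg (u ++ v)) *: K u (v ++ letter k h q :: r))).
  apply: eq_cuts => p w; rewrite (cuts_exchange (fun u v q r => _)).
  apply: eq_cuts => q r; rewrite -cutsZ.
  by apply: eq_cuts_in => u v ->.
rewrite (cuts_assoc (fun u v w => \cuts_(q | r <- w) _)).
apply: eq_cuts => u z; rewrite -cutsZ.
apply: eq_cuts => v w; rewrite -cutsZ.
by apply: eq_cuts => q r; rewrite sgnZZ; apply: sgnZ_par; psolve.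
Qed.

Lemma insZ k h (c : F) (phi : seq (helt A) -> V) t :
  ins k h (fun t => c *: phi t) t = c *: ins k h phi t.
Proof.
rewrite /ins -cutsZ; apply: eq_cuts => p w; rewrite -cutsZ.
by apply: eq_cuts => q r; rewrite !scalerA mulrC.
Qed.

Lemma eq_ins k h (phi psi : seq (helt A) -> V) t :
  (forall t, phi t = psi t) -> ins k h phi t = ins k h psi t.
Proof. by move=> /funext ->. Qed.

Lemma insD k h (phi psi : seq (helt A) -> V) t :
  ins k h (fun t => phi t + psi t) t = ins k h phi t + ins k h psi t.
Proof.
rewrite /ins -cutsD; apply: eq_cuts => p w; rewrite -cutsD.
by apply: eq_cuts => q r; rewrite scalerDr.
Qed.
End Multilinear.

Section Calculus.
Variables (F : fieldType) (A : dgAlgebra F) (N : dgBimodule A).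
Implicit Types (s t u v p q r : seq (helt A)) (a c : helt A).
Local Notation CA := (seq (helt A) -> A).
Local Notation CN := (hfun N).
Implicit Types (f h : CA) (x : CN) (n m k : int).

Lemma dcoef_cochain n x : ncochain n x -> ncochain (n - 1) (dcoef n x).
Proof.
move=> [xl xp]; split=> [s t c a b e da db ev|t]; rewrite /dcoef.
  rewrite (xl s t c a b e da db ev) !bdeg_cat !bdeg_cons da db.
  exact: bm_d_linear.
by apply: piece_cast (bm_d_piece (xp t)) _; ring.
Qed.

Lemma ins_ncochain n k h x : cochain k h -> ncochain n x ->
  ncochain (n + k + 1) (ins k h x).
Proof.
move=> ch [xl xp]; split; first exact: ins_multilinear.
move=> t; apply: piece_cuts => p w ->; apply: piece_cuts => q r ->.
apply: pieceZ; apply: piece_cast (xp _) _.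
by rewrite !(bdeg_cat, bdeg_cons) deg_letter; ring.
Qed.

Lemma lcup_cochain n m f x : cochain n f -> ncochain m x ->
  ncochain (n + m) (lcup n m f x).
Proof.
move=> cf [xl xp]; split.
  apply: multilinear_cuts => [v|u].
    apply: (multilinear_sgn (fun i => m * i)) => s t.
    by apply: (@homog_linear_letter _ _ _ _ _ (fun a => bm_l a _ (x v)) _ _ cf);
      exact: bm_l_homog.
  apply: multilinearZ => s t c a b e da db ev.
  rewrite (xl s t c a b e da db ev) !bdeg_cat !bdeg_cons da db.
  exact: bm_l_linear.
move=> t; apply: piece_cuts => u v ->; apply: pieceZ.
by apply: piece_cast (bm_l_piece _ (xp v)) _; rewrite deg_letter bdeg_cat; ring.
Qed.

Lemma rcup_cochain n m x f : ncochain n x -> cochain m f ->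
  ncochain (n + m) (rcup n m x f).
Proof.
move=> [xl xp] cf; split.
  apply: multilinear_cuts => [v|u].
    apply: (multilinear_sgn (fun i => m * i)) => s t c a b e da db ev.
    rewrite (xl s t c a b e da db ev) !bdeg_cat !bdeg_cons da db.
    exact: bm_r_linear.
  apply: multilinearZ => s t.
  by apply: (@homog_linear_letter _ _ _ _ _ (fun a => bm_r _ (x u) a) _ _ cf);
    exact: bm_r_homog.
move=> t; apply: piece_cuts => u v ->; apply: pieceZ.
by apply: piece_cast (bm_r_piece _ (xp u)) _; rewrite deg_letter bdeg_cat; ring.
Qed.

Lemma dcoef_dcoef n x : ncochain n x -> dcoef (n - 1) (dcoef n x) = 0.
Proof.
move=> [_ xp]; apply/funext => t; rewrite /dcoef.
by rewrite (_ : n - 1 + _ = n + bdeg t - 1) ?bm_dd //; ring.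
Qed.

Lemma dcoef_ins n k h x :
  dcoef (n + k + 1) (ins k h x) = ins k h (dcoef n x).
Proof.
apply/funext => t; rewrite /dcoef /ins (lin_cuts (bm_d_linear _)).
apply: eq_cuts_in => p w ->; rewrite (lin_cuts (bm_d_linear _)).
apply: eq_cuts_in => q r ->; rewrite (linZ' (bm_d_linear _)).
by congr (_ *: bm_d _ _); rewrite !(bdeg_cat, bdeg_cons) deg_letter; ring.
Qed.

Lemma hd_letter n f t : cochain n f ->
  hd (letter n f t) = letter (n - 1) (fun t => dga_d (f t)) t.
Proof.
move=> cf; have e : n - 1 + bdeg t = n + bdeg t - 1 by ring.
apply: homog_eq => /=; first by rewrite !deg_letter.
rewrite hval_letter // /letter hval_mkhomog // e.
exact: gr_d (proj2 cf t).
Qed.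

Lemma dcoef_lcup n m f x : cochain n f -> ncochain m x ->
  dcoef (n + m) (lcup n m f x) =
    lcup (n - 1) m (fun t => dga_d (f t)) x
    + sgn F n *: lcup n (m - 1) f (dcoef m x).
Proof.
move=> cf [_ xp]; apply/funext => t.
rewrite -[RHS]/(lcup (n - 1) m (fun t => dga_d (f t)) x t
    + sgn F n *: lcup n (m - 1) f (dcoef m x) t).
rewrite /dcoef /lcup (lin_cuts (bm_d_linear _)) -cutsZ -cutsD.
apply: eq_cuts_in => u v ->; rewrite (linZ' (bm_d_linear _)).
rewrite (_ : n + m + _ = deg (letter n f u) + (m + bdeg v)); last first.
  by rewrite deg_letter bdeg_cat; ring.
rewrite bm_dl // scalerDr hd_letter //; congr (_ + _).
rewrite !sgnZZ (_ : m - 1 + bdeg v = m + bdeg v - 1); last by ring.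
by apply: sgnZ_par; psolve.
Qed.

Lemma dcoef_rcup n m x f : ncochain n x -> cochain m f ->
  dcoef (n + m) (rcup n m x f) =
    rcup (n - 1) m (dcoef n x) f
    + sgn F n *: rcup n (m - 1) x (fun t => dga_d (f t)).
Proof.
move=> [_ xp] cf; apply/funext => t.
rewrite -[RHS]/(rcup (n - 1) m (dcoef n x) f t
    + sgn F n *: rcup n (m - 1) x (fun t => dga_d (f t)) t).
rewrite /dcoef /rcup (lin_cuts (bm_d_linear _)) -cutsZ -cutsD.
apply: eq_cuts_in => u v ->; rewrite (linZ' (bm_d_linear _)).
rewrite (_ : n + m + _ = (n + bdeg u) + deg (letter m f v)); last first.
  by rewrite deg_letter bdeg_cat; ring.
rewrite bm_dr // scalerDr hd_letter //.
rewrite (_ : n - 1 + bdeg u = n + bdeg u - 1); last by ring.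
congr (_ + _); rewrite !sgnZZ; apply: sgnZ_par; psolve.
Qed.

Lemma slot_ins (V : lmodType F) (phi : helt A -> V) n k f h t :
  homog_linear phi -> cochain n f -> cochain k h ->
  phi (letter (n + k + 1) (ins k h f) t) =
    ins k h (fun t => phi (letter n f t)) t.
Proof.
move=> lphi cf ch; rewrite {1}/letter /ins.
have fp p q r : f (p ++ letter k h q :: r)
    \in piece (dga_space A) (n + k + 1 + bdeg (p ++ q ++ r)).
  apply: piece_cast (proj2 cf _) _.
  by rewrite !(bdeg_cat, bdeg_cons) deg_letter; ring.
rewrite slot_cuts // => [|p w ->]; last first.
  apply: (@piece_cuts _ (dga_space A)) => q r ->.
  exact: (@pieceZ _ (dga_space A)).
apply: eq_cuts_in => p w ->; rewrite slot_cuts // => [|q r ->]; last first.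
  exact: (@pieceZ _ (dga_space A)).
apply: eq_cuts_in => q r ->; rewrite slotZ // /letter; congr (_ *: phi (mkhomog _ _)).
by rewrite !(bdeg_cat, bdeg_cons) deg_mkhomog; ring.
Qed.

End Calculus.

Section Insert.
Variables (F : fieldType) (A : dgAlgebra F) (V : lmodType F).
Implicit Types (t u v p q r : seq (helt A)) (h : seq (helt A) -> A).

Lemma ins_sgn k h m (phi : seq (helt A) -> V) t :
  ins k h (fun u => sgn F (m * bdeg u) *: phi u) t =
  sgn F (m * (bdeg t + (k + 1))) *: ins k h phi t.
Proof.
rewrite /ins -cutsZ; apply: eq_cuts_in => p w ->; rewrite -cutsZ.
apply: eq_cuts_in => q r ->; rewrite !sgnZZ; apply: sgnZ_par; psolve.
Qed.

Lemma ins_lin (U : lmodType F) k h m (l : int -> U -> V)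
    (x : seq (helt A) -> U) t : (forall j, linear (l j)) ->
  ins k h (fun u => l (m + bdeg u) (x u)) t = l (m + k + 1 + bdeg t) (ins k h x t).
Proof.
move=> ll; rewrite /ins (lin_cuts (ll _)); apply: eq_cuts_in => p w ->.
rewrite (lin_cuts (ll _)); apply: eq_cuts_in => q r ->.
rewrite (linZ' (ll _)); congr (_ *: l _ _).
by rewrite !(bdeg_cat, bdeg_cons) deg_letter; ring.
Qed.

Lemma ins_iota k h t : cochain k h -> ins k h (@iota F A) t = h t.
Proof.
move=> ch; rewrite /ins.
have e p q r : @iota F A (p ++ letter k h q :: r) =
    if (p, r) is ([::], [::]) then h q else 0.
  case: p => [|a [|b p]] //; case: r => [|b r] //=; exact: hval_letter.
have z r : \cuts_(u | v <- r) (if v is [::] then h u else 0) = h r.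
  elim: r (h) => [|a r IH] g /=; first by rewrite addr0.
  by rewrite add0r (IH (fun u => g (a :: u))).
transitivity (\cuts_(p | w <- t) (if p is [::] then h w else 0)).
  apply: eq_cuts => p w; under eq_cuts => q r do rewrite e.
  case: p => [|a p]; last by rewrite cuts_zero // => q r; rewrite scaler0.
  rewrite -[RHS]z; apply: eq_cuts => q [|b r]; rewrite ?scaler0 //.
  by rewrite bdeg_nil mulr0 sgnZ0.
case: t => [|a t] /=; first by rewrite addr0.
by rewrite cuts_zero ?addr0.
Qed.

End Insert.

Section Calculus.
Variables (F : fieldType) (A : dgAlgebra F) (N : dgBimodule A).
Implicit Types (s t u v p : seq (helt A)) (a c : helt A).
Local Notation CA := (seq (helt A) -> A).
Local Notation CN := (hfun N).
Implicit Types (f g h : CA) (x : CN) (n m k : int).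

Lemma ins_lcup n m k f x h : cochain n f -> ncochain m x -> cochain k h ->
  (ins k h (lcup n m f x) : CN) =
    sgn F ((k + 1) * m) *: lcup (n + k + 1) m (ins k h f) x
    + lcup n (m + k + 1) f (ins k h x).
Proof.
move=> cf cx ch; apply/funext => t.
rewrite -[RHS]/(sgn F ((k + 1) * m) *: lcup (n + k + 1) m (ins k h f) x t
    + lcup n (m + k + 1) f (ins k h x) t).
rewrite /lcup ins_cuts; congr (_ + _).
  rewrite -cutsZ; apply: eq_cuts => u v; rewrite ins_sgn.
  rewrite (@slot_ins _ _ _ (fun a => bm_l a _ (x v))) //; last first.
    exact: bm_l_homog (proj2 cx v).
  by rewrite sgnZZ; apply: sgnZ_par; psolve.
apply: eq_cuts => u v; rewrite insZ.
rewrite (ins_lin k h m x v (fun j => bm_l_linear _ j)) sgnZZ.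
by apply: sgnZ_par; psolve.
Qed.

Lemma ins_rcup n m k x f h : ncochain n x -> cochain m f -> cochain k h ->
  (ins k h (rcup n m x f) : CN) =
    sgn F ((k + 1) * m) *: rcup (n + k + 1) m (ins k h x) f
    + rcup n (m + k + 1) x (ins k h f).
Proof.
move=> cx cf ch; apply/funext => t.
rewrite -[RHS]/(sgn F ((k + 1) * m) *: rcup (n + k + 1) m (ins k h x) f t
    + rcup n (m + k + 1) x (ins k h f) t).
rewrite /rcup ins_cuts; congr (_ + _).
  rewrite -cutsZ; apply: eq_cuts => u v; rewrite ins_sgn.
  rewrite (ins_lin k h n x u (fun j => bm_r_linear _ j)) sgnZZ.
  by apply: sgnZ_par; psolve.
apply: eq_cuts => u v; rewrite insZ.
rewrite (@slot_ins _ _ _ (fun a => bm_r _ (x u) a)) //; last first.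
  exact: bm_r_homog (proj2 cx u).
by rewrite sgnZZ; apply: sgnZ_par; psolve.
Qed.

(** Both [lcup] and [rcup], with coefficients in the algebra itself; no letter is
    formed here, so that only the degree [m] of [g] is needed. *)
Definition acup m f g : CA := fun t =>
  \cuts_(u | v <- t) (sgn F (m * bdeg u) *: dga_mul (f u) (g v)).

Lemma acup_cochain n m f g : cochain n f -> cochain m g ->
  cochain (n + m) (acup m f g).
Proof.
move=> cf cg; have [fl fp] := cf; have [gl gp] := cg; split.
  apply: multilinear_cuts => [v|u].
    apply: (multilinear_sgn (fun i => m * i)) => s t c a b e da db ev.
    by rewrite (fl s t c a b e da db ev); exact: dga_mul_linear_l.
  apply: multilinearZ => s t c a b e da db ev.
  by rewrite (gl s t c a b e da db ev); exact: dga_mul_linear_r.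
move=> t; apply: (@piece_cuts _ (dga_space A)) => u v ->.
apply: (@pieceZ _ (dga_space A)); apply: gr_cast (gr_mul (fp u) (gp v)) _.
by rewrite bdeg_cat; ring.
Qed.

Lemma slot_acup (V : lmodType F) (phi : helt A -> V) n m f g t :
  homog_linear phi -> cochain n f -> cochain m g ->
  phi (letter (n + m) (acup m f g) t) =
  \cuts_(u | v <- t) (sgn F (m * bdeg u) *: phi (hmul (letter n f u) (letter m g v))).
Proof.
move=> lphi cf cg; have p u v : dga_mul (f u) (g v)
    \in piece (dga_space A) (n + m + bdeg (u ++ v)).
  apply: gr_cast (gr_mul (proj2 cf u) (proj2 cg v)) _.
  by rewrite bdeg_cat; ring.
rewrite {1}/letter slot_cuts // => [|u v ->]; last exact: (@pieceZ _ (dga_space A)).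
apply: eq_cuts_in => u v ->; rewrite slotZ //; congr (_ *: phi _).
apply: homog_eq; rewrite /= ?deg_mkhomog ?deg_letter ?bdeg_cat; first by ring.
by rewrite hval_mkhomog ?hval_letter // -bdeg_cat.
Qed.

Lemma lcupA n m k f g x : cochain n f -> cochain m g -> ncochain k x ->
  lcup n (m + k) f (lcup m k g x) = lcup (n + m) k (acup m f g) x.
Proof.
move=> cf cg [_ xp]; apply/funext => t; rewrite /lcup.
transitivity (\cuts_(u | v | w <- t) (sgn F ((m + k) * bdeg u + k * bdeg v) *:
    bm_l (letter n f u) (m + bdeg v + (k + bdeg w))
      (bm_l (letter m g v) (k + bdeg w) (x w)))).
  apply: eq_cuts => u z; rewrite (lin_cuts (bm_l_linear _ _)) -cutsZ.
  apply: eq_cuts_in => v w ->; rewrite (linZ' (bm_l_linear _ _)) sgnZZ.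
  congr (_ *: bm_l _ _ _); rewrite bdeg_cat; ring.
rewrite -[LHS]cuts_assoc; apply: eq_cuts => y w.
rewrite (@slot_acup _ (fun a => bm_l a _ (x w))) //; last exact: bm_l_homog.
rewrite -cutsZ; apply: eq_cuts_in => u v ->.
rewrite bm_lA // sgnZZ deg_letter; apply: sgnZ_par; psolve.
Qed.

Lemma lrcupA n m k f x g : cochain n f -> ncochain m x -> cochain k g ->
  lcup n (m + k) f (rcup m k x g) = rcup (n + m) k (lcup n m f x) g.
Proof.
move=> cf [_ xp] cg; apply/funext => t; rewrite /lcup /rcup.
transitivity (\cuts_(u | v | w <- t) (sgn F ((m + k) * bdeg u + k * bdeg v) *:
    bm_l (letter n f u) (m + bdeg v + deg (letter k g w))
      (bm_r (m + bdeg v) (x v) (letter k g w)))).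
  apply: eq_cuts => u z; rewrite (lin_cuts (bm_l_linear _ _)) -cutsZ.
  apply: eq_cuts_in => v w ->; rewrite (linZ' (bm_l_linear _ _)) sgnZZ.
  congr (_ *: bm_l _ _ _); rewrite deg_letter bdeg_cat; ring.
rewrite -[LHS]cuts_assoc; apply: eq_cuts => y w.
rewrite (lin_cuts (bm_r_linear _ _)) -cutsZ; apply: eq_cuts_in => u v ->.
rewrite (linZ' (bm_r_linear _ _)) sgnZZ.
rewrite (_ : n + m + _ = deg (letter n f u) + (m + bdeg v)); last first.
  by rewrite deg_letter bdeg_cat; ring.
rewrite bm_lr //; apply: sgnZ_par; psolve.
Qed.

Lemma rcupA n m k x f g : ncochain n x -> cochain m f -> cochain k g ->
  rcup (n + m) k (rcup n m x f) g = rcup n (m + k) x (acup k f g).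
Proof.
move=> [_ xp] cf cg; apply/funext => t; rewrite /rcup.
transitivity (\cuts_(u | v | w <- t) (sgn F ((m + k) * bdeg u + k * bdeg v) *:
    bm_r (n + bdeg u + deg (letter m f v))
      (bm_r (n + bdeg u) (x u) (letter m f v)) (letter k g w))).
  rewrite -[RHS]cuts_assoc; apply: eq_cuts => y w.
  rewrite (lin_cuts (bm_r_linear _ _)) -cutsZ; apply: eq_cuts_in => u v ->.
  rewrite (linZ' (bm_r_linear _ _)) sgnZZ.
  rewrite (_ : n + m + _ = n + bdeg u + deg (letter m f v)); last first.
    by rewrite deg_letter bdeg_cat; ring.
  apply: sgnZ_par; psolve.
apply: eq_cuts => u z.
rewrite (@slot_acup _ (fun a => bm_r _ (x u) a)) //; last exact: bm_r_homog.
rewrite -cutsZ; apply: eq_cuts => v w.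
rewrite bm_rA // sgnZZ; apply: sgnZ_par; psolve.
Qed.

End Calculus.

Section AlgebraCochains.
Variables (F : fieldType) (A : dgAlgebra F).
Implicit Types (t u v p q r : seq (helt A)) (a c : helt A).
Local Notation CA := (seq (helt A) -> A).
Local Notation iota := (@iota F A).
Local Notation struct := (@struct F A).
Local Notation S := (self_bimodule A).
Implicit Types (f g h : CA) (n m k : int).

Lemma cochain_self n f : cochain n f <-> @ncochain F A S n f.
Proof. by []. Qed.

Lemma lcup_self n m f g : cochain n f -> @lcup F A S n m f g = acup m f g.
Proof.
move=> cf; apply/funext => t; apply: eq_cuts => u v.
by rewrite /= hval_letter.
Qed.

Lemma rcup_self n m f g : cochain m g -> @rcup F A S n m f g = acup m f g.
Proof.
move=> cg; apply/funext => t; apply: eq_cuts => u v.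
by rewrite /= hval_letter.
Qed.

Definition da f : CA := fun t => dga_d (f t).

Lemma da_cochain n f : cochain n f -> cochain (n - 1) (da f).
Proof. by move=> /cochain_self/dcoef_cochain. Qed.

Lemma cochain_cast n m f : cochain n f -> n = m -> cochain m f.
Proof. by move=> + <-. Qed.

Lemma ins_acup n m k f g h t : cochain n f -> cochain m g -> cochain k h ->
  ins k h (acup m f g) t =
    sgn F ((k + 1) * m) *: acup m (ins k h f) g t
    + acup (m + k + 1) f (ins k h g) t.
Proof.
move=> cf cg ch; rewrite -(lcup_self m g cf).
have /cochain_self cg' := cg.
have := congr1 (fun x : hfun S => x t) (ins_lcup cf cg' ch); rewrite !hfunE.
by rewrite (lcup_self _ _ (ins_cochain cf ch)) !(lcup_self _ _ cf).
Qed.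

Lemma da_acup n m f g t : cochain n f -> cochain m g ->
  da (acup m f g) t =
    acup m (da f) g t + sgn F n *: acup (m - 1) f (da g) t.
Proof.
move=> cf cg; rewrite -(lcup_self m g cf).
have /cochain_self cg' := cg.
have := congr1 (fun x : hfun S => x t) (dcoef_lcup cf cg'); rewrite !hfunE.
by rewrite (lcup_self _ _ (da_cochain cf)) !(lcup_self _ _ cf).
Qed.

Lemma acupA n m k f g h : cochain n f -> cochain m g -> cochain k h ->
  acup (m + k) f (acup k g h) = acup k (acup m f g) h.
Proof.
move=> cf cg ch; have /cochain_self ch' := ch.
have := lcupA cf cg ch'; rewrite (lcup_self _ _ cf) (lcup_self _ _ cg).
by rewrite (lcup_self _ _ (acup_cochain cf cg)).
Qed.

Lemma acupBl m f1 f2 g t :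
  acup m (fun t => f1 t - f2 t) g t = acup m f1 g t - acup m f2 g t.
Proof.
rewrite /acup -cutsN -cutsD; apply: eq_cuts => u v; rewrite -scalerBr.
by rewrite (linB' (dga_mul_linear_l (g v))).
Qed.

Lemma acupBr m f g1 g2 t :
  acup m f (fun t => g1 t - g2 t) t = acup m f g1 t - acup m f g2 t.
Proof.
rewrite /acup -cutsN -cutsD; apply: eq_cuts => u v; rewrite -scalerBr.
by rewrite (linB' (dga_mul_linear_r (f u))).
Qed.

Lemma eq_acup m f f' g g' t : (forall t, f t = f' t) -> (forall t, g t = g' t) ->
  acup m f g t = acup m f' g' t.
Proof. by move=> /funext -> /funext ->. Qed.

Lemma structE t : struct t = da iota t - acup (-1) iota iota t.
Proof.
have z1 x : dga_mul (0 : A) x = 0 := lin0' (dga_mul_linear_l x).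
have z2 x : dga_mul x (0 : A) = 0 := lin0' (dga_mul_linear_r x).
have zd : dga_d (0 : A) = 0 := lin0' (@dga_d_linear F A).
rewrite /acup /da; case: t => [|a [|c t]] /=;
  rewrite ?z1 ?z2 ?zd ?scaler0 ?addr0 ?subr0 //.
rewrite !add0r cuts_zero => [|u v]; last by rewrite z1 scaler0.
rewrite addr0; case: t => [|b t]; last by rewrite z2 scaler0 oppr0.
by rewrite sgnZN; apply: sgnZ_par; psolve.
Qed.

Lemma ins_struct_iota : ins (-1 - 1) struct iota = struct.
Proof. by apply/funext => t; rewrite ins_iota //; exact: struct_cochain. Qed.

(** Associativity, the Leibniz rule and [d d = 0], in a single identity. *)
Lemma ins_struct_struct t : ins (-1 - 1) struct struct t = 0.
Proof.
have ci := iota_cochain A; have cs := struct_cochain A.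
rewrite (eq_ins _ _ _ structE) insD.
rewrite (eq_ins _ _ _ (fun t => esym (scaleN1r (acup (-1) iota iota t)))) insZ.
rewrite (ins_acup _ ci ci cs) ins_struct_iota.
have := congr1 (fun x : hfun S => x t) (@dcoef_ins F A S (-1) (-1 - 1) struct iota).
rewrite ins_struct_iota -[LHS]/(da struct t) => <-.
have -> : da struct t = - da (acup (-1) iota iota) t.
  rewrite /da structE (linB' (@dga_d_linear F A)) /da dga_dd.
  by rewrite sub0r.
have cdi := da_cochain ci.
rewrite (da_acup _ ci ci).
rewrite (eq_acup _ _ structE (fun=> erefl)) (eq_acup _ _ (fun=> erefl) structE).
rewrite acupBl acupBr (acupA ci ci ci).
rewrite (_ : -1 + (-1 - 1) + 1 = -1 - 1) //; linear_sgn.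
Qed.

(** By [preLie]: the structure cochain is odd, so that disjoint insertions cancel,
    and nested ones vanish by [ins_struct_struct]. *)
Lemma ins_struct_sq (V : lmodType F) (phi : seq (helt A) -> V) t :
  multilinear phi -> ins (-1 - 1) struct (ins (-1 - 1) struct phi) t = 0.
Proof.
move=> lphi; have cs := struct_cochain A.
rewrite preLie // (@sgn_eq_par _ _ 1) // scaleN1r subrr add0r.
rewrite /ins cuts_zero // => p w; rewrite cuts_zero // => q r.
rewrite (@slot_eq0 _ _ _ (fun a => phi (p ++ a :: r))) ?scaler0 //.
exact: ins_struct_struct.
Qed.

End AlgebraCochains.

(** * The Hochschild complex *)

Lemma cochain_lin (F : fieldType) (A : dgAlgebra F) n (c : F)
    (f g : seq (helt A) -> A) :
  cochain n f -> cochain n g -> cochain n (fun t => c *: f t + g t).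
Proof.
move=> [fl fp] [gl gp]; split.
  by apply: multilinearD => //; apply: multilinearZ.
by move=> t; apply: (@pieceP _ (dga_space A)).
Qed.

Section HochschildComplex.
Variables (F : fieldType) (A : dgAlgebra F) (N : dgBimodule A).
Implicit Types (t u v : seq (helt A)) (a c : helt A).
Local Notation CA := (seq (helt A) -> A).
Local Notation CN := (hfun N).
Local Notation iota := (@iota F A).
Local Notation struct := (@struct F A).
Implicit Types (f g : CA) (x y : CN) (n m : int).

Lemma ncochain_cast n m x : ncochain n x -> n = m -> ncochain m x.
Proof. by move=> + <-. Qed.

Lemma ncochainD n x y : ncochain n x -> ncochain n y -> ncochain n (x + y).
Proof.
move=> /ncochainP cx /ncochainP cy; apply/ncochainP.
exact: (@pieceD _ (hochschild_space N)).
Qed.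

Lemma ncochainZ n (c : F) x : ncochain n x -> ncochain n (c *: x).
Proof.
by move=> /ncochainP cx; apply/ncochainP; apply: (@pieceZ _ (hochschild_space N)).
Qed.

Lemma ncochainN n x : ncochain n x -> ncochain n (- x).
Proof. by rewrite -scaleN1r; exact: ncochainZ. Qed.

Lemma ncochainB n x y : ncochain n x -> ncochain n y -> ncochain n (x - y).
Proof. by move=> cx cy; apply: ncochainD => //; exact: ncochainN. Qed.

Lemma ins_struct_ncochain n x : ncochain n x ->
  ncochain (n - 1) (ins (-1 - 1) struct x).
Proof.
move=> cx; apply: ncochain_cast (ins_ncochain (struct_cochain A) cx) _; ring.
Qed.

Lemma lcup_iota_cochain n x : ncochain n x ->
  ncochain (n - 1) (lcup (-1) n iota x).
Proof.
move=> cx; apply: ncochain_cast (lcup_cochain (iota_cochain A) cx) _; ring.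
Qed.

Lemma rcup_iota_cochain n x : ncochain n x ->
  ncochain (n - 1) (rcup n (-1) x iota).
Proof. by move=> cx; exact: (rcup_cochain cx (iota_cochain A)). Qed.

Lemma hochschild_d_cochain n x : ncochain n x ->
  ncochain (n - 1) (hochschild_d n x).
Proof.
move=> cx; rewrite hochschild_dE //.
apply: ncochainD; [apply: ncochainB; [apply: ncochainD|]|].
- exact: dcoef_cochain.
- by apply: ncochainZ; exact: ins_struct_ncochain.
- exact: lcup_iota_cochain.
- by apply: ncochainZ; exact: rcup_iota_cochain.
Qed.

Lemma slotP' (V : lmodType F) (phi : helt A -> V) n (c : F) f g t :
  homog_linear phi -> cochain n f -> cochain n g ->
  phi (letter n (fun t => c *: f t + g t) t) =
  c *: phi (letter n f t) + phi (letter n g t).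
Proof. by move=> lphi [_ fp] [_ gp]; rewrite /letter slotP. Qed.

Lemma lcupPl n m (c : F) f g x : cochain n f -> cochain n g -> ncochain m x ->
  lcup n m (fun t => c *: f t + g t) x = c *: lcup n m f x + lcup n m g x.
Proof.
move=> cf cg [_ xp]; apply/funext => t; rewrite !hfunE /lcup -cutsZ -cutsD.
apply: eq_cuts => u v; rewrite (@slotP' _ (fun a => bm_l a _ (x v))) //.
  by rewrite scalerDr !scalerA mulrC.
exact: bm_l_homog.
Qed.

Lemma rcupPr n m (c : F) x f g : ncochain n x -> cochain m f -> cochain m g ->
  rcup n m x (fun t => c *: f t + g t) = c *: rcup n m x f + rcup n m x g.
Proof.
move=> [_ xp] cf cg; apply/funext => t; rewrite !hfunE /rcup -cutsZ -cutsD.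
apply: eq_cuts => u v; rewrite (@slotP' _ (fun a => bm_r _ (x u) a)) //.
  by rewrite scalerDr !scalerA mulrC.
exact: bm_r_homog.
Qed.

Lemma lcup_linear n m f : linear (lcup n m f : CN -> CN).
Proof.
move=> c x y; apply/funext => t; rewrite !hfunE /lcup -cutsZ -cutsD.
apply: eq_cuts => u v; rewrite !hfunE (bm_l_linear (letter n f u)).
by rewrite scalerDr !scalerA mulrC.
Qed.

Lemma structE' : struct = (fun t => (-1 : F) *: acup (-1) iota iota t + da iota t).
Proof. by apply/funext => t; rewrite structE scaleN1r addrC. Qed.

Lemma lcup_struct n x : ncochain n x -> lcup (-1 - 1) n struct x =
  lcup (-1 - 1) n (da iota) x - lcup (-1 - 1) n (acup (-1) iota iota) x.
Proof.
move=> cx; have ci := iota_cochain A; rewrite structE' lcupPl //.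
- by rewrite scaleN1r addrC.
- exact: acup_cochain.
- exact: da_cochain.
Qed.

Lemma rcup_struct n x : ncochain n x -> rcup n (-1 - 1) x struct =
  rcup n (-1 - 1) x (da iota) - rcup n (-1 - 1) x (acup (-1) iota iota).
Proof.
move=> cx; have ci := iota_cochain A; rewrite structE' rcupPr //.
- by rewrite scaleN1r addrC.
- exact: acup_cochain.
- exact: da_cochain.
Qed.

(** After the compatibilities above have been applied, all the terms cancel in
    pairs: the square of the insertion vanishes, and what it does to [iota] in a
    product is the structure cochain, that is, the sum of the derivative of
    [iota] and of its square. *)
Lemma hochschild_dd n x : ncochain n x ->
  hochschild_d (n - 1) (hochschild_d n x) = 0.
Proof.
move=> cx; have ci := iota_cochain A; have cs := struct_cochain A.
have c1 := dcoef_cochain cx; have c2 := ins_struct_ncochain cx.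
have c3 := lcup_iota_cochain cx; have c4 := rcup_iota_cochain cx.
have dl := @hochschild_d_linear F A N (n - 1).
rewrite {1}(hochschild_dE cx) (linD' dl) (linB' dl) (linD' dl) !(linZ' dl).
rewrite !hochschild_dE //.
rewrite dcoef_dcoef // (_ : dcoef (n - 1) (ins _ _ _) = ins (-1 - 1) struct (dcoef n x)); last first.
  by rewrite -dcoef_ins; congr (dcoef _ _); ring.
rewrite (_ : ins _ _ (ins _ _ _) = 0); last first.
  by apply/funext => t; apply: ins_struct_sq; case: cx.
have -> : dcoef (n - 1) (lcup (-1) n iota x) =
    lcup (-1 - 1) n (da iota) x - lcup (-1) (n - 1) iota (dcoef n x).
  rewrite (_ : n - 1 = -1 + n); last by ring.
  rewrite (dcoef_lcup ci cx) (_ : -1 + n = n - 1); last by ring.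
  by linear_sgn.
have -> : dcoef (n - 1) (rcup n (-1) x iota) =
    rcup (n - 1) (-1) (dcoef n x) iota + sgn F n *: rcup n (-1 - 1) x (da iota).
  exact: (dcoef_rcup cx ci).
have -> : (ins (-1 - 1) struct (lcup (-1) n iota x) : CN) =
    sgn F n *: lcup (-1 - 1) n struct x
    + lcup (-1) (n - 1) iota (ins (-1 - 1) struct x).
  rewrite (ins_lcup ci cx cs) ins_struct_iota (_ : n + _ + 1 = n - 1); last by ring.
  rewrite (_ : -1 + (-1 - 1) + 1 = -1 - 1) //.
  by linear_sgn.
have -> : (ins (-1 - 1) struct (rcup n (-1) x iota) : CN) =
    - rcup (n - 1) (-1) (ins (-1 - 1) struct x) iota + rcup n (-1 - 1) x struct.
  rewrite (ins_rcup cx ci cs) ins_struct_iota (_ : n + _ + 1 = n - 1); last by ring.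
  rewrite (_ : -1 + (-1 - 1) + 1 = -1 - 1) //.
  by linear_sgn.
have -> : lcup (-1) (n - 1) iota (lcup (-1) n iota x) =
    lcup (-1 - 1) n (acup (-1) iota iota) x.
  by rewrite -(lcupA ci ci cx) addrC.
have -> : rcup (n - 1) (-1) (rcup n (-1) x iota) iota =
    rcup n (-1 - 1) x (acup (-1) iota iota).
  exact: rcupA.
have -> : lcup (-1) (n - 1) iota (rcup n (-1) x iota) =
    rcup (n - 1) (-1) (lcup (-1) n iota x) iota.
  by rewrite (lrcupA ci cx ci) addrC.
rewrite lcup_struct // rcup_struct //.
linear_sgn.
Qed.

Lemma hochschild_d_self n f : cochain n f ->
  (hochschild_d n (f : hfun (self_bimodule A)) : CA) = (fun t =>
    da f t + sgn F n *: ins (-1 - 1) struct f t - acup n iota f t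
    + sgn F n *: acup (-1) f iota t).
Proof.
move=> cf; have ci := iota_cochain A.
rewrite (@hochschild_dE F A (self_bimodule A)) //.
by rewrite (lcup_self _ _ ci) (rcup_self _ _ ci).
Qed.

(** Each term of the differential is a derivation, except that [iota] can enter
    between [f] and [x]; it does so in two ways, which cancel. *)
Lemma hochschild_d_lcup n m f x : cochain n f -> ncochain m x ->
  hochschild_d (n + m) (lcup n m f x) =
    lcup (n - 1) m (hochschild_d n (f : hfun (self_bimodule A)) : CA) x
    + sgn F n *: lcup n (m - 1) f (hochschild_d m x).
Proof.
move=> cf cx; have ci := iota_cochain A; have cs := struct_cochain A.
have cdf := da_cochain cf.
have csf : cochain (n - 1) (ins (-1 - 1) struct f).
  by apply: cochain_cast (ins_cochain cf cs) _; ring.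
have cif : cochain (n - 1) (acup n iota f).
  by apply: cochain_cast (acup_cochain ci cf) _; ring.
have cfi : cochain (n - 1) (acup (-1) f iota) := acup_cochain cf ci.
rewrite hochschild_dE; last exact: lcup_cochain.
have -> : lcup (n - 1) m (hochschild_d n (f : hfun (self_bimodule A)) : CA) x =
    lcup (n - 1) m (da f) x + sgn F n *: lcup (n - 1) m (ins (-1 - 1) struct f) x
    - lcup (n - 1) m (acup n iota f) x
    + sgn F n *: lcup (n - 1) m (acup (-1) f iota) x.
  rewrite hochschild_d_self //.
  have -> : (fun t => da f t + sgn F n *: ins (-1 - 1) struct f t
      - acup n iota f t + sgn F n *: acup (-1) f iota t) =
    (fun t => (-1) *: acup n iota f t + (sgn F n *: acup (-1) f iota t
      + (sgn F n *: ins (-1 - 1) struct f t + da f t))).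
    by apply/funext => t; linear_coefs; ring.
  have c1 : cochain (n - 1) (fun t => sgn F n *: ins (-1 - 1) struct f t + da f t).
    exact: cochain_lin.
  have c2 := cochain_lin (sgn F n) cfi c1.
  rewrite lcupPl // lcupPl // lcupPl //.
  by linear_coefs; ring.
rewrite (dcoef_lcup cf cx) (ins_lcup cf cx cs).
rewrite (hochschild_dE cx).
have ll := lcup_linear n (m - 1) f.
rewrite (linD' ll) (linB' ll) (linD' ll) !(linZ' ll).
rewrite (_ : lcup (-1) (n + m) iota _ = lcup (n - 1) m (acup n iota f) x); last first.
  by rewrite (lcupA ci cf cx) addrC.
rewrite -(lrcupA cf cx ci).
rewrite -(lcupA cf ci cx) (_ : -1 + m = m - 1); last by ring.
rewrite (_ : n + _ + 1 = n - 1); last by ring.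
rewrite (_ : m + _ + 1 = m - 1); last by ring.
linear_sgn.
Qed.

End HochschildComplex.

(** * The bracket of cochains *)

Section Bracket.
Variables (F : fieldType) (A : dgAlgebra F).
Implicit Types (t u v p q r : seq (helt A)) (a c : helt A).
Local Notation CA := (seq (helt A) -> A).
Local Notation iota := (@iota F A).
Local Notation struct := (@struct F A).
Local Notation S := (self_bimodule A).
Implicit Types (f g h : CA) (n m k : int).

Local Notation d n f := (hochschild_d n (f : hfun S) : CA).

Lemma ins_in_struct n f t : cochain n f ->
  ins n f struct t = da f t - acup n iota f t + sgn F n *: acup (-1) f iota t.
Proof.
move=> cf; have ci := iota_cochain A.
have iE : ins n f iota = f by apply/funext => u; exact: ins_iota.
rewrite structE' insD insZ (ins_acup _ ci ci cf) !iE.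
have e : ins n f (da iota) t = da f t.
  have := congr1 (fun x : hfun S => x t) (@dcoef_ins F A S (-1) n f iota).
  by rewrite iE => <-.
rewrite e (_ : -1 + n + 1 = n); last by ring.
linear_sgn.
Qed.

(** In this form the differential is a commutator of insertions, so that [preLie]
    computes it on further insertions. *)
Lemma hochschild_d_ins n f t : cochain n f ->
  d n f t = ins n f struct t + sgn F n *: ins (-1 - 1) struct f t.
Proof.
by move=> cf; rewrite hochschild_d_self // ins_in_struct //; linear_coefs; ring.
Qed.

(** Only words of length two survive: the structure cochain multiplies the values
    of [f] and [g]. *)
Lemma ins2_struct n m f g t : cochain n f -> cochain m g ->
  ins2 n f m g struct t = sgn F n *: acup m f g t.
Proof.
move=> cf cg; rewrite /ins2.
have s0 a p q x y z :
    struct ((a :: p) ++ letter n f q :: x ++ letter m g y :: z) = 0.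
  by case: p => [|b [|c p]]; case: x => [|b' x].
have s1 q a x y z : struct (letter n f q :: (a :: x) ++ letter m g y :: z) = 0.
  by case: x.
have s2 q y a z : struct [:: letter n f q, letter m g y, a & z] = 0 by [].
rewrite cuts_head => [|a p w]; last first.
  rewrite cuts_zero // => q r; rewrite cuts_zero // => x v.
  by rewrite cuts_zero // => y z; rewrite s0 scaler0.
rewrite /acup -cutsZ; apply: eq_cuts => q r.
rewrite cuts_head => [|a x v]; last first.
  by rewrite cuts_zero // => y z; rewrite s1 scaler0.
rewrite cuts_tail => [|a y z]; last by rewrite s2 scaler0.
rewrite /= !hval_letter // !sgnZZ; apply: sgnZ_par; psolve.
Qed.

Lemma slot_insl (V : lmodType F) n (c : F) f g (phi : seq (helt A) -> V) t :
  multilinear phi -> cochain n f -> cochain n g ->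
  ins n (fun t => c *: f t + g t) phi t = c *: ins n f phi t + ins n g phi t.
Proof.
move=> lphi cf cg; rewrite /ins -cutsZ -cutsD; apply: eq_cuts => p w.
rewrite -cutsZ -cutsD; apply: eq_cuts => q r.
rewrite (@slotP' _ _ _ (fun a => phi (p ++ a :: r))) //.
by rewrite scalerDr !scalerA mulrC.
Qed.

Lemma d_cochain n f : cochain n f -> cochain (n - 1) (d n f).
Proof. by move=> cf; exact: (@hochschild_d_cochain F A S). Qed.

(** Each of the three insertions is reordered by [preLie]; the disjoint insertions
    into the structure cochain leave the two products. *)
Lemma hochschild_d_circ n m f g t : cochain n f -> cochain m g ->
  d (n + m + 1) (ins m g f) t =
    ins m g (d n f) t + sgn F (n + 1) *: ins (m - 1) (d m g) f t
    - sgn F n *: acup m f g t + sgn F (n * m + n) *: acup n g f t.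
Proof.
move=> cf cg; have cs := struct_cochain A.
have cfg := ins_cochain cf cg.
have [fl _] := cf; have [sl _] := cs.
have cbg : cochain (m - 1) (ins (-1 - 1) struct g).
  by apply: cochain_cast (ins_cochain cg cs) _; ring.
have cgb : cochain (m - 1) (ins m g struct).
  by apply: cochain_cast (ins_cochain cs cg) _; ring.
have -> : ins m g (d n f) t = ins m g (ins n f struct) t
    + sgn F n *: ins m g (ins (-1 - 1) struct f) t.
  by rewrite -insZ -insD; apply: eq_ins => u; exact: hochschild_d_ins.
have -> : ins (m - 1) (d m g) f t = ins (m - 1) (ins m g struct) f t
    + sgn F m *: ins (m - 1) (ins (-1 - 1) struct g) f t.
  have -> : d m g = fun t => sgn F m *: ins (-1 - 1) struct g t + ins m g struct t.
    by apply/funext => u; rewrite hochschild_d_ins // addrC.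
  by rewrite slot_insl // addrC.
rewrite hochschild_d_ins //.
rewrite (preLie t cf cg sl) (preLie t cg cs fl) (preLie t cs cg fl).
rewrite !ins2_struct // (_ : m + _ + 1 = m - 1); last by ring.
rewrite (_ : -1 - 1 + _ + 1 = m - 1); last by ring.
linear_sgn.
Qed.

Definition bracket n m f g : CA := fun t =>
  ins m g f t - sgn F ((n + 1) * (m + 1)) *: ins n f g t.

Lemma bracketE n m f g : hochschild_bracket n m (f : hochschild S) g = bracket n m f g.
Proof.
by rewrite /hochschild_bracket !circE.
Qed.

Lemma bracket_cochain n m f g : cochain n f -> cochain m g ->
  cochain (n + m + 1) (bracket n m f g).
Proof.
move=> cf cg; have c1 := ins_cochain cf cg.
have c2 : cochain (n + m + 1) (ins n f g).
  by apply: cochain_cast (ins_cochain cg cf) _; ring.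
have -> : bracket n m f g =
    fun t => (- sgn F ((n + 1) * (m + 1))) *: ins n f g t + ins m g f t.
  by apply/funext => t; rewrite /bracket; linear_coefs; ring.
exact: cochain_lin.
Qed.

Lemma hochschild_d_bracket n m f g t : cochain n f -> cochain m g ->
  d (n + m + 1) (bracket n m f g) t =
    bracket (n - 1) m (d n f) g t
    + sgn F (n + 1) *: bracket n (m - 1) f (d m g) t.
Proof.
move=> cf cg.
have -> : d (n + m + 1) (bracket n m f g) t = d (n + m + 1) (ins m g f) t
    - sgn F ((n + 1) * (m + 1)) *: d (m + n + 1) (ins n f g) t.
  rewrite (_ : m + n = n + m); last by ring.
  have dl := @hochschild_d_linear F A S (n + m + 1).
  have := congr1 (fun x : hfun S => x t) (linB' dl (ins m g f : hfun S)
    (sgn F ((n + 1) * (m + 1)) *: (ins n f g : hfun S))).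
  by rewrite (linZ' dl) !hfunE.
rewrite !hochschild_d_circ // /bracket.
rewrite (_ : n - 1 + 1 = n); last by ring.
rewrite (_ : m - 1 + 1 = m); last by ring.
linear_sgn.
Qed.

(** The bracket is the commutator of a right pre-Lie product. *)
Lemma bracket_jacobi n m k f g h t : cochain n f -> cochain m g -> cochain k h ->
  bracket n (m + k + 1) f (bracket m k g h) t =
    bracket (n + m + 1) k (bracket n m f g) h t
    + sgn F ((n + 1) * (m + 1)) *: bracket m (n + k + 1) g (bracket n k f h) t.
Proof.
move=> cf cg ch; have [fl _] := cf; have [gl _] := cg; have [hl _] := ch.
have ins_br i j x y (z : CA) : multilinear z -> cochain i x -> cochain j y ->
  ins (i + j + 1) (bracket i j x y) z t = ins (i + j + 1) (ins j y x) z t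
    - sgn F ((i + 1) * (j + 1)) *: ins (i + j + 1) (ins i x y) z t.
  move=> lz cx cy.
  have -> : bracket i j x y = fun t => (- sgn F ((i + 1) * (j + 1))) *: ins i x y t
      + ins j y x t.
    by apply/funext => u; rewrite /bracket; linear_coefs; ring.
  rewrite slot_insl //; first by linear_coefs; ring.
  - by apply: cochain_cast (ins_cochain cy cx) _; ring.
  - exact: ins_cochain.
have br_ins i j l w x y : ins l w (bracket i j x y) t = ins l w (ins j y x) t
    - sgn F ((i + 1) * (j + 1)) *: ins l w (ins i x y) t.
  rewrite -insZ -[- ins _ _ _ _]scaleN1r -insZ -insD; apply: eq_ins => u.
  by rewrite scaleN1r.
rewrite {1}/bracket [X in _ = X + _]/bracket [X in _ = _ + _ *: X]/bracket.
rewrite !br_ins !ins_br //.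
rewrite (preLie t cf cg hl) (preLie t cg cf hl) (preLie t cf ch gl)
  (preLie t ch cf gl) (preLie t cg ch fl) (preLie t ch cg fl).
rewrite (_ : k + m + 1 = m + k + 1); last by ring.
rewrite (_ : m + n + 1 = n + m + 1); last by ring.
rewrite (_ : k + n + 1 = n + k + 1); last by ring.
linear_sgn.
Qed.

End Bracket.

(** * Classes of cocycles *)

Section HomologyClasses.
Variables (F : fieldType) (C : precomplex F).
Implicit Types (z w : C) (n : int).

Lemma hrepr_cycle n (x : homology C n) : hrepr x \in cycle C n.
Proof. exact: valP. Qed.

Lemma hreprK n (x : homology C n) : hclass C n (hrepr x) = x.
Proof.
by rewrite /hclass /hrepr valKd lreprK.
Qed.

Lemma hclassP n (x : homology C n) :
  exists2 z, z \in cycle C n & x = hclass C n z.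
Proof. by exists (hrepr x); rewrite ?hrepr_cycle ?hreprK. Qed.

Lemma hclass_eq n z w : z \in cycle C n -> w \in cycle C n ->
  hclass C n z = hclass C n w <->
  exists2 y, y \in piece C (n + 1) & pc_d (n + 1) y = z - w.
Proof.
move=> cz cw; rewrite /hclass lpi_eq.
have e : val (insubd (0 : cycles C n) z - insubd 0 w) = z - w.
  by rewrite raddfB /= !val_insubd cz cw.
split=> [/asboolP[y py dy]|[y py dy]]; first by exists y; rewrite // -e.
by apply/asboolP; exists y; rewrite // e.
Qed.

Lemma hclass_lin n (c : F) z w : z \in cycle C n -> w \in cycle C n ->
  hclass C n (c *: z + w) = c *: hclass C n z + hclass C n w.
Proof.
move=> cz cw; rewrite /hclass; set Z := insubd _ z; set W := insubd _ w.
rewrite -[c *: lpi _ _]/(lquot_scale c (lpi _ _)) lpi_scale -lpiD.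
congr lpi; apply: val_inj; rewrite val_insubd (proj2 (cycle_closed C n)) //.
by rewrite linearP /= !val_insubd cz cw.
Qed.

End HomologyClasses.

Section InducedMaps.
Variables (F : fieldType) (C C' : precomplex F).

Definition homologous n (z w : C) : Prop :=
  exists2 y, y \in piece C (n + 1) & pc_d (n + 1) y = z - w.

Lemma homology_map_induced n m (phi : C -> C') :
  (forall z, z \in cycle C n -> phi z \in cycle C' m) ->
  (forall z w, z \in cycle C n -> w \in cycle C n -> homologous n z w ->
     hclass C' m (phi z) = hclass C' m (phi w)) ->
  induced1 phi (@homology_map F C C' n m phi).
Proof.
move=> cphi bphi z cz; split; first exact: cphi.
apply: bphi; rewrite ?hrepr_cycle //; apply/hclass_eq => //.
  exact: hrepr_cycle.
exact: hreprK.
Qed.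

Lemma induced2_intro (D : precomplex F) n m k (phi : D -> D -> D) :
  (forall z w, z \in cycle D n -> w \in cycle D m -> phi z w \in cycle D k) ->
  (forall z z' w, z \in cycle D n -> z' \in cycle D n -> w \in cycle D m ->
     hclass D n z = hclass D n z' ->
     hclass D k (phi z w) = hclass D k (phi z' w)) ->
  (forall z w w', z \in cycle D n -> w \in cycle D m -> w' \in cycle D m ->
     hclass D m w = hclass D m w' ->
     hclass D k (phi z w) = hclass D k (phi z w')) ->
  induced2 phi (fun (x : homology D n) (y : homology D m) =>
    hclass D k (phi (hrepr x) (hrepr y))).
Proof.
move=> cphi b1 b2 z w cz cw; split; first exact: cphi.
have cz' := hrepr_cycle (hclass D n z); have cw' := hrepr_cycle (hclass D m w).
by rewrite (b1 _ z) ?hreprK // (b2 z _ w) ?hreprK.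
Qed.

End InducedMaps.

Section HochschildCycles.
Variables (F : fieldType) (A : dgAlgebra F) (N : dgBimodule A).
Implicit Types (x y z : hfun N) (n : int).

Lemma cycleP n x :
  x \in cycle (hochschild N) n <-> ncochain n x /\ hochschild_d n x = 0.
Proof.
have -> : (x \in cycle (hochschild N) n) =
  (x \in piece (hochschild_space N) n) && (hochschild_d n x == 0) by [].
split=> [/andP[/ncochainP cx /eqP dx] //|[cx dx]].
by apply/andP; split; [apply/ncochainP | apply/eqP].
Qed.

Lemma hochschild_homologous n x y : x \in cycle (hochschild N) n ->
  y \in cycle (hochschild N) n ->
  hclass (hochschild N) n x = hclass (hochschild N) n y <->
  exists2 z, ncochain (n + 1) z & hochschild_d (n + 1) z = x - y.
Proof.
move=> cx cy; rewrite hclass_eq //.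
by split=> -[z /ncochainP cz dz]; exists z.
Qed.

End HochschildCycles.

Section AlgebraClasses.
Variables (F : fieldType) (A : dgAlgebra F).
Local Notation CA := (seq (helt A) -> A).
Local Notation S := (self_bimodule A).
Local Notation C := (hochschild S).
Implicit Types (f g : CA) (n m k : int).

Local Notation d n f := (hochschild_d n (f : hfun S) : CA).

Lemma hochschild_cupE m f g : hochschild_cup m (f : C) g = acup m f g.
Proof. by apply/funext => t; rewrite /acup -cuts_big. Qed.

Lemma hochschild_d_acup n m f g : cochain n f -> cochain m g ->
  d (n + m) (acup m f g) =
  (fun t => acup m (d n f) g t + sgn F n *: acup (m - 1) f (d m g) t).
Proof.
move=> cf cg; have /cochain_self cg' := cg.
have := hochschild_d_lcup cf cg'.
rewrite (lcup_self _ _ (d_cochain cf)) !(lcup_self _ _ cf) => ->.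
by apply/funext => t.
Qed.

Lemma acup1l m f : acup m (@hochschild_one F A) f = f.
Proof.
apply/funext => t; rewrite /acup cuts_head => [|a u v].
  by rewrite bdeg_nil mulr0 sgnZ0 dga_mul1l.
by rewrite /= (lin0' (dga_mul_linear_l (f v))) scaler0.
Qed.

Lemma acup1r f : acup 0 f (@hochschild_one F A) = f.
Proof.
apply/funext => t; rewrite /acup cuts_tail => [|a u v].
  by rewrite mul0r sgnZ0 dga_mul1r.
by rewrite /= (lin0' (dga_mul_linear_r (f u))) scaler0.
Qed.

Lemma d_one : dga_d (dga_one A) = 0.
Proof.
have := @dga_leibniz F A 0 (dga_one A) (dga_one A) (gr_one A).
rewrite !dga_mul1l dga_mul1r sgnZ0 => e.
by apply: (@addrI _ (dga_d (dga_one A))); rewrite addr0 -e.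
Qed.

Lemma one_cycle : @hochschild_one F A \in cycle C 0.
Proof.
have co : cochain 0 (@hochschild_one F A).
  split=> [s t c a b e _ _ _|[|a t]]; last exact: (@piece0 _ (dga_space A)).
    by case: s => [|? ?]; rewrite /= scaler0 addr0.
  by rewrite bdeg_nil addr0; exact: gr_one.
apply/cycleP; split=> //; rewrite (hochschild_d_self co).
have ci := iota_cochain A; have cs := struct_cochain A.
apply/funext => t; rewrite !sgnZ0.
have d1 := d_one.
rewrite acup1l acup1r subrK.
have -> : da (@hochschild_one F A) t = 0.
  by case: t => [|a t]; rewrite /da //= (lin0' (@dga_d_linear F A)).
rewrite add0r /ins cuts_zero // => p w; rewrite cuts_zero // => q r.
by case: p => [|a p]; rewrite /= scaler0.
Qed.

Definition subf f g : CA := fun t => f t - g t.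

(** Serves both for the product, with [c = e = 0], and for the bracket, with
    [c = e = 1]. *)
Lemma derivation_induced (phi : int -> int -> CA -> CA -> CA)
    (k : int -> int -> int) (c e : int) n m :
  (forall n m, k n m = n + m + c) ->
  (forall n m f g, cochain n f -> cochain m g ->
     cochain (k n m) (phi n m f g)) ->
  (forall n m f f' g, cochain n f -> cochain n f' -> cochain m g ->
     phi n m (subf f f') g = subf (phi n m f g) (phi n m f' g)) ->
  (forall n m f g g', cochain n f -> cochain m g -> cochain m g' ->
     phi n m f (subf g g') = subf (phi n m f g) (phi n m f g')) ->
  (forall n m f g, cochain n f -> cochain m g ->
     d (k n m) (phi n m f g) = (fun t =>
       phi (n - 1) m (d n f) g t + sgn F (n + e) *: phi n (m - 1) f (d m g) t)) ->
  induced2 (phi n m : C -> C -> C)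
    (fun (x : HH S n) (y : HH S m) =>
       hclass C (k n m) (phi n m (hrepr x) (hrepr y) : C)).
Proof.
move=> kE phic phiBl phiBr dphi.
have z1 i j f g : cochain i f -> cochain j g -> phi i j 0 g = fun=> 0.
  move=> cf cg; have <- : subf f f = 0 by apply/funext => t; exact: subrr.
  by rewrite phiBl //; apply/funext => t; exact: subrr.
have z2 i j f g : cochain i f -> cochain j g -> phi i j f 0 = fun=> 0.
  move=> cf cg; have <- : subf g g = 0 by apply/funext => t; exact: subrr.
  by rewrite phiBr //; apply/funext => t; exact: subrr.
have cc f g : f \in cycle C n -> g \in cycle C m ->
    phi n m f g \in cycle C (k n m).
  move=> /cycleP[cf df] /cycleP[cg dg]; apply/cycleP.
  split; first exact: phic.
  have cdf := d_cochain cf; have cdg := d_cochain cg.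
  rewrite (dphi _ _ _ _ cf cg) df dg (z1 _ _ _ _ cdf cg) (z2 _ _ _ _ cf cdg).
  by apply/funext => t; rewrite scaler0 addr0.
apply: induced2_intro => // [f f' g|f g g'] cf cf' cg.
  move=> /(hochschild_homologous cf cf')[y cy dy].
  apply/hochschild_homologous; rewrite ?cc //.
  have /cycleP[cg' dg] := cg; have cdg := d_cochain cg'.
  exists (phi (n + 1) m y g).
    by apply/cochain_self/(cochain_cast (phic _ _ _ _ cy cg')); rewrite !kE; ring.
  rewrite (_ : k n m + 1 = k (n + 1) m); last by rewrite !kE; ring.
  rewrite (dphi _ _ _ _ cy cg') dg dy (z2 _ _ _ _ cy cdg) addrK.
  have /cycleP[c1 _] := cf; have /cycleP[c2 _] := cf'.
  rewrite (phiBl _ _ _ _ _ c1 c2 cg').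
  by apply/funext => t; rewrite scaler0 addr0.
move=> /(hochschild_homologous cf' cg)[y cy dy].
apply/hochschild_homologous; rewrite ?cc //.
have /cycleP[cf1 df] := cf; have cdf := d_cochain cf1.
exists (sgn F (n + e) *: (phi n (m + 1) f y : hfun S)).
  by apply: ncochainZ; apply/cochain_self/(cochain_cast (phic _ _ _ _ cf1 cy)); rewrite !kE; ring.
rewrite (linZ' (@hochschild_d_linear F A S _)).
rewrite (_ : k n m + 1 = k n (m + 1)); last by rewrite !kE; ring.
rewrite (dphi _ _ _ _ cf1 cy) df dy (z1 _ _ _ _ cdf cy) addrK.
have /cycleP[c1 _] := cf'; have /cycleP[c2 _] := cg.
rewrite (phiBr _ _ _ _ _ cf1 c1 c2).
apply/funext => t; rewrite !hfunE add0r sgnZZ.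
by rewrite (@sgn_eq_par _ _ 0) ?sgnZ0 //; psolve.
Qed.

Lemma acup_induced n m : induced2 (@hochschild_cup F A m) (@HH_cup F A n m).
Proof.
have e : @hochschild_cup F A m = acup m.
  by apply/funext => f; apply/funext => g; rewrite hochschild_cupE.
rewrite /HH_cup e.
apply: (@derivation_induced (fun n m => acup m) (fun n m => n + m) 0 0) => //.
- by move=> i j; rewrite addr0.
- by move=> *; exact: acup_cochain.
- by move=> i j f f' g _ _ _; apply/funext => t; exact: acupBl.
- by move=> i j f g g' _ _ _; apply/funext => t; exact: acupBr.
- by move=> i j f g cf cg; rewrite hochschild_d_acup // addr0.
Qed.

Lemma bracket_linl n m c f f' g : cochain n f -> cochain n f' -> cochain m g ->
  bracket n m (fun t => c *: f t + f' t) g =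
  (fun t => c *: bracket n m f g t + bracket n m f' g t).
Proof.
move=> cf cf' cg; apply/funext => t; rewrite /bracket.
rewrite slot_insl //; last by case: cg.
rewrite insD insZ; linear_coefs; ring.
Qed.

Lemma bracketBl n m f f' g : cochain n f -> cochain n f' -> cochain m g ->
  bracket n m (subf f f') g = subf (bracket n m f g) (bracket n m f' g).
Proof.
move=> cf cf' cg.
have e (x y : CA) : subf x y = fun t => (-1) *: y t + x t.
  by apply/funext => t; rewrite scaleN1r addrC.
by rewrite !e bracket_linl.
Qed.

Lemma bracketC n m f g : bracket n m f g =
  fun t => - sgn F ((n + 1) * (m + 1)) *: bracket m n g f t.
Proof.
apply/funext => t; rewrite /bracket; linear_sgn.
Qed.

Lemma bracketBr n m f g g' : cochain n f -> cochain m g -> cochain m g' ->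
  bracket n m f (subf g g') = subf (bracket n m f g) (bracket n m f g').
Proof.
move=> cf cg cg'; rewrite bracketC (bracketC n m f g) (bracketC n m f g').
rewrite bracketBl //; apply/funext => t; rewrite /subf; linear_coefs; ring.
Qed.

Lemma bracket_induced n m :
  induced2 (@hochschild_bracket F A n m) (@HH_bracket F A n m).
Proof.
have e : @hochschild_bracket F A n m = bracket n m.
  by apply/funext => f; apply/funext => g; rewrite bracketE.
rewrite /HH_bracket e.
apply: (@derivation_induced (@bracket F A) (fun n m => n + m + 1) 1 1) => //.
- by move=> *; exact: bracket_cochain.
- by move=> *; exact: bracketBl.
- by move=> *; exact: bracketBr.
- by move=> i j f g cf cg; apply/funext => t; exact: hochschild_d_bracket.
Qed.

(** The insertion of [g] into [f] is the homotopy, by [hochschild_d_circ]. *)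
Lemma acup_commutes n m f g : f \in cycle C n -> g \in cycle C m ->
  exists2 y, @ncochain F A S (n + m + 1) y & hochschild_d (n + m + 1) y =
    (acup m f g : hfun S) - sgn F (n * m) *: (acup n g f : hfun S).
Proof.
move=> /cycleP[cf df] /cycleP[cg dg].
exists (- sgn F n *: (ins m g f : hfun S)).
  by apply: ncochainZ; apply/cochain_self/ins_cochain.
rewrite (linZ' (@hochschild_d_linear F A S _)).
apply/funext => t; rewrite !hfunE.
have := hochschild_d_circ t cf cg; rewrite df dg => ->.
have fl : multilinear f by case: cf.
have -> : ins m g (0 : hfun S) t = 0.
  by apply: cuts_zero => p w; apply: cuts_zero => q r; rewrite scaler0.
have -> : ins (m - 1) (0 : hfun S) f t = 0.
  apply: cuts_zero => p w; apply: cuts_zero => q r.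
  by rewrite (@slot_eq0 _ _ _ (fun a => f (p ++ a :: r))) ?scaler0.
linear_sgn.
Qed.

End AlgebraClasses.

(** * Cyclic words *)

Section Cyclic.
Variables (F : fieldType) (A : dgAlgebra F) (V : lmodType F).
Implicit Types (s t u v p q r w x y : seq (helt A)) (a c l : helt A).
Local Notation struct := (@struct F A).
Local Notation b q := (letter (-1 - 1) struct q).
Implicit Types (M phi : seq (helt A) -> V).
Implicit Types (Phi : seq (helt A) -> helt A -> seq (helt A) -> V).

(** Functions of a cyclic word are functions of a linear word which is cut at its
    first letter; the structure cochain is inserted into the cyclic word, and the
    result is cut so that [c], or the letter which contains [c], stays first. *)
Definition cyc_d M w : V :=
  if w is c :: t then
    \cuts_(y | p | x <- t)
      (sgn F (bdeg x * (deg c + 1 + bdeg y + bdeg p)) *: M (b (x ++ c :: y) :: p))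
    + sgn F (deg c + 1) *: ins (-1 - 1) struct (fun t => M (c :: t)) t
  else 0.

(** The marked letter is the first one of the cyclic word, and [s] is the part of
    the word which the cut puts in front of it; the sign is that of the rotation. *)
Definition cyc Phi w : V :=
  if w is c :: t then
    \cuts_(r | s <- t) (sgn F ((deg c + 1 + bdeg r) * bdeg s) *: Phi s c r)
  else 0.

(** Insertion of the structure cochain into a linear word with a marked letter,
    which remains marked when it is absorbed. *)
Definition marked_d Phi s c r : V :=
  ins (-1 - 1) struct (fun s => Phi s c r) s
  + sgn F (bdeg s + deg c + 1) *: ins (-1 - 1) struct (Phi s c) r
  + \cuts_(s' | x <- s) \cuts_(y | r' <- r)
      (sgn F (bdeg s') *: Phi s' (b (x ++ c :: y)) r').

Lemma marked_d_ins phi s c r :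
  marked_d (fun s c r => phi (s ++ c :: r)) s c r = ins (-1 - 1) struct phi (s ++ c :: r).
Proof.
rewrite /marked_d /ins cuts3_mark addrAC; congr (_ + _ + _).
- by do 2!apply: eq_cuts => *; rewrite -catA.
- rewrite -cutsZ; apply: eq_cuts => p w; rewrite -cutsZ; apply: eq_cuts => q z.
  by rewrite sgnZZ -catA; apply: sgnZ_par; psolve.
- by do 2!apply: eq_cuts => *; apply: sgnZ_par; psolve.
Qed.

Lemma ins_sgn1 k h (l : int -> int) (phi : seq (helt A) -> V) t :
  ins k h (fun u => sgn F (l (bdeg u)) *: phi u) t =
  sgn F (l (bdeg t + (k + 1))) *: ins k h phi t.
Proof.
rewrite /ins -cutsZ; apply: eq_cuts_in => p w ->; rewrite -cutsZ.
apply: eq_cuts_in => q r ->; rewrite !sgnZZ; congr (sgn F _ *: _).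
rewrite addrC; congr (l _ + _).
by rewrite !(bdeg_cat, bdeg_cons) deg_letter; ring.
Qed.

(** Cutting a cyclic word open and inserting the structure cochain commute, since
    the insertion takes place away from the cut. *)
Lemma cyc_d_cyc Phi w : cyc_d (cyc Phi) w = cyc (marked_d Phi) w.
Proof.
case: w => [//|c t]; rewrite /cyc_d /cyc ins_cuts /marked_d.
under [RHS]eq_cuts => r s do rewrite !scalerDr.
rewrite !cutsD addrC scalerDr; congr (_ + _); first rewrite addrC; first congr (_ + _).
- rewrite -cutsZ; apply: eq_cuts => r s.
  rewrite (ins_sgn1 _ _ (fun i => (deg c + 1 + i) * bdeg s)) !sgnZZ.
  by apply: sgnZ_par; psolve.
- rewrite -cutsZ; apply: eq_cuts => r s.
  rewrite ins_sgn !sgnZZ.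
  by apply: sgnZ_par; psolve.
transitivity (\cuts_(y | r | z <- t) \cuts_(s | x <- z)
   (sgn F ((deg c + 1 + bdeg y + bdeg r) * (bdeg s + bdeg x) + bdeg s) *:
      Phi s (b (x ++ c :: y)) r)).
  apply: eq_cuts => y v; rewrite -[RHS]cuts_assoc; apply: eq_cuts => p x.
  rewrite -cutsZ; apply: eq_cuts_in => r s ->; rewrite sgnZZ.
  by apply: sgnZ_par; psolve.
rewrite -[LHS]cuts_assoc; apply: eq_cuts => v z.
rewrite (cuts_exchange (fun s x y r =>
  sgn F (bdeg s) *: Phi s (b (x ++ c :: y)) r)) -cutsZ.
apply: eq_cuts_in => y r ->; rewrite -cutsZ; apply: eq_cuts_in => s x ->.
by rewrite sgnZZ; apply: sgnZ_par; psolve.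
Qed.

End Cyclic.

(** * Cochains with dual coefficients as functionals on cyclic words *)

Section ChainDual.
Variables (F : fieldType) (A : dgAlgebra F).
Implicit Types (s t u v p q w x y : seq (helt A)) (a c l : helt A).
Local Notation struct := (@struct F A).
Local Notation b q := (letter (-1 - 1) struct q).
Local Notation Dual := (dual_bimodule A).
Implicit Types (M phi : seq (helt A) -> F^o) (g : hfun Dual) (n : int).

(** A word [a :: t] stands for the chain [a[t]]; no chain corresponds to the empty
    word. *)
Definition functional n M : Prop :=
  [/\ multilinear M, M [::] = 0
    & forall a t, deg a + bdeg t + n != 0 -> M (a :: t) = 0].

Lemma of_chain_dualK M : M [::] = 0 ->
  to_chain_dual (of_chain_dual M : hochschild Dual) = M.
Proof.
move=> M0; apply/funext => -[|a t] //=.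
by rewrite /of_chain_dual mulrA -sgnD (@sgn_eq_par _ _ 0) ?expr0z ?mul1r //; psolve.
Qed.

Lemma of_chain_dual_cochain n M : functional n M ->
  ncochain n (of_chain_dual M : hfun Dual).
Proof.
move=> [lM _ M0]; split.
  move=> s t k a c e da dc ev; apply/funext => x.
  rewrite -[RHS]/(k * of_chain_dual M (s ++ a :: t) x + of_chain_dual M (s ++ c :: t) x).
  rewrite /of_chain_dual !bdeg_cat !bdeg_cons da dc.
  have /= -> := lM (x :: s) t k a c e da dc ev.
  by rewrite mulrDr mulrCA.
move=> t; apply/asboolP; split.
  move=> k a c e da dc ev; rewrite /of_chain_dual da dc.
  have /= -> := lM [::] t k a c e da dc ev.
  by rewrite mulrDr mulrCA.
move=> a na; rewrite /of_chain_dual M0 ?mulr0 //.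
apply: contraNneq na => e; apply/eqP.
by rewrite -[RHS]addr0 -e; ring.
Qed.

Lemma to_chain_dual_functional n g : ncochain n g ->
  functional n (to_chain_dual (g : hochschild Dual)).
Proof.
move=> [lg pg]; split=> //.
  case=> [|x s] t k a c e da dc ev /=.
    rewrite da dc; have /asboolP[lgt _] := pg t.
    by rewrite (lgt k a c e da dc ev) mulrDr mulrCA.
  have -> := lg s t k a c e da dc ev.
  rewrite -[(_ + _) x]/(k * g (s ++ a :: t) x + g (s ++ c :: t) x).
  by rewrite !bdeg_cat !bdeg_cons da dc mulrDr mulrCA.
move=> a t na /=; have /asboolP[_ g0] := pg t.
rewrite g0 ?mulr0 //; apply: contraNneq na => ->; apply/eqP; ring.
Qed.

Lemma hfun_dualD g h t a : (g + h : hfun Dual) t a = g t a + h t a.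
Proof. by []. Qed.
Lemma hfun_dualN g t a : (- g : hfun Dual) t a = - g t a.
Proof. by []. Qed.
Lemma hfun_dualZ (k : F) g t a : (k *: g : hfun Dual) t a = k * g t a.
Proof. by []. Qed.

(** The structure cochain differentiates the first letter, or multiplies it by the
    next one or, across the cut, by the last one. *)
Lemma cyc_d_head M c t : multilinear M ->
  \cuts_(y | p | x <- t)
    (sgn F (bdeg x * (deg c + 1 + bdeg y + bdeg p)) *: M (b (x ++ c :: y) :: p)) =
  M (hd c :: t)
  + (if t is a :: u then sgn F (deg c) *: M (hmul c a :: u) else 0)
  + (if t is a :: u then
       sgn F ((deg (last a u) + 1) * (deg c + 1 + bdeg (belast a u)) + deg (last a u)) *:
         M (hmul (last a u) c :: belast a u) else 0).
Proof.
move=> lM.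
have lM1 p : homog_linear (fun a => M (a :: p)) := lM [::] p.
have b0 q p : struct q = 0 -> M (b q :: p) = 0.
  by move=> e; apply: (@slot_eq0 _ _ _ (fun a => M (a :: p))).
have b1 a p : M (b [:: a] :: p) = M (hd a :: p) by rewrite letter_struct1.
have b2 a a' p : M (b [:: a; a'] :: p) = sgn F (deg a) *: M (hmul a a' :: p).
  exact: (@slot_struct2 _ _ _ (fun a => M (a :: p))).
pose G y p x := sgn F (bdeg x * (deg c + 1 + bdeg y + bdeg p)) *: M (b (x ++ c :: y) :: p).
have zx y p a a' x : G y p [:: a, a' & x] = 0.
  by rewrite /G b0 ?scaler0 //; case: x => [|? ?].
have zxy a y p a' x : G (a :: y) p (a' :: x) = 0.
  by rewrite /G b0 ?scaler0 //; case: x => [|? [|? ?]].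
have zy a a' y p : G [:: a, a' & y] p [::] = 0 by rewrite /G b0 ?scaler0.
have G1 p : G [::] p [::] = M (hd c :: p).
  by rewrite /G /= b1 bdeg_nil mul0r sgnZ0.
have G2 a p : G [:: a] p [::] = sgn F (deg c) *: M (hmul c a :: p).
  by rewrite /G /= b2 bdeg_nil mul0r sgnZ0.
have G3 l p : G [::] p [:: l] =
    sgn F ((deg l + 1) * (deg c + 1 + bdeg p) + deg l) *: M (hmul l c :: p).
  by rewrite /G /= b2 sgnZZ; apply: sgnZ_par; psolve.
have tl a y u : cuts (G (a :: y)) u = G (a :: y) u [::].
  by apply: cuts_tail => *; exact: zxy.
transitivity (\cuts_(y | p | x <- t) G y p x) => //.
case: t => [|a u] /=; first by rewrite G1 !addr0.
rewrite [X in _ + X]cuts_head => [|a' y v]; last by rewrite tl zy.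
rewrite tl G2.
rewrite -[G [::] [::] _ + _]/(cuts (G [::]) (a :: u)) [RHS]addrAC; congr (_ + _).
rewrite lastI cuts_rcons cuts_tail => [|a' p v]; last by case: v => [|? ?]; rewrite /= zx.
by rewrite G3 G1 addrC.
Qed.

(** On the cyclic word [c :: t] the two outer terms of the Hochschild differential
    become the products of [c] with its two neighbours. *)
Lemma hochschild_d_dual n g : ncochain n g ->
  hochschild_d n g = of_chain_dual (fun w =>
    - sgn F n *: cyc_d (to_chain_dual (g : hochschild Dual) : _ -> F^o) w).
Proof.
move=> cg; have [lg pg] := cg.
have [lM M0 _] := to_chain_dual_functional cg.
rewrite hochschild_dE //; apply/funext => t; apply/funext => c.
rewrite !hfun_dualD hfun_dualN.
rewrite !hfun_dualZ.
have ofE M : of_chain_dual M t c = sgn F (deg c * bdeg t) *: (M (c :: t) : F^o) by [].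
have toE a u : to_chain_dual (g : hochschild Dual) (a :: u) =
  sgn F (deg a * bdeg u) *: (g u a : F^o) by [].
have mulE (k x : F) : k * x = k *: (x : F^o) by [].
rewrite ofE /cyc_d cyc_d_head // !mulE !toE.
have -> : lcup (-1) n (@iota F A) g t c = if t is a :: u then
    sgn F (n * (deg a + 1)) *: (sgn F (deg a * (n + bdeg u + deg c)) *: (g u (hmul c a) : F^o))
  else 0 by rewrite lcup_iota //; case: (t).
have -> : rcup n (-1) g (@iota F A) t c = if t is a :: u then
    sgn F (bdeg (belast a u)) *: (g (belast a u) (hmul (last a u) c) : F^o)
  else 0 by rewrite rcup_iota //; case: (t).
have -> : ins (-1 - 1) struct g t c = ins (-1 - 1) struct (fun t => g t c : F^o) t.
  have ev : linear (fun phi : dual_sort A => phi c : F^o) by [].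
  rewrite /ins (lin_cuts ev); apply: eq_cuts => p w.
  by rewrite (lin_cuts ev).
have -> : ins (-1 - 1) struct (fun t => to_chain_dual (g : hochschild Dual) (c :: t) : F^o) t =
   sgn F (deg c * (bdeg t + (-1 - 1 + 1))) *: ins (-1 - 1) struct (fun t => g t c : F^o) t.
  by rewrite -ins_sgn.
have -> : dcoef n g t c = - sgn F (n + bdeg t) *: (g t (hd c) : F^o) by [].
case: t ofE => [|a u] _; first by linear_sgn.
have e : par (deg (last a u)) =
    xorb (par (deg a)) (xorb (par (bdeg u)) (par (bdeg (belast a u)))).
  have : par (bdeg (a :: u)) = par (bdeg (rcons (belast a u) (last a u))) by rewrite -lastI.
  by psimp; par_cases.
rewrite !toE; linear_coefs; rewrite ?sgn_if; psimp; rewrite ?e; sgn_coef.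
Qed.

End ChainDual.

(** * Rotations and the norm *)

Section Rotation.
Variables (F : fieldType) (A : dgAlgebra F) (V : lmodType F).
Implicit Types (s t u v r w : seq (helt A)) (a c l : helt A).
Local Notation struct := (@struct F A).
Implicit Types (M phi : seq (helt A) -> V).

(** The norm of the cyclic action: here the first letter is marked only in order to
    describe the rotations. *)
Definition norm phi : seq (helt A) -> V := cyc (fun s c r => phi (s ++ c :: r)).

Lemma eq_norm phi psi w : (forall v, size v != 0 -> phi v = psi v) ->
  norm phi w = norm psi w.
Proof.
move=> e; case: w => [//|c t]; apply: eq_cuts => r s; congr (_ *: _).
by apply: e; rewrite size_cat addnS.
Qed.

Lemma cyc_d_norm phi w : cyc_d (norm phi) w = norm (ins (-1 - 1) struct phi) w.
Proof.
rewrite /norm cyc_d_cyc; case: w => [//|c t]; apply: eq_cuts => r s.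
by rewrite marked_d_ins.
Qed.

(** For empty [pre] this is the generator of the cyclic action; units in [pre]
    give the degenerate part of Connes' operator and its contraction. *)
Definition rot_last pre M v : V :=
  if v is c :: t then
    sgn F ((deg (last c t) + 1) * (bdeg pre + bdeg (belast c t))) *:
      M (last c t :: pre ++ belast c t)
  else 0.

Lemma rot_last_rcons pre M u l :
  rot_last pre M (rcons u l) =
  sgn F ((deg l + 1) * (bdeg pre + bdeg u)) *: M (l :: pre ++ u).
Proof.
case: u => [|a u]; rewrite /rot_last //=.
by rewrite last_rcons belast_rcons.
Qed.

(** The letter next to a cut can be counted on either side of it. *)
Lemma cuts_shift (Q : seq (helt A) -> helt A -> seq (helt A) -> V) t :
  \cuts_(r | s <- t) (if r is a :: r' then Q (belast a r') (last a r') s else 0) =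
  \cuts_(r | s <- t) (if s is l :: s' then Q r l s' else 0).
Proof.
elim: t Q => [//|a t IH] Q /=; rewrite add0r.
rewrite -(IH (fun r => Q (a :: r))).
rewrite -[Q [::] a t]/(if [::] is a' :: r' then Q [::] a' t else Q [::] a t).
rewrite -(@cuts_head _ _ (fun r s => if r is [::] then Q [::] a s else 0)) //.
by rewrite -cutsD; apply: eq_cuts => -[|a' r] s; rewrite /= ?addr0 ?add0r.
Qed.

Lemma norm_rot_last phi w : norm (rot_last [::] phi) w = norm phi w.
Proof.
case: w => [//|c t]; rewrite /norm /cyc.
pose Q r l s := sgn F ((deg c + 1 + bdeg r) * (deg l + 1 + bdeg s)) *: phi (l :: s ++ c :: r).
transitivity (\cuts_(r | s <- t) (if r is [::] then phi (c :: s) else 0)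
   + \cuts_(r | s <- t) (if r is a :: r' then Q (belast a r') (last a r') s else 0)).
  rewrite -cutsD; apply: eq_cuts => -[|a r] s.
    rewrite cats1 rot_last_rcons sgnZZ addr0 -[RHS]sgnZ0; apply: sgnZ_par; psolve.
  rewrite add0r lastI -rcons_cons -rcons_cat rot_last_rcons /= sgnZZ.
  apply: sgnZ_par; psolve.
rewrite cuts_head // cuts_shift addrC.
transitivity (\cuts_(r | s <- t) (if s is l :: s' then Q r l s' else 0)
   + \cuts_(r | s <- t) (if s is [::] then phi (c :: r) else 0)).
  by congr (_ + _); rewrite cuts_tail.
rewrite -cutsD; apply: eq_cuts => r [|l s].
  by rewrite bdeg_nil mulr0 sgnZ0 add0r.
by rewrite addr0 /Q; apply: sgnZ_par; psolve.
Qed.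

Lemma norm_rot phi c u l :
  rot_last [::] (norm phi) (c :: rcons u l) = norm phi (c :: rcons u l).
Proof.
rewrite -rcons_cons rot_last_rcons /= cuts_rcons /= addrC scalerDr.
rewrite bdeg_nil -cutsZ; congr (_ + _).
  apply: eq_cuts_in => r s ->; rewrite sgnZZ -cats1 -catA /=.
  by apply: sgnZ_par; psolve.
rewrite cats1 sgnZZ; apply: sgnZ_par; psolve.
Qed.

Lemma rot_last_multilinear pre M : multilinear M -> multilinear (rot_last pre M).
Proof.
move=> lM s t; case/lastP: t => [|t l] k a b e da db ev.
  rewrite !cats1 !rot_last_rcons da db.
  by rewrite (lM [::] (pre ++ s) k a b e da db ev) scalerDr !scalerA mulrC.
rewrite -!rcons_cons -!rcons_cat !rot_last_rcons !bdeg_cat !bdeg_cons da db.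
have := lM (l :: pre ++ s) t k a b e da db ev; rewrite /= -!catA => ->.
by rewrite scalerDr !scalerA mulrC.
Qed.

End Rotation.

Section CyclicMultilinear.
Variables (F : fieldType) (A : dgAlgebra F) (V : lmodType F).
Implicit Types (s t u v r : seq (helt A)) (a c : helt A).

Lemma cyc_multilinear (Phi : seq (helt A) -> helt A -> seq (helt A) -> V) :
  (forall c r, multilinear (fun s => Phi s c r)) ->
  (forall s r, homog_linear (fun c => Phi s c r)) ->
  (forall s c, multilinear (Phi s c)) -> multilinear (cyc Phi).
Proof.
move=> l1 l2 l3 [|c s] t.
  apply: homog_linear_cuts => r s.
  by apply: (homog_linear_sgn (fun i => (i + 1 + bdeg r) * bdeg s)).
apply: (@multilinear_cuts _ _ _ (fun r s =>
   sgn F ((deg c + 1 + bdeg r) * bdeg s) *: Phi s c r)) => [v|u].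
  exact: (multilinear_sgn (fun i => (deg c + 1 + i) * bdeg v)).
exact: (multilinear_sgn (fun i => (deg c + 1 + bdeg u) * i)).
Qed.

Lemma norm_multilinear (phi : seq (helt A) -> V) :
  multilinear phi -> multilinear (norm phi).
Proof.
move=> lphi; apply: cyc_multilinear => [c r s t|s r|s c s' t].
- by move=> k a e d da de ev; rewrite -!catA; exact: (lphi s).
- exact: lphi.
- have := lphi (s ++ c :: s') t; rewrite /multilinear.
  by move=> h k a e d da de ev; have := h k a e d da de ev; rewrite -!catA.
Qed.

End CyclicMultilinear.

(** * Connes' operator *)

Section ConnesOperator.
Variables (F : fieldType) (A : dgAlgebra F).
Implicit Types (s t u v p q r w : seq (helt A)) (a c l : helt A).
Local Notation struct := (@struct F A).
Local Notation Dual := (dual_bimodule A).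
Local Notation C := (hochschild Dual).
Implicit Types (M phi : seq (helt A) -> F^o) (g : hfun Dual) (n : int).
Local Notation toM g := (to_chain_dual (g : C) : seq (helt A) -> F^o).
Local Notation ofM M := (of_chain_dual M : hfun Dual).
Local Notation bins := (ins (-1 - 1) struct).

Definition unit_head M v : F^o := M (hone :: v).

Lemma rot_dual_norm phi w : \sum_(i < size w) rot_dual i phi w = norm phi w.
Proof.
case: w => [|c t]; first by rewrite big_ord0.
rewrite big_ord_recl /= /norm /cyc -cuts_big big_ord_recr /= addrC.
congr (_ + _).
  rewrite /rot_dual rot0 /= bdeg_nil mul0r expr0z mul1r.
  by rewrite take_size drop_size bdeg_nil mulr0 sgnZ0.
apply: eq_bigr => i _; rewrite /rot_dual /= /rot /=.
by rewrite bdeg_cons.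
Qed.

Lemma connes_BE M : connes_B M =
  fun w => - norm (fun v => unit_head M v - rot_last [:: hone] M v) w.
Proof.
apply/funext => w; rewrite /connes_B rot_dual_norm; congr (- _).
apply: (@eq_norm F A F^o) => v; case/lastP: v => [//|v l] _.
rewrite /unit_head; congr (_ - _).
rewrite rot_last_rcons /rot_dual size_rcons.
have -> : take (size v).+1 (hone :: rcons v l) = hone :: v.
  by rewrite /= -cats1 take_size_cat.
have -> : drop (size v).+1 (hone :: rcons v l) = [:: l].
  by rewrite /= -cats1 drop_size_cat.
have -> : rot (size v).+1 (hone :: rcons v l) = l :: hone :: v.
  by rewrite /rot /= -cats1 take_size_cat // drop_size_cat.
congr (_ * _); apply: sgn_eq_par; psolve.
Qed.

(** The term [s N] of [- (1 - t) s N], the only one which survives on normalized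
    chains. *)
Definition connes1 n g : hfun Dual := ofM (fun w => - sgn F n *: norm (unit_head (toM g)) w).

Definition connes_htpy g : hfun Dual := ofM (norm (rot_last [:: hone; hone] (toM g))).

Lemma norm_functional n phi : multilinear phi ->
  (forall v, size v != 0 -> bdeg v + n - 1 != 0 -> phi v = 0) -> functional n (norm phi).
Proof.
move=> lphi phi0; split=> [|//|a t na]; first exact: norm_multilinear.
rewrite /norm /cyc (eq_cuts_in (H := fun _ _ => 0)) ?cuts0 // => r s e.
rewrite phi0 ?scaler0 //; first by case: s {e}.
apply: contraNneq na => h; apply/eqP; rewrite -[RHS]h e.
by rewrite !(bdeg_cat, bdeg_cons); ring.
Qed.

Lemma hochschild_d_of n M : functional n M ->
  hochschild_d n (ofM M) = ofM (fun w => - sgn F n *: cyc_d M w).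
Proof.
move=> fM; rewrite (hochschild_d_dual (of_chain_dual_cochain fM)).
by case: fM => _ M0 _; rewrite of_chain_dualK.
Qed.

Lemma unit_head_functional n M : functional n M ->
  functional (n + 1) (norm (unit_head M)).
Proof.
move=> [lM _ M0]; apply: norm_functional => [s t|v _ nv].
  exact: (lM (hone :: s) t).
rewrite /unit_head M0 //; apply: contraNneq nv => e; apply/eqP.
by rewrite -[RHS]e /=; ring.
Qed.

Lemma rot_last_functional n M : functional n M ->
  functional (n + 1 + 1) (norm (rot_last [:: hone; hone] M)).
Proof.
move=> [lM _ M0]; apply: norm_functional; first exact: rot_last_multilinear.
move=> v; case/lastP: v => [//|v l] _ nv; rewrite rot_last_rcons M0 ?scaler0 //.
apply: contraNneq nv => e; apply/eqP; rewrite -[RHS]e.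
by rewrite bdeg_rcons !bdeg_cat !bdeg_cons bdeg_nil /=; ring.
Qed.

Lemma hmul1l a : hmul hone a = a.
Proof. by apply: homog_eq; rewrite /= ?dga_mul1l ?add0r. Qed.

Lemma hmul1r a : hmul a hone = a.
Proof. by apply: homog_eq; rewrite /= ?dga_mul1r ?addr0. Qed.

Lemma multilinear0 M s t a : multilinear M -> hval a = 0 -> M (s ++ a :: t) = 0.
Proof. by move=> lM; exact: (@homog_linear0 _ _ (fun a => M (s ++ a :: t)) a (lM s t)). Qed.

(** The unit disappears when it is multiplied with either neighbour; these two
    terms differ by a rotation, and the norm cancels them. *)
Lemma unit_head_d M v : multilinear M -> size v != 0 ->
  unit_head (cyc_d M) v = M v - rot_last [::] M v - bins (unit_head M) v.
Proof.
move=> lM; case: v => [//|a u] _.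
rewrite /unit_head /cyc_d cyc_d_head //.
rewrite (@multilinear0 _ [::] _ (hd hone) lM (d_one A)).
rewrite hmul1l hmul1r /rot_last /= bdeg_nil.
linear_sgn.
Qed.

Lemma bins_units phi u : multilinear phi ->
  bins phi [:: hone, hone & u] =
  (if u is [::] then phi (hone :: u) else 0)
  + bins (fun u => phi [:: hone, hone & u]) u.
Proof.
move=> lphi.
have lphi' : multilinear (fun u => phi [:: hone, hone & u]).
  by move=> s; exact: (lphi [:: hone, hone & s]).
have d1 s t : phi (s ++ hd hone :: t) = 0.
  by rewrite (@multilinear0 _ s t (hd hone) lphi (d_one A)).
rewrite !ins_struct // /= (d1 [::]) (d1 [:: hone]) !hmul1l.
have E1 v : \cuts_(p | w <- v) (if w is a :: r then
      sgn F (bdeg [:: hone, hone & p]) *: phi [:: hone, hone & p ++ hd a :: r] else 0) =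
   \cuts_(p | w <- v) (if w is a :: r then
      sgn F (bdeg p) *: phi [:: hone, hone & p ++ hd a :: r] else 0).
  by apply: eq_cuts => p [|a r] //; apply: sgnZ_par; psolve.
have E2 v : \cuts_(p | w <- v) (if w is [:: a, c & r] then
      sgn F (bdeg [:: hone, hone & p] + deg a) *: phi [:: hone, hone & p ++ hmul a c :: r] else 0) =
   \cuts_(p | w <- v) (if w is [:: a, c & r] then
      sgn F (bdeg p + deg a) *: phi [:: hone, hone & p ++ hmul a c :: r] else 0).
  by apply: eq_cuts => p [|a [|c r]] //; apply: sgnZ_par; psolve.
rewrite E1 E2 bdeg_nil.
by case: u => [|a u]; rewrite ?hmul1l; linear_sgn.
Qed.

Lemma bins_rcons phi u l : multilinear phi ->
  bins phi (rcons u l) =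
  bins (fun u => phi (rcons u l)) u + sgn F (bdeg u) *: phi (rcons u (hd l))
  + (if u is a :: u' then
      sgn F (bdeg (belast a u') + deg (last a u')) *:
        phi (rcons (belast a u') (hmul (last a u') l)) else 0).
Proof.
move=> lphi.
have b0 p q r : struct q = 0 -> phi (p ++ letter (-1 - 1) struct q :: r) = 0.
  by move=> e; apply: (@slot_eq0 _ _ _ (fun a => phi (p ++ a :: r))).
rewrite /ins cuts_rcons /= b0 // scaler0 !addr0.
under eq_cuts => p w do rewrite cuts_rcons.
rewrite cutsD -[RHS]addrA; congr (_ + _).
  by do 2!apply: eq_cuts => *; rewrite -rcons_cons -rcons_cat.
case/lastP: u => [|u c] /=.
  by rewrite letter_struct1 bdeg_nil mulr0 sgnZ0.
rewrite cuts_rcons cuts_tail => [|a p w]; last first.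
  by rewrite b0 ?scaler0 //; case: w => [|? [|? ?]].
rewrite /= letter_struct1 (@slot_struct2 _ _ _ (fun a => phi (u ++ [:: a]))) // sgnZZ.
rewrite !cats1; case: u => [|a u] /=; first by rewrite addrC; congr (_ + _); apply: sgnZ_par; psolve.
by rewrite last_rcons belast_rcons addrC; congr (_ + _); apply: sgnZ_par; psolve.
Qed.

(** Inserting a second unit next to the first one contracts the degenerate part of
    Connes' operator. *)
Lemma rot_last_d M v : multilinear M -> size v != 0 ->
  rot_last [:: hone; hone] (cyc_d M) v =
  bins (rot_last [:: hone; hone] M) v - rot_last [:: hone] M v.
Proof.
move=> lM; case/lastP: v => [//|u l] _.
have lMl : multilinear (fun t => M (l :: t)) by move=> s; exact: (lM (l :: s)).
rewrite bins_rcons; last exact: rot_last_multilinear.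
rewrite !rot_last_rcons /cyc_d cyc_d_head // bins_units //.
have -> : bins (fun v => rot_last [:: hone; hone] M (rcons v l)) u =
    sgn F ((deg l + 1) * (bdeg u + (-1 - 1 + 1))) *: bins (fun u => M [:: l, hone, hone & u]) u.
  rewrite -ins_sgn; apply: eq_ins => v; rewrite rot_last_rcons.
  by apply: sgnZ_par; psolve.
rewrite /= hmul1r; case: u => [|a u] /=.
  rewrite hmul1l; linear_sgn.
have e : par (deg (last a u)) =
    xorb (par (deg a)) (xorb (par (bdeg u)) (par (bdeg (belast a u)))).
  have : par (bdeg (a :: u)) = par (bdeg (rcons (belast a u) (last a u))) by rewrite -lastI.
  by psimp; par_cases.
rewrite rot_last_rcons /=.
linear_coefs; rewrite ?sgn_if; psimp; rewrite ?e; sgn_coef.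
Qed.

End ConnesOperator.

Section Connes.
Variables (F : fieldType) (A : dgAlgebra F).
Implicit Types (s t u v r w y : seq (helt A)) (a c l : helt A).
Local Notation struct := (@struct F A).
Local Notation Dual := (dual_bimodule A).
Local Notation C := (hochschild Dual).
Implicit Types (M phi : seq (helt A) -> F^o) (g : hfun Dual) (n : int).
Local Notation toM g := (to_chain_dual (g : C) : seq (helt A) -> F^o).
Local Notation ofM M := (of_chain_dual M : hfun Dual).
Local Notation bins := (ins (-1 - 1) struct).

Lemma normD phi psi w : norm (fun v => phi v + psi v) w = norm phi w + norm psi w.
Proof.
case: w => [|c t]; first by rewrite addr0.
by rewrite /norm /cyc -cutsD; apply: eq_cuts => r s; rewrite scalerDr.
Qed.

Lemma normZ (k : F) phi w : norm (fun v => k *: phi v) w = k *: norm phi w.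
Proof.
case: w => [|c t]; first by rewrite scaler0.
by rewrite /norm /cyc -cutsZ; apply: eq_cuts => r s; rewrite !scalerA mulrC.
Qed.

Lemma normB phi psi w : norm (fun v => phi v - psi v) w = norm phi w - norm psi w.
Proof.
rewrite normD -[- norm psi w]scaleN1r -normZ; congr (_ + _).
by apply: eq_norm => v _; rewrite scaleN1r.
Qed.

Lemma ofME M t a : ofM M t a = sgn F (deg a * bdeg t) *: (M (a :: t) : F^o).
Proof. by []. Qed.

Lemma hfun_dualP (g h : hfun Dual) : (forall t a, g t a = h t a :> F^o) -> g = h.
Proof. by move=> e; apply/funext => t; apply/funext => a; exact: e. Qed.

Lemma dual_addE g h t a : ((g + h) t a : F^o) = g t a + h t a. Proof. by []. Qed.
Lemma dual_oppE g t a : ((- g) t a : F^o) = - g t a. Proof. by []. Qed.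
Lemma dual_scaleE (k : F) g t a : ((k *: g) t a : F^o) = k *: (g t a : F^o).
Proof. by []. Qed.

Definition dualE := (dual_addE, dual_oppE, dual_scaleE, ofME).

Lemma ofM0 : ofM (fun=> 0) = 0.
Proof. by apply/funext => t; apply/funext => a; rewrite /of_chain_dual mulr0. Qed.

Lemma norm0 w : norm (fun=> 0 : F^o) w = 0.
Proof. by case: w => [//|c t]; apply: cuts_zero => r s; rewrite scaler0. Qed.

Lemma eq_ofM M phi : (forall w, M w = phi w) -> ofM M = ofM phi.
Proof. by move=> /funext ->. Qed.

Lemma connes_coboundaryE n g : connes_coboundary n (g : C) =
  ofM (fun w => - sgn F n *: norm (fun v =>
     unit_head (toM g) v - rot_last [:: hone] (toM g) v) w).
Proof.
rewrite /connes_coboundary connes_BE; apply/funext => t; apply/funext => a.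
rewrite hfun_dualZ /of_chain_dual -[- _ *: _]/(- sgn F n * _).
by rewrite mulrCA mulrN mulNr.
Qed.

Lemma connes1_cochain n g : ncochain n g -> ncochain (n + 1) (connes1 n g).
Proof.
move=> /to_chain_dual_functional/unit_head_functional/of_chain_dual_cochain h.
have -> : connes1 n g = - sgn F n *: ofM (norm (unit_head (toM g))).
  by apply: hfun_dualP => t a; rewrite /connes1 !dualE; linear_coefs; ring.
exact: ncochainZ.
Qed.

Lemma connes_htpy_cochain n g : ncochain n g -> ncochain (n + 1 + 1) (connes_htpy g).
Proof.
by move=> /to_chain_dual_functional/rot_last_functional/of_chain_dual_cochain.
Qed.

Lemma toM_d n g : ncochain n g -> toM (hochschild_d n g) =
  fun w => - sgn F n *: cyc_d (toM g) w.
Proof. by move=> cg; rewrite hochschild_d_dual // of_chain_dualK //= scaler0. Qed.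

Lemma rot_lastZ pre (k : F) M v :
  rot_last pre (fun w => k *: M w) v = k *: rot_last pre M v.
Proof. by case: v => [|a v] /=; rewrite ?scaler0 // !scalerA mulrC. Qed.

(** The homotopy [connes_htpy] removes the degenerate term, by [rot_last_d]. *)
Lemma connes_split n g : ncochain n g -> connes_coboundary n (g : C) =
  connes1 n g - hochschild_d (n + 1 + 1) (connes_htpy g)
  + connes_htpy (hochschild_d n g).
Proof.
move=> cg; have [lM M0 Ms] := to_chain_dual_functional cg.
have fK := rot_last_functional (to_chain_dual_functional cg).
rewrite connes_coboundaryE /connes1 /connes_htpy (hochschild_d_of fK) toM_d //.
apply: hfun_dualP => t a; rewrite !dualE; set w := a :: t.
rewrite normB cyc_d_norm.
have -> : norm (rot_last [:: hone; hone] (fun w => - sgn F n *: cyc_d (toM g) w)) w =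
    - sgn F n *: norm (rot_last [:: hone; hone] (cyc_d (toM g))) w.
  by rewrite -normZ; apply: eq_norm => v _; exact: rot_lastZ.
have -> : norm (rot_last [:: hone; hone] (cyc_d (toM g))) w =
    norm (bins (rot_last [:: hone; hone] (toM g))) w - norm (rot_last [:: hone] (toM g)) w.
  by rewrite -normB; apply: eq_norm => v nv; exact: rot_last_d.
linear_sgn.
Qed.

Lemma connes1_d n g : ncochain n g ->
  hochschild_d (n + 1) (connes1 n g) = - connes1 (n - 1) (hochschild_d n g).
Proof.
move=> cg; have [lM M0 Ms] := to_chain_dual_functional cg.
have fK := unit_head_functional (to_chain_dual_functional cg).
have E : connes1 n g = - sgn F n *: ofM (norm (unit_head (toM g))).
  by apply: hfun_dualP => t a; rewrite /connes1 !dualE; linear_coefs; ring.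
rewrite E (linZ' (@hochschild_d_linear F A Dual _)) (hochschild_d_of fK).
rewrite /connes1 toM_d //.
apply: hfun_dualP => t a; rewrite !dualE cyc_d_norm; set w := a :: t.
have -> : norm (unit_head (fun w => - sgn F n *: cyc_d (toM g) w)) w =
    - sgn F n *: norm (unit_head (cyc_d (toM g))) w.
  by rewrite -normZ; apply: eq_norm.
have -> : norm (unit_head (cyc_d (toM g))) w = - norm (bins (unit_head (toM g))) w.
  transitivity (norm (fun v => (toM g v - rot_last [::] (toM g) v) - bins (unit_head (toM g)) v) w).
    by apply: eq_norm => v nv; exact: unit_head_d.
  by rewrite normB normB norm_rot_last subrr sub0r.
linear_sgn.
Qed.

(** The second operator puts a unit in front of a word and subtracts the rotated
    word, where the norm in the first one does not see the rotation. *)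
Lemma connes_square n g : connes_coboundary (n + 1) (connes_coboundary n (g : C)) = 0.
Proof.
rewrite [connes_coboundary n g]connes_coboundaryE connes_coboundaryE.
set phi := (fun v => unit_head (toM g) v - rot_last [:: hone] (toM g) v).
have e : toM (ofM (fun w => - sgn F n *: norm phi w)) = fun w => - sgn F n *: norm phi w.
  by rewrite of_chain_dualK //= scaler0.
rewrite !e.
rewrite -ofM0; apply: eq_ofM => w; rewrite (_ : norm _ w = 0) ?scaler0 //.
rewrite -[RHS](norm0 w); apply: eq_norm => v; case/lastP: v => [//|v l] _.
rewrite /unit_head rot_lastZ rot_last_rcons.
rewrite -[norm phi (hone :: rcons v l)]norm_rot -rcons_cons rot_last_rcons.
rewrite cat0s cat1s; linear_sgn.
Qed.

Lemma connes_linear n : linear (connes_coboundary n : hfun Dual -> hfun Dual).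
Proof.
move=> k g h; rewrite !connes_coboundaryE; apply: hfun_dualP => t a.
rewrite !dualE !normB.
have E : toM (k *: g + h) = fun w => k *: toM g w + toM h w.
  by apply/funext => -[|c u] /=; rewrite ?scaler0 ?addr0 // mulrDr mulrCA.
have -> w : norm (unit_head (toM (k *: g + h))) w =
    k *: norm (unit_head (toM g)) w + norm (unit_head (toM h)) w.
  by rewrite -normZ -normD; apply: eq_norm => v _; rewrite /unit_head E.
have -> w : norm (rot_last [:: hone] (toM (k *: g + h))) w =
    k *: norm (rot_last [:: hone] (toM g)) w + norm (rot_last [:: hone] (toM h)) w.
  rewrite -normZ -normD E; apply: eq_norm => v; case/lastP: v => [//|v l] _.
  rewrite !rot_last_rcons; cbv beta.
  by rewrite scalerDr !scalerA [k * _]mulrC.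
move: (norm _ _) (norm _ _) (norm _ _) (norm _ _) => x1 x2 x3 x4.
linear_coefs; ring.
Qed.

Lemma connes_htpy0 : connes_htpy (0 : hfun Dual) = 0.
Proof.
rewrite /connes_htpy -[RHS]ofM0; apply: eq_ofM => w.
rewrite -[RHS](norm0 w); apply: eq_norm => v; case/lastP: v => [//|v l] _.
by rewrite rot_last_rcons /= mulr0 scaler0.
Qed.

Lemma connes1_0 n : connes1 n (0 : hfun Dual) = 0.
Proof.
rewrite /connes1 -[RHS]ofM0; apply: eq_ofM => w.
rewrite (_ : norm _ w = 0) ?scaler0 //; rewrite -[RHS](norm0 w).
by apply: eq_norm => v _; rewrite /unit_head /= mulr0.
Qed.

Lemma connes_cochain n g : ncochain n g ->
  ncochain (n + 1) (connes_coboundary n (g : C)).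
Proof.
move=> cg; rewrite connes_split //; apply: ncochainD; first apply: ncochainB.
- exact: connes1_cochain.
- by apply: ncochain_cast (hochschild_d_cochain (connes_htpy_cochain cg)) _; ring.
- by apply: ncochain_cast (connes_htpy_cochain (hochschild_d_cochain cg)) _; ring.
Qed.

Lemma connes_d n g : ncochain n g ->
  hochschild_d (n + 1) (connes_coboundary n (g : C)) =
  - (connes_coboundary (n - 1) (hochschild_d n g : C) : hfun Dual).
Proof.
move=> cg; have cdg := hochschild_d_cochain cg.
have dl := @hochschild_d_linear F A Dual (n + 1).
rewrite connes_split // connes_split // hochschild_dd // connes_htpy0.
rewrite (linD' dl) (linB' dl) connes1_d //.
have := hochschild_dd (connes_htpy_cochain cg).
rewrite (_ : n + 1 + 1 - 1 = n + 1); last by ring.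
move=> ->; rewrite (_ : n - 1 + 1 + 1 = n + 1); last by ring.
linear_coefs; ring.
Qed.

Lemma connes_cycle n g : g \in cycle C n ->
  connes_coboundary n (g : C) \in cycle C (n + 1).
Proof.
have c0 : connes_coboundary (n - 1) (0 : C) = 0 := lin0' (connes_linear (n - 1)).
move=> /cycleP[cg dg]; apply/cycleP; split; first exact: connes_cochain.
by rewrite connes_d // dg c0 oppr0.
Qed.

Lemma connes_induced n :
  induced1 (@connes_coboundary F A n) (@HH_connes F A n).
Proof.
apply: (@homology_map_induced F C C n (n + 1)); first exact: connes_cycle.
move=> g h cg ch [y /ncochainP cy dy].
apply: (proj2 (hochschild_homologous (connes_cycle cg) (connes_cycle ch))).
exists (- (connes_coboundary (n + 1) (y : C) : hfun Dual)).
  by apply: ncochainN; apply: connes_cochain.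
rewrite (linN' (@hochschild_d_linear F A Dual _)) connes_d //.
have -> : hochschild_d (n + 1) y = g - h := dy.
by rewrite addrK opprK (linB' (connes_linear n)).
Qed.

(** The homotopies for the Batalin-Vilkovisky identity produce [connes1] and not
    Connes' operator on all chains. *)
Lemma connes1_homologous n g : g \in cycle C n ->
  connes1 n g \in cycle C (n + 1) /\
  hclass C (n + 1) (connes_coboundary n (g : C)) = hclass C (n + 1) (connes1 n g).
Proof.
move=> cg; have /cycleP[cg1 dg] := cg.
have c1 : connes1 n g \in cycle C (n + 1).
  apply/cycleP; split; first exact: connes1_cochain.
  by rewrite connes1_d // dg connes1_0 oppr0.
split; first exact: c1.
apply: (proj2 (hochschild_homologous (connes_cycle cg) c1)).
exists (- connes_htpy g); first by apply: ncochainN; exact: connes_htpy_cochain.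
rewrite (linN' (@hochschild_d_linear F A Dual _)) connes_split // dg connes_htpy0.
linear_coefs; ring.
Qed.

End Connes.

(** * The double insertion *)

Section InsertionTools.
Variables (F : fieldType) (A : dgAlgebra F) (V : lmodType F).
Implicit Types (s t u v p q r w : seq (helt A)) (a c l : helt A).
Implicit Types (g h : seq (helt A) -> A) (m k : int).
Local Notation struct := (@struct F A).
Local Notation bins := (ins (-1 - 1) struct).

Lemma eq_ins_ne k h (phi psi : seq (helt A) -> V) t :
  (forall t, size t != 0 -> phi t = psi t) -> ins k h phi t = ins k h psi t.
Proof.
move=> e; apply: eq_cuts => p w; apply: eq_cuts => q r; congr (_ *: _).
by apply: e; rewrite size_cat addnS.
Qed.

Lemma ins_map (U : lmodType F) k h (l : U -> V) (phi : seq (helt A) -> U) t :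
  linear l -> ins k h (fun u => l (phi u)) t = l (ins k h phi t).
Proof.
move=> ll; rewrite /ins (lin_cuts ll); apply: eq_cuts => p w.
by rewrite (lin_cuts ll); apply: eq_cuts => q r; rewrite (linZ' ll).
Qed.

Lemma ins_sum k h T (G : seq T -> seq T -> seq (helt A) -> V) (s : seq T) t :
  ins k h (fun t => \cuts_(u | v <- s) G u v t) t = \cuts_(u | v <- s) ins k h (G u v) t.
Proof.
elim: s G => [|a s IH] G /=; last by rewrite insD IH.
by rewrite addr0; apply: eq_ins => u; rewrite addr0.
Qed.

Lemma ins_exchange k h m g (Q : seq (helt A) -> seq (helt A) -> V) s t :
  ins k h (fun s => ins m g (Q s) t) s = ins m g (fun t => ins k h (Q^~ t) s) t.
Proof.
have ll : linear (fun phi : seq (helt A) -> V => ins m g phi t).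
  by move=> c phi psi; rewrite -insZ -insD.
rewrite (ins_map k h Q s ll); apply: eq_ins => u.
have lu : linear (fun phi : seq (helt A) -> V => phi u) by [].
by rewrite -(ins_map k h Q s lu).
Qed.

(** By [preLie] the commutator of the two insertions is the insertion of the
    bracket of [g] and the structure cochain, which is the differential of [g]. *)
Lemma ins_struct_comm m g (phi : seq (helt A) -> V) t :
  cochain m g -> hochschild_d m (g : hfun (self_bimodule A)) = 0 ->
  multilinear phi ->
  bins (ins m g phi) t = sgn F (m + 1) *: ins m g (bins phi) t.
Proof.
move=> cg dg lphi; have cs := struct_cochain A.
have cbg : cochain (m - 1) (bins g).
  by apply: cochain_cast (ins_cochain cg cs) _; ring.
have cgb : cochain (m - 1) (ins m g struct).
  by apply: cochain_cast (ins_cochain cs cg) _; ring.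
have e : ins (m - 1) (ins m g struct) phi t = - sgn F m *: ins (m - 1) (bins g) phi t.
  have z : ins (m - 1) (fun u => sgn F m *: bins g u + ins m g struct u) phi t = 0.
    apply: cuts_zero => p w; apply: cuts_zero => q r.
    rewrite (@slot_eq0 _ _ _ (fun a => phi (p ++ a :: r))) ?scaler0 //.
    by rewrite addrC -hochschild_d_ins // dg.
  move: z; rewrite slot_insl // => /eqP; rewrite addrC addr_eq0 => /eqP ->.
  by rewrite scaleNr.
rewrite (preLie t cg cs lphi) (preLie t cs cg lphi).
rewrite (_ : m + _ + 1 = m - 1); last by ring.
rewrite (_ : -1 - 1 + _ + 1 = m - 1); last by ring.
rewrite e; linear_sgn.
Qed.

End InsertionTools.

Section InsertRight.
Variables (F : fieldType) (A : dgAlgebra F).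
Implicit Types (s t u v p q r w x y : seq (helt A)) (a c : helt A).
Local Notation CA := (seq (helt A) -> A).
Implicit Types (f g : CA) (n m k : int).
Local Notation struct := (@struct F A).
Local Notation iota := (@iota F A).
Local Notation bins := (ins (-1 - 1) struct).
Local Notation b q := (letter (-1 - 1) struct q).

(** The sign is that of moving [g] past the letters up to [c]. *)
Definition ins_right m g f s c r : A :=
  sgn F ((m + 1) * (bdeg s + deg c + 1)) *: ins m g (fun r => f (s ++ c :: r)) r.

Lemma cochain_shift n f s c : cochain n f ->
  cochain (n + (bdeg s + deg c + 1)) (fun r => f (s ++ c :: r)).
Proof.
move=> [fl fp]; split=> [p r k a e e' da de ev|r].
  by have := fl (s ++ c :: p) r k a e e' da de ev; rewrite -!catA.
by apply: gr_cast (fp _) _; rewrite bdeg_cat bdeg_cons; ring.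
Qed.

Lemma multilinear_prefix f c r : multilinear f -> multilinear (fun s => f (s ++ c :: r)).
Proof.
move=> fl p q k a e e' da de ev.
by have := fl p (q ++ c :: r) k a e e' da de ev; rewrite -!catA.
Qed.

(** The structure cochain meets all the letters of [f (s ++ c :: r)], except that
    it cannot multiply [c] with the value of [g] inserted next to it. *)
Lemma marked_d_ins_right n m f g s c r : cochain n f -> cochain m g ->
  hochschild_d m (g : hfun (self_bimodule A)) = 0 ->
  marked_d (ins_right m g f) s c r =
    sgn F ((m + 1) * (bdeg s + deg c)) *:
      (ins m g (fun r => bins f (s ++ c :: r)) r
       - \cuts_(q | r' <- r)
           (sgn F (bdeg s + deg c) *: f (s ++ hmul c (letter m g q) :: r'))).
Proof.
move=> cf cg dg; have [fl _] := cf; have cs := struct_cochain A.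
have [fscl _] := cochain_shift s c cf.
have b0 p q r' : struct q = 0 -> f (p ++ b q :: r') = 0.
  by move=> e; apply: (@slot_eq0 _ _ _ (fun a => f (p ++ a :: r'))).
pose K x y r' s' := sgn F (bdeg s') *: f (s' ++ b (x ++ c :: y) :: r').
have Z : ins m g (fun r => bins f (s ++ c :: r)) r =
    ins m g (fun r => bins (fun s => f (s ++ c :: r)) s) r
    + sgn F (bdeg s + deg c + 1) *: ins m g (bins (fun r => f (s ++ c :: r))) r
    + (\cuts_(s' | x <- s) \cuts_(y | r' <- r) ins m g (fun y => K x y r' s') y
    + \cuts_(s' | x <- s) \cuts_(y | r' <- r)
        (sgn F ((m + 1) * bdeg y) *: ins m g (fun r' => K x y r' s') r')).
  transitivity (ins m g (fun r => bins (fun s => f (s ++ c :: r)) s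
    + sgn F (bdeg s + deg c + 1) *: bins (fun r => f (s ++ c :: r)) r
    + \cuts_(s' | x <- s) \cuts_(y | r' <- r) K x y r' s') r).
    by apply: eq_ins => u; rewrite -marked_d_ins.
  rewrite !insD insZ; congr (_ + _); rewrite ins_sum -cutsD.
  by apply: eq_cuts => s' x; rewrite -ins_cuts.
have X : \cuts_(s' | x <- s) \cuts_(y | r' <- r) ins m g (fun y => K x y r' s') y =
    \cuts_(q | r' <- r)
       (sgn F (bdeg s + deg c) *: f (s ++ hmul c (letter m g q) :: r')).
  rewrite cuts_tail => [|a s' x]; last first.
    apply: cuts_zero => y r'; apply: cuts_zero => p w; apply: cuts_zero => q z.
    by rewrite /K b0 ?scaler0 //; case: x => [|? [|? ?]] //; case: p.
  apply: eq_cuts => y r'; rewrite /ins cuts_head => [|a p w]; last first.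
    apply: cuts_zero => q z; rewrite /K b0 ?scaler0 //.
    by case: p.
  rewrite cuts_tail => [|a p z]; last by rewrite /K b0 ?scaler0.
  rewrite /K /= (@slot_struct2 _ _ _ (fun a => f (s ++ a :: r'))) // !sgnZZ.
  by apply: sgnZ_par; psolve.
rewrite Z X /marked_d /ins_right.
have -> : bins (fun s => sgn F ((m + 1) * (bdeg s + deg c + 1)) *:
      ins m g (fun r => f (s ++ c :: r)) r) s =
    sgn F ((m + 1) * (bdeg s + (-1 - 1 + 1) + deg c + 1)) *:
      ins m g (fun r => bins (fun s => f (s ++ c :: r)) s) r.
  rewrite (ins_sgn1 _ _ (fun i => (m + 1) * (i + deg c + 1))).
  by rewrite (ins_exchange _ _ _ _ (fun s r => f (s ++ c :: r))).
rewrite insZ ins_struct_comm //.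
have -> : \cuts_(s' | x <- s) \cuts_(y | r' <- r) (sgn F (bdeg s') *:
     (sgn F ((m + 1) * (bdeg s' + deg (b (x ++ c :: y)) + 1)) *:
        ins m g (fun r0 => f (s' ++ b (x ++ c :: y) :: r0)) r')) =
   sgn F ((m + 1) * (bdeg s + deg c)) *:
   \cuts_(s' | x <- s) \cuts_(y | r' <- r)
        (sgn F ((m + 1) * bdeg y) *: ins m g (fun r' => K x y r' s') r').
  rewrite -cutsZ; apply: eq_cuts_in => s' x ->; rewrite -cutsZ.
  apply: eq_cuts => y r'; rewrite /K insZ !sgnZZ; apply: sgnZ_par; psolve.
linear_sgn.
Qed.

Local Notation fsc f s c := (fun r => f (s ++ c :: r)).

Lemma acup_iota_l n f t : cochain n f -> acup n iota f t =
  if t is a :: u then sgn F (n * (deg a + 1)) *: dga_mul (hval a) (f u) else 0.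
Proof.
move=> cf; rewrite -(lcup_self _ _ (iota_cochain A)) lcup_iota //.
Qed.

Lemma acup_iota_r n f t : cochain n f -> acup (-1) f iota t =
  if t is a :: u then
    sgn F (bdeg (belast a u)) *: dga_mul (f (belast a u)) (hval (last a u)) else 0.
Proof.
move=> cf; rewrite -(rcup_self n _ (iota_cochain A)) rcup_iota //.
Qed.

Lemma cocycle_struct n f t : cochain n f ->
  hochschild_d n (f : hfun (self_bimodule A)) = 0 ->
  bins f t = sgn F n *: (acup n iota f t - da f t) - acup (-1) f iota t.
Proof.
move=> cf df; have := hochschild_d_self cf; rewrite df.
move=> /(congr1 (fun x : CA => x t)) e.
have {}e : da f t + sgn F n *: bins f t - acup n iota f t
   + sgn F n *: acup (-1) f iota t = 0 by rewrite -e.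
rewrite -[RHS]addr0 -(scaler0 _ (sgn F n)) -e.
linear_sgn.
Qed.

Lemma ins_head n m f g s c r : cochain n f -> cochain m g ->
  ins m g (fun r => acup n iota f (s ++ c :: r)) r =
  if s is a :: s' then
    sgn F (n * (deg a + 1)) *: dga_mul (hval a) (ins m g (fsc f s' c) r)
  else sgn F (n * (deg c + 1)) *: dga_mul (hval c) (ins m g f r).
Proof.
move=> cf cg; case: s => [|a s].
  rewrite -(ins_map _ _ f r (dga_mul_linear_r (hval c : A))) -insZ.
  by apply: eq_ins => u; rewrite (acup_iota_l _ cf).
rewrite -(ins_map _ _ (fsc f s c) r (dga_mul_linear_r (hval a : A))) -insZ.
by apply: eq_ins => u; rewrite (acup_iota_l _ cf).
Qed.

Lemma ins_tail n m f g s c r : cochain n f -> cochain m g ->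
  ins m g (fun r => acup (-1) f iota (s ++ c :: r)) r =
  sgn F (bdeg s + deg c + 1) *:
    (sgn F (m + 1) *: acup (-1) (ins m g (fsc f s c)) iota r
     + acup m (fsc f s c) g r).
Proof.
move=> cf cg; have cfs := cochain_shift s c cf; have ci := iota_cochain A.
transitivity (sgn F (bdeg s + deg c + 1) *: ins m g (acup (-1) (fsc f s c) iota) r).
  rewrite -insZ; apply: eq_ins_ne => t nt; rewrite /acup cuts_mark cuts_zero => [|u v].
    rewrite add0r -cutsZ; apply: eq_cuts => u v; rewrite sgnZZ; apply: sgnZ_par; psolve.
  have -> : iota (v ++ c :: t) = 0.
    by apply: iota0; rewrite size_cat /= addnS eqSS addn_eq0 (negPf nt) andbF.
  by rewrite (lin0' (dga_mul_linear_r (f u))) scaler0.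
have iE : ins m g iota = g by apply/funext => u; exact: ins_iota.
rewrite (ins_acup r cfs ci cg) iE (_ : -1 + m + 1 = m); last by ring.
linear_sgn.
Qed.

(** For a cocycle [f] the insertions of the structure cochain are traded for outer
    products and the internal differential. *)
Lemma marked_d_cocycle n m f g s c r : cochain n f -> cochain m g ->
  hochschild_d n (f : hfun (self_bimodule A)) = 0 ->
  hochschild_d m (g : hfun (self_bimodule A)) = 0 ->
  marked_d (ins_right m g f) s c r =
    sgn F ((m + 1) * (bdeg s + deg c)) *:
      (sgn F n *: ins m g (fun r => acup n iota f (s ++ c :: r)) r
       - sgn F n *: da (ins m g (fsc f s c)) r
       + sgn F (bdeg s + deg c) *:
           (sgn F (m + 1) *: acup (-1) (ins m g (fsc f s c)) iota r
            + acup m (fsc f s c) g r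
            - \cuts_(q | r' <- r) f (s ++ hmul c (letter m g q) :: r'))).
Proof.
move=> cf cg df dg; rewrite (marked_d_ins_right _ _ _ cf cg dg) cutsZ.
have -> : ins m g (fun r => bins f (s ++ c :: r)) r =
    sgn F n *: (ins m g (fun r => acup n iota f (s ++ c :: r)) r
      - da (ins m g (fsc f s c)) r)
    - ins m g (fun r => acup (-1) f iota (s ++ c :: r)) r.
  have -> : da (ins m g (fsc f s c)) r = ins m g (fun r => da f (s ++ c :: r)) r.
    by rewrite /da (ins_map _ _ (fsc f s c) r (@dga_d_linear F A)).
  transitivity (ins m g (fun r => sgn F n *: (acup n iota f (s ++ c :: r)
     + (-1) *: da f (s ++ c :: r)) + (-1) *: acup (-1) f iota (s ++ c :: r)) r).
    by apply: eq_ins => u; rewrite (cocycle_struct _ cf df); linear_coefs; ring.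
  by rewrite insD !insZ insD !insZ; linear_coefs; ring.
rewrite (ins_tail _ _ _ cf cg).
linear_sgn.
Qed.

End InsertRight.

Section Brace.
Variables (F : fieldType) (A : dgAlgebra F).
Implicit Types (s t u v p q r w x y z : seq (helt A)) (a c : helt A).
Local Notation CA := (seq (helt A) -> A).
Local Notation S := (self_bimodule A).
Implicit Types (f g h : CA) (n m k : int).
Local Notation struct := (@struct F A).
Local Notation iota := (@iota F A).
Local Notation bins := (ins (-1 - 1) struct).
Local Notation b q := (letter (-1 - 1) struct q).
Local Notation fsc f s c := (fun r => f (s ++ c :: r)).

(** The double insertion [f{g,h}] of the theory of brace algebras. *)
Definition brace m g k h f t : A :=
  \cuts_(p | q | v <- t) (sgn F ((m + 1) * bdeg p) *: ins_right k h f p (letter m g q) v).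

Lemma slot_ins_right k h f s r : multilinear f -> cochain k h ->
  homog_linear (fun c => ins_right k h f s c r).
Proof.
move=> fl ch; apply: (homog_linear_sgn (fun i => (k + 1) * (bdeg s + i + 1))).
apply: homog_linear_cuts => p w; apply: homog_linear_cuts => q v.
exact: homog_linearZ.
Qed.

Lemma bins_brace n m g k h f t : cochain n f -> cochain m g -> cochain k h ->
  hochschild_d m (g : hfun S) = 0 ->
  bins (brace m g k h f) t = sgn F (m + 1) *:
    \cuts_(p | q | v <- t)
      (sgn F ((m + 1) * bdeg p) *: marked_d (ins_right k h f) p (letter m g q) v).
Proof.
move=> cf cg ch dg; have [fl _] := cf; have cs := struct_cochain A.
have cbg : cochain (m - 1) (bins g).
  by apply: cochain_cast (ins_cochain cg cs) _; ring.
have cgb : cochain (m - 1) (ins m g struct).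
  by apply: cochain_cast (ins_cochain cs cg) _; ring.
have lE s r := slot_ins_right s r fl ch.
have letterE p q v : ins_right k h f p (letter (m - 1) (bins g) q) v =
    - sgn F m *: ins_right k h f p (letter (m - 1) (ins m g struct) q) v.
  have : ins_right k h f p (letter (m - 1)
      (fun u => sgn F m *: bins g u + ins m g struct u) q) v = 0.
    rewrite (@slot_eq0 _ _ _ (fun c => ins_right k h f p c v)) //.
    by rewrite addrC -hochschild_d_ins // dg.
  rewrite (@slotP' _ _ _ (fun c => ins_right k h f p c v)) //.
  move=> /(congr1 (fun e : A => - sgn F m *: e)); rewrite scaler0 => e.
  rewrite -[LHS]addr0 -e; linear_sgn.
pose E := ins_right k h f.
pose T1 p q v := bins (fun p => E p (letter m g q) v) p.
pose T2 p q v := bins (E p (letter m g q)) v.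
pose T3 p q v := E p (letter (m - 1) (ins m g struct) q) v.
transitivity (\cuts_(p | q | v <- t) (sgn F ((m + 1) * (bdeg p + 1)) *: T1 p q v)
  + \cuts_(p | q | v <- t) (- sgn F (m + m * bdeg p) *: T3 p q v)
  + \cuts_(p | q | v <- t)
       (sgn F (m * bdeg p + bdeg q) *: T2 p q v)).
  rewrite /brace ins_cuts -[RHS]addrA -[X in _ = _ + X]cutsD; congr (_ + _); apply: eq_cuts => p w.
    rewrite ins_sum; apply: eq_cuts => q v.
    rewrite ins_sgn; apply: sgnZ_par; psolve.
  rewrite ins_cuts scalerDr -!cutsZ; congr (_ + _); apply: eq_cuts => q v.
    rewrite insZ -(@slot_ins _ _ _ (fun c => E p c v)) //.
    rewrite (_ : m + _ + 1 = m - 1); last by ring.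
    by rewrite /T3 /E letterE; linear_sgn.
  by rewrite insZ !sgnZZ; apply: sgnZ_par; psolve.
have -> : \cuts_(p | q | v <- t) (- sgn F (m + m * bdeg p) *: T3 p q v) =
   sgn F (m + 1) *: \cuts_(p | q | v <- t) (sgn F ((m + 1) * bdeg p) *:
      \cuts_(s' | x <- p) \cuts_(y | r' <- v)
        (sgn F (bdeg s') *: E s' (b (x ++ letter m g q :: y)) r')).
  transitivity (\cuts_(p | w | v <- t) \cuts_(x | q | y <- w)
     (- sgn F (m + (m * bdeg p + (m + 1) * bdeg x)) *: E p (b (x ++ letter m g q :: y)) v)).
    apply: eq_cuts => p z; apply: eq_cuts => w v; rewrite /T3.
    have := @slot_ins _ _ _ (fun c => E p c v) (-1 - 1) m struct g w (lE _ _) cs cg.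
    rewrite (_ : -1 - 1 + m + 1 = m - 1); last by ring.
    move=> ->; rewrite /ins -cutsZ; apply: eq_cuts => x u; rewrite -cutsZ.
    by apply: eq_cuts => q y; linear_sgn.
  rewrite -[LHS]cuts_assocm -cutsZ; apply: eq_cuts => p w; rewrite -cutsZ.
  apply: eq_cuts => q v; rewrite -!cutsZ; apply: eq_cuts_in => s' x ->.
  by rewrite -!cutsZ; apply: eq_cuts => y r'; linear_sgn.
rewrite -cutsZ -!cutsD -?cutsZ; apply: eq_cuts => p w.
rewrite -cutsZ -!cutsD -?cutsZ; apply: eq_cuts => q v.
rewrite /marked_d -/E -/(T1 p q v) -/(T2 p q v); linear_sgn.
Qed.

Lemma ins_right_multilinear_l n k h f c v : cochain n f ->
  multilinear (fun s => ins_right k h f s c v).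
Proof.
move=> [fl _]; apply: (multilinear_sgn (fun i => (k + 1) * (i + deg c + 1))) => s t.
apply: homog_linear_cuts => p w; apply: homog_linear_cuts => q r.
by apply: homog_linearZ; exact: (multilinear_prefix c _ fl).
Qed.

Lemma ins_right_multilinear_r n k h f s c : cochain n f -> cochain k h ->
  multilinear (ins_right k h f s c).
Proof.
move=> cf ch; apply: multilinearZ; apply: ins_multilinear => //.
by have [] := cochain_shift s c cf.
Qed.

Lemma ins_right_piece n k h f s c r : cochain n f -> cochain k h ->
  ins_right k h f s c r \in piece (dga_space A) (n + k + 1 + (bdeg s + deg c + 1) + bdeg r).
Proof.
move=> cf ch; apply: (@pieceZ _ (dga_space A)).
apply: gr_cast (proj2 (ins_cochain (cochain_shift s c cf) ch) r) _; ring.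
Qed.

Lemma brace_cochain n m g k h f : cochain n f -> cochain m g -> cochain k h ->
  cochain (n + m + k + 1 + 1) (brace m g k h f).
Proof.
move=> cf cg ch; have [fl _] := cf; split.
  apply: multilinear_cuts => [w|p].
    move=> s t; apply: homog_linear_cuts => q v.
    exact: (multilinear_sgn (fun i => (m + 1) * i)
      (ins_right_multilinear_l k h (letter m g q) v cf)).
  apply: multilinear_cuts => [v|q]; apply: multilinearZ.
    move=> s t; apply: (@homog_linear_letter _ _ _ _ _ (fun c => ins_right k h f p c v)) => //.
    exact: slot_ins_right.
  exact: (ins_right_multilinear_r p (letter m g q) cf ch).
move=> t; apply: (@piece_cuts _ (dga_space A)) => p w ->.
apply: (@piece_cuts _ (dga_space A)) => q v ->; apply: (@pieceZ _ (dga_space A)).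
apply: gr_cast (ins_right_piece p (letter m g q) v cf ch) _.
by rewrite !bdeg_cat deg_letter; ring.
Qed.

Lemma mul_cutsl (K : seq (helt A) -> seq (helt A) -> A) (x : A) t :
  dga_mul (cuts K t) x = \cuts_(u | v <- t) dga_mul (K u v) x.
Proof. exact: (lin_cuts (dga_mul_linear_l x)). Qed.

Lemma mul_cutsr (K : seq (helt A) -> seq (helt A) -> A) (x : A) t :
  dga_mul x (cuts K t) = \cuts_(u | v <- t) dga_mul x (K u v).
Proof. exact: (lin_cuts (dga_mul_linear_r x)). Qed.

Lemma mulZl (c : F) (x y : A) : dga_mul (c *: x) y = c *: dga_mul x y.
Proof. exact: (linZ' (dga_mul_linear_l y)). Qed.

Lemma mulZr (c : F) (x y : A) : dga_mul x (c *: y) = c *: dga_mul x y.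
Proof. exact: (linZ' (dga_mul_linear_r x)). Qed.

(** The boundary of [f{g,h}] collects the terms in which [g] comes first and
    multiplies from the left, [h] comes last and multiplies from the right, or
    [g] and [h] are next to each other and multiplied. *)
Lemma hochschild_d_brace n m g k h f t :
  cochain n f -> cochain m g -> cochain k h ->
  hochschild_d n (f : hfun S) = 0 -> hochschild_d m (g : hfun S) = 0 ->
  hochschild_d k (h : hfun S) = 0 ->
  (hochschild_d (n + m + k + 1 + 1) (brace m g k h f : hfun S) : CA) t =
    sgn F ((m + 1) * (n + k + 1)) *: acup (n + k + 1) g (ins k h f) t
    + sgn F (n + k + 1 + k * m) *:
      (acup k (ins m g f) h t - ins (m + k) (acup k g h) f t).
Proof.
move=> cf cg ch df dg dh; have [fl _] := cf.
have cB := brace_cochain cf cg ch; set N := n + m + k + 1 + 1 in cB *.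
rewrite (hochschild_d_self cB) (bins_brace _ cf cg ch dg).
pose w0 p q : int := (m + 1) * bdeg p + (k + 1) * (bdeg p + (m + bdeg q)).
pose H1 p q v := sgn F (w0 p q) *:
   ins k h (fun r => acup n iota f (p ++ letter m g q :: r)) v.
pose D1 p q v := sgn F (w0 p q) *: da (ins k h (fsc f p (letter m g q))) v.
pose P1 p q v := sgn F (w0 p q + (bdeg p + (m + bdeg q))) *:
   acup (-1) (ins k h (fsc f p (letter m g q))) iota v.
pose Q1 p q v := sgn F (w0 p q + (bdeg p + (m + bdeg q))) *:
   acup k (fsc f p (letter m g q)) h v.
pose R1 p q v := sgn F (w0 p q + (bdeg p + (m + bdeg q))) *:
   \cuts_(q' | r' <- v) f (p ++ hmul (letter m g q) (letter k h q') :: r').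
pose Sum (G : seq (helt A) -> seq (helt A) -> seq (helt A) -> A) := \cuts_(p | q | v <- t) G p q v.
have -> : \cuts_(p | q | v <- t)
      (sgn F ((m + 1) * bdeg p) *: marked_d (ins_right k h f) p (letter m g q) v) =
    sgn F n *: Sum H1 - sgn F n *: Sum D1 + sgn F (k + 1) *: Sum P1 + Sum Q1 - Sum R1.
  rewrite /Sum; rewrite -!cutsZ -!cutsN -!cutsD; apply: eq_cuts => p w.
  rewrite -!cutsZ -!cutsN -!cutsD; apply: eq_cuts => q v.
  rewrite (marked_d_cocycle _ _ _ cf ch df dh) deg_letter /H1 /D1 /P1 /Q1 /R1 /w0.
  linear_sgn.
have -> : da (brace m g k h f) t = sgn F (k + 1) *: Sum D1.
  rewrite /da /brace (lin_cuts (@dga_d_linear F A)) /Sum -cutsZ; apply: eq_cuts => p w.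
  rewrite (lin_cuts (@dga_d_linear F A)) -cutsZ; apply: eq_cuts => q v.
  rewrite (linZ' (@dga_d_linear F A)) /ins_right (linZ' (@dga_d_linear F A)) /D1 /w0 /da.
  by rewrite deg_letter; linear_sgn.
have -> : acup (-1) (brace m g k h f) iota t = sgn F (k + 1 + m) *: Sum P1.
  rewrite /acup /brace.
  transitivity (\cuts_(u | w <- t) \cuts_(p | q | v <- u)
    (sgn F (w0 p q + (k + 1) + (bdeg p + bdeg q + bdeg v)) *:
       dga_mul (ins k h (fsc f p (letter m g q)) v) (iota w))).
    apply: eq_cuts => u w; rewrite mul_cutsl -cutsZ; apply: eq_cuts_in => p y ->.
    rewrite mul_cutsl -cutsZ; apply: eq_cuts_in => q v ->.
    rewrite /ins_right !mulZl deg_letter /w0; linear_sgn.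
  rewrite cuts_assoc4 /Sum -cutsZ; apply: eq_cuts => p y; rewrite -cutsZ.
  apply: eq_cuts => q v; rewrite /P1 /acup -!cutsZ; apply: eq_cuts => x w.
  rewrite /w0; linear_sgn.
have -> : Sum Q1 = sgn F (k * m) *: acup k (ins m g f) h t.
  transitivity (sgn F (k * m) *: \cuts_(u | w <- t) \cuts_(p | q | v <- u)
    (sgn F ((m + 1) * bdeg p + k * (bdeg p + bdeg q + bdeg v)) *:
       dga_mul (f (p ++ letter m g q :: v)) (h w))).
    rewrite cuts_assoc4 /Sum -cutsZ; apply: eq_cuts => p y; rewrite -cutsZ.
    apply: eq_cuts => q v; rewrite /Q1 /acup -!cutsZ; apply: eq_cuts => x w.
    rewrite /w0; linear_sgn.
  congr (_ *: _); apply: eq_cuts => u w; rewrite /ins mul_cutsl -cutsZ.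
  apply: eq_cuts_in => p y ->; rewrite mul_cutsl -cutsZ; apply: eq_cuts_in => q v ->.
  by rewrite mulZl; linear_sgn.
have -> : Sum R1 = sgn F (k * m) *: ins (m + k) (acup k g h) f t.
  rewrite /Sum /ins -cutsZ; apply: eq_cuts => p y.
  transitivity (\cuts_(w | v <- y) \cuts_(q | q' <- w)
     (sgn F (k * m + ((m + k + 1) * bdeg p + k * bdeg q)) *:
        f (p ++ hmul (letter m g q) (letter k h q') :: v))).
    rewrite [RHS]cuts_assoc; apply: eq_cuts => q v; rewrite /R1 -cutsZ.
    by apply: eq_cuts => q' r'; rewrite /w0; apply: sgnZ_par; psolve.
  rewrite -cutsZ; apply: eq_cuts => w v.
  rewrite (@slot_acup _ _ _ (fun a => f (p ++ a :: v))) // -!cutsZ.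
  by apply: eq_cuts => q q'; rewrite !sgnZZ; apply: sgnZ_par; psolve.
have -> : acup N iota (brace m g k h f) t = sgn F (k + 1) *: (Sum H1
    - sgn F ((k + 1) * m + n * m + n) *: acup (n + k + 1) g (ins k h f) t).
  have h1 : \cuts_(q | v <- t) H1 [::] q v =
      sgn F ((k + 1) * m + n * m + n) *: acup (n + k + 1) g (ins k h f) t.
    rewrite /acup -cutsZ; apply: eq_cuts => q v.
    rewrite /H1 (ins_head [::] _ _ cf ch) hval_letter // deg_letter /w0.
    by rewrite !sgnZZ; apply: sgnZ_par; psolve.
  rewrite -h1 (acup_iota_l _ cB) /Sum; case: t {h1 Sum} => [|a u] /=.
    by rewrite !addr0 subrr scaler0.
  rewrite addrC addKr /brace mul_cutsr -!cutsZ; apply: eq_cuts => p y.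
  rewrite mul_cutsr -!cutsZ; apply: eq_cuts => q v.
  rewrite /H1 (ins_head (a :: p) _ _ cf ch) /ins_right mulZr mulZr deg_letter /w0.
  by rewrite !sgnZZ; apply: sgnZ_par; rewrite /N; psolve.
rewrite /N; linear_sgn.
Qed.

End Brace.

(** * The trace of a bimodule map *)

Section Trace.
Variables (F : fieldType) (A : dgAlgebra F) (d : int).
Implicit Types (s t u v x y z : seq (helt A)) (a c : helt A).
Local Notation CA := (seq (helt A) -> A).
Local Notation S := (self_bimodule A).
Local Notation Dual := (dual_bimodule A).
Variable Theta : S -> Dual.
Hypothesis Theta_map : is_bimodule_map d Theta.
Implicit Types (f g : CA) (n m k : int).
Local Notation struct := (@struct F A).
Local Notation iota := (@iota F A).
Local Notation bins := (ins (-1 - 1) struct).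

(** This is [Theta 1] on homogeneous elements, written in such a way that it is
    linear on all of [A]. *)
Definition trace (x : A) : F^o := (Theta x : dual_sort A) hone.

Lemma trace_linear : linear trace.
Proof. by move=> k x y; rewrite /trace (bmap_linear Theta_map). Qed.

Lemma ThetaE j (x : A) a : x \in gr (d := A) j ->
  (Theta x : dual_sort A) a = trace (dga_mul x (hval a)).
Proof.
move=> xj; rewrite /trace.
have /= -> := bmap_r Theta_map a xj.
by rewrite -[LHS]/((Theta x : dual_sort A) a) /dual_r hmul1r.
Qed.

(** Right linearity reduces [Theta] to the trace, and left linearity then makes the
    trace invariant under cyclic permutations. *)
Lemma trace_comm j (x : A) a : x \in gr (d := A) j ->
  trace (dga_mul (hval a) x) = sgn F (deg a * j) *: trace (dga_mul x (hval a)).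
Proof.
move=> xj; rewrite -(ThetaE a xj) /trace.
have /= -> := bmap_l Theta_map a xj.
rewrite -[LHS]/(sgn F (d * deg a) * dual_l a (j + d) (Theta x : dual_sort A) hone).
rewrite /dual_l hmul1l mulrA -sgnD -[RHS]/(_ * _); congr (_ * _).
by apply: sgn_eq_par; rewrite /=; psolve.
Qed.

Lemma trace_d j (x : A) : x \in gr (d := A) j -> trace (dga_d x) = 0.
Proof.
move=> xj; have := bmap_d Theta_map xj.
move=> /(congr1 (fun phi : dual_sort A => phi hone)).
have /asboolP[lx _] := bmap_piece Theta_map xj.
rewrite /= /dual_d (homog_linear0 lx) ?mulr0; last exact: d_one.
move=> e; have {}e : sgn F d *: trace (dga_d x) = 0 by rewrite [RHS]e.
rewrite -[LHS](sgnZ0 (F := F)) -(@sgnZ_par _ _ (d + d)) -?sgnZZ ?e ?scaler0 //.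
by psolve.
Qed.

Lemma trace0 j (x : A) : x \in gr (d := A) j -> j + d != 0 -> trace x = 0.
Proof.
move=> xj jd; have /asboolP[_ z] := bmap_piece Theta_map xj.
by apply: z; rewrite /= eq_sym oppr_eq0.
Qed.

Lemma theta_cochainE n f t a : cochain n f ->
  (theta_cochain d Theta n (f : hochschild S) t : dual_sort A) a =
  sgn F (d * n) *: trace (dga_mul (f t) (hval a)).
Proof. by move=> [_ fp]; rewrite -(ThetaE a (fp t)). Qed.

Lemma theta_ncochain n f : cochain n f ->
  ncochain (n + d) (theta_cochain d Theta n (f : hochschild S) : hfun Dual).
Proof.
move=> [fl fp]; apply: ncochainZ; split.
  move=> s t k a c e da dc ev; rewrite (fl s t k a c e da dc ev).
  exact: (bmap_linear Theta_map).
by move=> t; apply: piece_cast (bmap_piece Theta_map (fp t)) _; ring.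
Qed.

Lemma theta_linear n : linear (theta_cochain d Theta n).
Proof.
move=> k f g; apply/funext => t.
rewrite -[LHS]/(sgn F (d * n) *: Theta (k *: (f t : A) + g t)).
rewrite -[RHS]/(k *: (sgn F (d * n) *: Theta (f t)) + sgn F (d * n) *: Theta (g t)).
rewrite (bmap_linear Theta_map); linear_coefs; ring.
Qed.

(** [Theta] is left linear, and the sign in [theta_cochain] is what makes the signs
    agree. *)
Lemma theta_lcup n m f g : cochain n f -> cochain m g ->
  lcup n (m + d) f (theta_cochain d Theta m (g : hochschild S) : hfun Dual) =
  theta_cochain d Theta (n + m) (acup m f g : hochschild S).
Proof.
move=> cf cg; have [gl gp] := cg; apply/funext => t.
rewrite -[RHS]/(sgn F (d * (n + m)) *: Theta (acup m f g t)).
rewrite /acup (lin_cuts (bmap_linear Theta_map)) -cutsZ; apply: eq_cuts => u v.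
rewrite (linZ' (bmap_linear Theta_map)) -(hval_letter u cf).
rewrite [Theta (dga_mul _ _)](bmap_l Theta_map (letter n f u) (gp v)).
rewrite -[theta_cochain _ _ _ _ v]/(sgn F (d * m) *: Theta (g v)).
rewrite (_ : m + d + bdeg v = m + bdeg v + d); last by ring.
rewrite (linZ' (@bm_l_linear F A Dual _ _)) deg_letter.
linear_sgn.
Qed.

Lemma theta_d n f : cochain n f ->
  hochschild_d (n + d) (theta_cochain d Theta n (f : hochschild S) : hfun Dual) =
  theta_cochain d Theta (n - 1) (hochschild_d n (f : hfun S)).
Proof.
move=> cf; have [fl fp] := cf; have ci := iota_cochain A.
have lT := bmap_linear Theta_map.
rewrite (hochschild_dE (theta_ncochain cf)) (hochschild_d_self cf).
apply/funext => t.
rewrite -[RHS]/(sgn F (d * (n - 1)) *: Theta (da f t + sgn F n *: bins f t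
   - acup n iota f t + sgn F n *: acup (-1) f iota t)).
rewrite (linD' lT) (linB' lT) (linD' lT) !(linZ' lT).
have e1 : dcoef (n + d) (theta_cochain d Theta n (f : hochschild S) : hfun Dual) t =
    sgn F (d * n + d) *: Theta (da f t).
  rewrite /dcoef (linZ' (@bm_d_linear F A Dual _)).
  rewrite (_ : n + d + bdeg t = n + bdeg t + d); last by ring.
  have -> := bmap_d Theta_map (fp t).
  by rewrite sgnZZ.
have e2 : ins (-1 - 1) struct (theta_cochain d Theta n (f : hochschild S) : hfun Dual) t =
    sgn F (d * n) *: Theta (bins f t).
  by rewrite -(ins_map (-1 - 1) struct f t lT) -insZ.
have e3 : lcup (-1) (n + d) iota (theta_cochain d Theta n (f : hochschild S) : hfun Dual) t =
    sgn F (d * (-1 + n)) *: Theta (acup n iota f t).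
  by rewrite (theta_lcup ci cf).
have e4 : rcup (n + d) (-1) (theta_cochain d Theta n (f : hochschild S) : hfun Dual) iota t =
    sgn F (d * n) *: Theta (acup (-1) f iota t).
  rewrite /rcup /acup (lin_cuts lT) -cutsZ; apply: eq_cuts => u v.
  rewrite (linZ' (@bm_r_linear F A Dual _ _)) (linZ' lT).
  rewrite (_ : n + d + bdeg u = n + bdeg u + d); last by ring.
  rewrite -(hval_letter v ci).
  have <- := bmap_r Theta_map (letter (-1) iota v) (fp u).
  linear_sgn.
rewrite !hfunE e1 e2 e3 e4; linear_sgn.
Qed.

End Trace.

(** * The homotopy behind the Batalin-Vilkovisky identity *)

Section CyclicHomotopy.
Variables (F : fieldType) (A : dgAlgebra F) (d : int).
Implicit Types (s t u v q r w x y : seq (helt A)) (a c l : helt A).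
Local Notation CA := (seq (helt A) -> A).
Local Notation S := (self_bimodule A).
Local Notation Dual := (dual_bimodule A).
Variable Theta : S -> Dual.
Hypothesis Theta_map : is_bimodule_map d Theta.
Implicit Types (f g h : CA) (n m k : int).
Local Notation iota := (@iota F A).
Local Notation fsc f s c := (fun r => f (s ++ c :: r)).
Local Notation trace := (trace Theta).
Local Notation ofM M := (of_chain_dual M : hfun Dual).
Local Notation toM g := (to_chain_dual (g : hochschild Dual) : seq (helt A) -> F^o).
Local Notation theta n f := (theta_cochain d Theta n (f : hochschild S) : hfun Dual).
Let tl := trace_linear Theta_map.

Lemma marked_d_map (U V : lmodType F) (l : U -> V) Phi s c r : linear l ->
  marked_d (fun s c r => l (Phi s c r)) s c r = l (marked_d Phi s c r).
Proof.
move=> ll; rewrite /marked_d !(linD' ll) (linZ' ll).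
rewrite (ins_map _ _ (fun s => Phi s c r) _ ll) (ins_map _ _ (Phi s c) _ ll).
congr (_ + _); rewrite (lin_cuts ll); apply: eq_cuts => s' x.
by rewrite (lin_cuts ll); apply: eq_cuts => y r'; rewrite (linZ' ll).
Qed.

(** The terms of the norm of the product of [f] and [g] in which the marked letter
    is fed to [f]. *)
Definition arc_cup m f g s c r : F^o :=
  \cuts_(u | v <- r) (sgn F (m * (bdeg s + deg c + 1 + bdeg u)) *:
     trace (dga_mul (f (s ++ c :: u)) (g v))).

(** The terms of the product of [g] with Connes' operator of [f], by
    [lcup_connes1]. *)
Definition arc_mul m f g s c r : F^o :=
  sgn F (m * (bdeg s + deg c)) *:
    \cuts_(q | r' <- r) trace (f (s ++ hmul c (letter m g q) :: r')).

(** The terms in which a letter outside of [f] is multiplied from the left or from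
    the right cancel by cyclic invariance, except the ones in which this letter
    is the marked one. *)
Lemma cyc_d_ins_right n m f g c t : cochain n f -> cochain m g ->
  hochschild_d n (f : hfun S) = 0 -> hochschild_d m (g : hfun S) = 0 ->
  cyc_d (cyc (fun s c r => trace (ins_right m g f s c r))) (c :: t) =
    sgn F ((n + m + 1) * deg c) *: trace (dga_mul (hval c) (ins m g f t))
    + sgn F m *: cyc (arc_cup m f g) (c :: t) - cyc (arc_mul m f g) (c :: t).
Proof.
move=> cf cg df dg; rewrite cyc_d_cyc.
have cif s := ins_cochain (cochain_shift s c cf) cg.
pose w r s := (deg c + 1 + bdeg r) * bdeg s.
pose H s r := sgn F (w r s + (m + 1) * (bdeg s + deg c) + n) *:
  trace (ins m g (fun r => acup n iota f (s ++ c :: r)) r).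
pose I s r := sgn F (w r s + (m + 1) * (bdeg s + deg c) + (bdeg s + deg c) + (m + 1)) *:
  trace (acup (-1) (ins m g (fsc f s c)) iota r).
transitivity (\cuts_(r | s <- t) (H s r + I s r)
   + sgn F m *: cyc (arc_cup m f g) (c :: t) - cyc (arc_mul m f g) (c :: t)).
  rewrite /cyc -cutsZ -cutsN -!cutsD; apply: eq_cuts => r s.
  rewrite (marked_d_map (ins_right m g f) _ _ _ tl).
  rewrite (marked_d_cocycle _ _ _ cf cg df dg) (linZ' tl) !(linD' tl) !(linN' tl) !(linZ' tl).
  rewrite (linB' tl) (linD' tl) (linZ' tl).
  have -> : trace (da (ins m g (fsc f s c)) r) = 0.
    by apply: (trace_d Theta_map (proj2 (cif s) r)).
  have -> : trace (acup m (fsc f s c) g r) =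
      sgn F (m * (bdeg s + deg c + 1)) *: arc_cup m f g s c r.
    rewrite /acup (lin_cuts tl) /arc_cup -cutsZ; apply: eq_cuts => u v.
    by rewrite (linZ' tl); linear_sgn.
  have -> : trace (\cuts_(q | r' <- r) f (s ++ hmul c (letter m g q) :: r')) =
      sgn F (m * (bdeg s + deg c)) *: arc_mul m f g s c r.
    by rewrite (lin_cuts tl) /arc_mul; linear_sgn.
  rewrite /H /I /w; linear_sgn.
congr (_ + _ - _).
pose Q r l s := sgn F ((deg c + 1 + bdeg r) * bdeg s + deg l * bdeg s
   + (m + 1) * (bdeg s + deg c) + deg c + m + bdeg r + 1) *:
  trace (dga_mul (ins m g (fsc f s c) r) (hval l)).
have eI s r : I s r = if r is a :: r' then Q (belast a r') (last a r') s else 0.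
  rewrite /I (acup_iota_r _ (cif s)); case: r => [|a r].
    by rewrite (lin0' tl) scaler0.
  rewrite (linZ' tl) sgnZZ /Q; apply: sgnZ_par; rewrite /w.
  by rewrite lastI; psolve.
have eH s r : H s r = (if s is l :: s' then - Q r l s' else 0)
   + (if s is [::] then sgn F ((n + m + 1) * deg c) *:
       trace (dga_mul (hval c) (ins m g f r)) else 0).
  rewrite /H (ins_head s _ _ cf cg); case: s => [|l s].
    rewrite add0r (linZ' tl) sgnZZ; apply: sgnZ_par; rewrite /w; psolve.
  rewrite addr0 (linZ' tl) /Q (trace_comm Theta_map l (proj2 (cif s) r)) /w.
  linear_sgn.
under eq_cuts => r s do rewrite eI eH.
rewrite !cutsD cuts_shift addrAC -cutsD cuts_zero => [|r [|l s]]; last 2 first.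
- by rewrite addr0.
- by rewrite addNr.
by rewrite add0r cuts_tail.
Qed.

Lemma multilinear_lin (U V : lmodType F) (l : U -> V) (phi : seq (helt A) -> U) :
  linear l -> multilinear phi -> multilinear (fun t => l (phi t)).
Proof. by move=> ll lphi s t k a e e' da de ev; rewrite (lphi s t k a e e') // ll. Qed.

Lemma ins_right_functional n m f g : cochain n f -> cochain m g ->
  functional (n + m + 1 + d + 1) (cyc (fun s c r => trace (ins_right m g f s c r))).
Proof.
move=> cf cg; have [fl _] := cf; split=> //.
  apply: cyc_multilinear => [c r|s r|s c].
  - exact: (multilinear_lin tl (ins_right_multilinear_l m g c r cf)).
  - move=> k a e e' da de ev.
    by rewrite (slot_ins_right s r fl cg da de ev) tl.
  - exact: (multilinear_lin tl (ins_right_multilinear_r s c cf cg)).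
move=> c t nt; rewrite /cyc (eq_cuts_in (H := fun _ _ => 0)) ?cuts0 // => r s e.
rewrite (trace0 Theta_map (ins_right_piece s c r cf cg)) ?scaler0 //.
apply: contraNneq nt => h; apply/eqP; rewrite -[RHS]h e bdeg_cat; ring.
Qed.

Lemma trace_theta n f v : cochain n f ->
  unit_head (toM (theta n f)) v = sgn F (d * n) *: trace (f v).
Proof.
move=> cf; rewrite /unit_head /= mul0r expr0z mul1r (theta_cochainE Theta_map _ _ cf).
by rewrite /= dga_mul1r.
Qed.

Lemma connes1_theta n f : cochain n f ->
  connes1 (n + d) (theta n f) =
  ofM (fun w => - sgn F (n + d + d * n) *: norm (fun v => trace (f v)) w).
Proof.
move=> cf; apply: hfun_dualP => t a; rewrite /connes1 !dualE.
have -> : norm (unit_head (toM (theta n f))) (a :: t) =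
   sgn F (d * n) *: norm (fun v => trace (f v)) (a :: t).
  by rewrite -normZ; apply: eq_norm => v _; exact: trace_theta.
linear_sgn.
Qed.

Lemma lcup_connes1 n m f g : cochain m g -> cochain n f ->
  lcup m (n + d + 1) g (connes1 (n + d) (theta n f)) =
  ofM (fun w => sgn F (m * (n + d + 1) + 1 + n + d + d * n) *: cyc (arc_mul m f g) w).
Proof.
move=> cg cf; rewrite connes1_theta //; apply: hfun_dualP => t c; rewrite ofME.
have ev : linear (fun phi : dual_sort A => phi c : F^o) by [].
rewrite /lcup (lin_cuts ev) /cyc.
transitivity (\cuts_(q | r | s <- t)
   (sgn F (m * (n + d + 1) + 1 + n + d + d * n + deg c * (bdeg q + bdeg r + bdeg s)
     + (deg c + 1 + bdeg q + bdeg r) * bdeg s + m * (bdeg s + deg c)) *: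
      trace (f (s ++ hmul c (letter m g q) :: r)))).
  apply: eq_cuts => q v.
  rewrite -[LHS]/(sgn F ((n + d + 1) * bdeg q) *:
    (sgn F (deg (letter m g q) * (n + d + 1 + bdeg v + deg c)) *:
    (sgn F (deg (hmul c (letter m g q)) * bdeg v) *:
    (- sgn F (n + d + d * n) *: norm (fun v => trace (f v)) (hmul c (letter m g q) :: v))))).
  rewrite /norm /cyc -!cutsZ; apply: eq_cuts_in => r s ->.
  rewrite deg_letter /= deg_letter; linear_sgn.
rewrite -[LHS]cuts_assoc -!cutsZ; apply: eq_cuts_in => u s ->.
rewrite /arc_mul -!cutsZ; apply: eq_cuts_in => q r ->.
linear_sgn.
Qed.

(** The homotopy sums the traces of [f] with [g] inserted to the right of the
    marked letter, over all the ways to open the cyclic word. *)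
Lemma theta_circ_homotopy n m f g : cochain n f -> cochain m g ->
  hochschild_d n (f : hfun S) = 0 -> hochschild_d m (g : hfun S) = 0 ->
  exists2 W, ncochain (n + m + 1 + d + 1) W &
    hochschild_d (n + m + 1 + d + 1) W =
      theta (n + m + 1) (ins m g f)
      + sgn F (n + (n + 1) * m) *: lcup m (n + d + 1) g (connes1 (n + d) (theta n f))
      + sgn F (m + d * (n + m + 1)) *: ofM (cyc (arc_cup m f g)).
Proof.
move=> cf cg df dg; have fH := ins_right_functional cf cg.
exists (sgn F (n + m + d + d * (n + m + 1) + 1) *:
    ofM (cyc (fun s c r => trace (ins_right m g f s c r)))).
  by apply: ncochainZ; exact: of_chain_dual_cochain.
rewrite (linZ' (@hochschild_d_linear F A Dual _)) (hochschild_d_of fH).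
rewrite (lcup_connes1 cg cf); apply: hfun_dualP => t c; rewrite !dualE.
rewrite (theta_cochainE Theta_map _ _ (ins_cochain cf cg)).
rewrite (cyc_d_ins_right c t cf cg df dg).
rewrite (trace_comm Theta_map c (proj2 (ins_cochain cf cg) t)).
linear_sgn.
Qed.

(** The marked letter is fed to [f] or to [g]; in the second case the trace is
    rotated. *)
Lemma norm_acup n m f g w : cochain n f -> cochain m g ->
  norm (fun v => trace (acup m f g v)) w =
  cyc (arc_cup m f g) w + sgn F (n * m) *: cyc (arc_cup n g f) w.
Proof.
move=> cf cg; case: w => [|c t]; first by rewrite /norm /cyc scaler0 addr0.
rewrite /norm /cyc.
transitivity (\cuts_(r | s <- t) (sgn F ((deg c + 1 + bdeg r) * bdeg s) *:
    arc_cup m f g s c r)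
  + \cuts_(r | s <- t) \cuts_(u | v <- s)
     (sgn F ((deg c + 1 + bdeg r) * (bdeg u + bdeg v) + m * bdeg u) *:
      trace (dga_mul (f u) (g (v ++ c :: r))))).
  rewrite -cutsD; apply: eq_cuts => r s; rewrite /acup cuts_mark (linD' tl).
  rewrite scalerDr addrC; congr (_ + _).
    rewrite (lin_cuts tl) /arc_cup; congr (_ *: _); apply: eq_cuts => u v.
    by rewrite (linZ' tl); apply: sgnZ_par; psolve.
  rewrite (lin_cuts tl) -cutsZ; apply: eq_cuts_in => u v ->.
  by rewrite (linZ' tl) sgnZZ; apply: sgnZ_par; psolve.
congr (_ + _).
transitivity (\cuts_(r | s | u <- t)
     (sgn F (n * m + (deg c + 1 + bdeg r + bdeg s) * bdeg u + n * (bdeg u + deg c + 1 + bdeg r)) *: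
      trace (dga_mul (g (u ++ c :: r)) (f s)))).
  apply: eq_cuts => r y; apply: eq_cuts => u v.
  rewrite -{1}(hval_letter u cf) (trace_comm Theta_map _ (proj2 cg _)) hval_letter //.
  rewrite deg_letter sgnZZ; apply: sgnZ_par; psolve.
rewrite -[LHS]cuts_assoc -cutsZ; apply: eq_cuts => v s.
rewrite /arc_cup -!cutsZ; apply: eq_cuts_in => r u ->.
rewrite !sgnZZ; apply: sgnZ_par; psolve.
Qed.

(** Antisymmetrisation of [theta_circ_homotopy]: by [norm_acup] the arcs through
    [f] and the arcs through [g] add up to Connes' operator of the product. *)
Lemma bv_homotopy n m f g : cochain n f -> cochain m g ->
  hochschild_d n (f : hfun S) = 0 -> hochschild_d m (g : hfun S) = 0 ->
  exists2 W, ncochain (n + m + 1 + d + 1) W &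
    hochschild_d (n + m + 1 + d + 1) W =
      theta (n + m + 1) (bracket n m f g)
      - sgn F n *: connes1 (n + m + d) (theta (n + m) (acup m f g))
      + sgn F (n + (n + 1) * m) *: lcup m (n + d + 1) g (connes1 (n + d) (theta n f))
      + lcup n (m + d + 1) f (connes1 (m + d) (theta m g)).
Proof.
move=> cf cg df dg.
have [W1 cW1 dW1] := theta_circ_homotopy cf cg df dg.
have [W2 cW2 dW2] := theta_circ_homotopy cg cf dg df.
rewrite (_ : m + n = n + m) in cW2 dW2; last by ring.
exists (W1 - sgn F ((n + 1) * (m + 1)) *: W2).
  by apply: ncochainB => //; exact: ncochainZ.
have dl := @hochschild_d_linear F A Dual (n + m + 1 + d + 1).
rewrite (linB' dl) (linZ' dl) dW1 dW2.
rewrite (connes1_theta (acup_cochain cf cg)).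
have -> : theta (n + m + 1) (bracket n m f g) = theta (n + m + 1) (ins m g f)
    - sgn F ((n + 1) * (m + 1)) *: theta (n + m + 1) (ins n f g).
  have tlin := theta_linear Theta_map (n + m + 1).
  by rewrite -(linZ' tlin) -(linB' tlin).
apply: hfun_dualP => t c; rewrite !dualE (norm_acup _ cf cg).
linear_sgn.
Qed.

End CyclicHomotopy.

(** * Acyclic coefficients *)

Section LinearSection.
Variables (F : fieldType) (U V : lmodType F) (d : U -> V) (P : {pred U}).
Hypotheses (d_lin : linear d) (P_closed : submod_closed P).

(* graphs of partial linear sections of [d], with the pair (0, 0) left implicit *)
Let graph (X : set (V * U)) (q : V * U) : Prop := X q \/ q = 0.

Let partial_section (X : set (V * U)) : Prop :=
  [/\ forall (c : F) p q, graph X p -> graph X q -> graph X (c *: p + q),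
      forall q, graph X q -> q.2 \in P /\ d q.2 = q.1
    & forall p q, graph X p -> graph X q -> p.1 = q.1 -> p.2 = q.2].

(** By Zorn's lemma, the dimensions being arbitrary. *)
Lemma linear_section : exists sec : V -> U,
  (forall u, u \in P -> sec (d u) \in P /\ d (sec (d u)) = d u) /\
  (forall c u v, u \in P -> v \in P -> sec (c *: d u + d v) = c *: sec (d u) + sec (d v)).
Proof.
have [P0 PD] := P_closed.
have d0 : d 0 = 0 := lin0' d_lin.
have [|X [[Xlin Xsec Xfun] Xmax]] := @Zorn_bigcup _ partial_section.
  move=> G GP Gtot.
  have two p q : graph (bigcup G id) p -> graph (bigcup G id) q ->
      (p = 0 /\ q = 0) \/ exists2 X, G X & graph X p /\ graph X q.
    move=> [[X GX Xp]|->] [[Y GY Yq]|->].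
    - by have [XY|YX] := Gtot _ _ GX GY; right; [exists Y | exists X] => //; split;
        left => //; [exact: XY | exact: YX].
    - by right; exists X => //; split; [left | right].
    - by right; exists Y => //; split; [right | left].
    - by left.
  have lift X q : G X -> graph X q -> graph (bigcup G id) q.
    by move=> GX [Xq|->]; [left; exists X | right].
  split.
  - move=> c p q gp gq; have [[-> ->]|[X GX [Xp Xq]]] := two _ _ gp gq.
      by right; rewrite scaler0 addr0.
    by have [Xl _ _] := GP _ GX; apply: (lift X) => //; exact: Xl.
  - move=> q gq; have [[-> _]|[X GX [Xq _]]] := two _ _ gq gq; first by rewrite /= d0.
    by have [_ + _] := GP _ GX; exact.
  - move=> p q gp gq; have [[-> ->]|[X GX [Xp Xq]]] // := two _ _ gp gq.
    by have [_ _] := GP _ GX; exact.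
have tot u : u \in P -> exists u', graph X (d u, u').
  move=> Pu; apply: contrapT => nu.
  pose w : V * U := (d u, u).
  pose Y : set (V * U) := fun p => exists q c, graph X q /\ p = c *: w + q.
  have gY p : graph Y p -> Y p.
    by move=> [//|->]; exists 0, 0; split; [right | rewrite scale0r addr0].
  apply: (Xmax Y).
    split.
      move=> q Xq; exists q, 0; split; first by left.
      by rewrite scale0r add0r.
    move=> YX; apply: nu; exists u; left; apply: YX; exists 0, 1.
    by split; [right | rewrite scale1r addr0].
  split.
  - move=> c p q /gY[p' [a [gp ->]]] /gY[q' [b [gq ->]]]; left.
    exists (c *: p' + q'), (c * a + b); split; first exact: Xlin.
    by rewrite scalerDl scalerDr scalerA addrACA.
  - move=> p /gY[q [c [gq ->]]] /=; have [Pq dq] := Xsec _ gq.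
    split; first exact: PD.
    by rewrite (linD' d_lin) (linZ' d_lin) dq.
  - move=> p q /gY[p' [a [gp ->]]] /gY[q' [b [gq ->]]] /= e.
    have [ab|nab] := eqVneq a b.
      by move: e; rewrite ab => /addrI e; congr (_ + _); exact: Xfun.
    case: nu; pose r := (a - b)^-1 *: (- p' + q').
    exists r.2; have gr : graph X r.
      rewrite /r -[_ *: _]addr0; apply: (Xlin); last by right.
      rewrite -[- p']scaleN1r; exact: Xlin.
    suff -> : d u = r.1 by case: (r) gr.
    have nz : a - b != 0 by rewrite subr_eq0.
    have e' : (a - b) *: d u = - p'.1 + q'.1.
      apply/eqP; rewrite scalerBl subr_eq addrAC -addrA eq_sym addrC subr_eq.
      by rewrite addrC e addrC.
    by rewrite /r /= -e' scalerA mulVf ?scale1r.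
pose sec v : U := xget 0 (fun u => graph X (v, u)).
have secP u : u \in P -> graph X (d u, sec (d u)).
  by move=> /tot[u' gu']; rewrite /sec; case: xgetP => [v -> //|/(_ u')]; case.
exists sec; split=> [u Pu|c u v Pu Pv].
  by have [] := Xsec _ (secP _ Pu).
have Pcuv := PD c u v Pu Pv.
rewrite -d_lin; have g1 := secP _ Pcuv.
have g2 := Xlin c _ _ (secP _ Pu) (secP _ Pv).
by apply: (Xfun _ _ g1 g2); rewrite /= d_lin.
Qed.

End LinearSection.

Section Acyclic.
Variables (F : fieldType) (A : dgAlgebra F) (N : dgBimodule A).
Implicit Types (n : int).

Definition acyclic : Prop := forall j (x : N), x \in piece N j -> bm_d j x = 0 ->
  exists2 y, y \in piece N (j + 1) & bm_d (j + 1) y = x.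

Hypothesis acyN : acyclic.

(** Let [sec] be a linear section of the differential. What is left of [x] after
    subtracting [sec (d x)] is a cycle, hence a boundary, and [s x] is its image
    under [sec]. *)
Lemma contraction : exists s : int -> N -> N,
  [/\ forall j x, x \in piece N j -> s j x \in piece N (j + 1),
      forall j (c : F) x y, x \in piece N j -> y \in piece N j ->
        s j (c *: x + y) = c *: s j x + s j y
    & forall j x, x \in piece N j -> bm_d (j + 1) (s j x) + s (j - 1) (bm_d j x) = x].
Proof.
have [sec secP] := choice (fun j =>
  linear_section (@bm_d_linear F A N (j + 1)) (piece_closed N (j + 1))).
have sec1 j u : u \in piece N (j + 1) -> sec j (bm_d (j + 1) u) \in piece N (j + 1).
  by case: (secP j) => + _ => /(_ u) + /[dup] => h /h [].
have sec2 j u : u \in piece N (j + 1) ->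
    bm_d (j + 1) (sec j (bm_d (j + 1) u)) = bm_d (j + 1) u.
  by case: (secP j) => + _ => /(_ u) + /[dup] => h /h [].
have sec3 j (c : F) u v : u \in piece N (j + 1) -> v \in piece N (j + 1) ->
    sec j (c *: bm_d (j + 1) u + bm_d (j + 1) v) =
    c *: sec j (bm_d (j + 1) u) + sec j (bm_d (j + 1) v).
  by case: (secP j) => _; exact.
pose rest j (x : N) := x - sec (j - 1) (bm_d j x).
have restP j x : x \in piece N j -> rest j x \in piece N j /\ bm_d j (rest j x) = 0.
  move=> xj; have := sec1 (j - 1) x; have := sec2 (j - 1) x; rewrite subrK => h2 h1.
  split; first by apply: pieceB => //; exact: h1.
  by rewrite /rest (linB' (@bm_d_linear F A N j)) h2 // subrr.
have rest_lin j (c : F) x y : x \in piece N j -> y \in piece N j ->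
    rest j (c *: x + y) = c *: rest j x + rest j y.
  move=> xj yj; have := sec3 (j - 1) c x y; rewrite subrK => h3.
  rewrite /rest (@bm_d_linear F A N j) h3 //.
  by linear_coefs; ring.
have restE j x : x \in piece N j -> exists2 y, y \in piece N (j + 1) & rest j x = bm_d (j + 1) y.
  by move=> /restP[rj dr]; have [y yj <-] := acyN rj dr; exists y.
exists (fun j x => sec j (rest j x)); split.
- by move=> j x /restE[y yj ->]; exact: sec1.
- move=> j c x y xj yj; rewrite rest_lin //.
  by have [u uj ->] := restE _ _ xj; have [v vj ->] := restE _ _ yj; exact: sec3.
- move=> j x xj; have [y yj ey] := restE _ _ xj; rewrite ey sec2 // -ey.
  have sec0 i : sec i 0 = 0.
    have := sec3 i (-1) 0 0 (piece0 _ _) (piece0 _ _).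
    by rewrite (lin0' (@bm_d_linear F A N _)) scaler0 addr0 scaleN1r addNr.
  by rewrite {2}/rest (bm_dd xj) sec0 subr0 /rest subrK.
Qed.

Definition zero_below k (x : hfun N) : Prop := forall t, (size t < k)%N -> x t = 0.

Lemma hochschild_D1_local n (x y : hfun N) t : (forall u, (size u < size t)%N -> x u = y u) ->
  hochschild_D1 n x t = hochschild_D1 n y t.
Proof.
case: t => [//|a u] e; rewrite /hochschild_D1; congr (_ - _ + _).
- by rewrite e.
- apply: eq_bigr => i _; rewrite e // size_cat /= size_drop size_takel /=.
    by have := ltn_ord i; lia.
  by have := ltn_ord i; rewrite /=; lia.
- by rewrite e // size_belast.
Qed.

Lemma hochschild_D0_local n (x y : hfun N) t : (forall u, size u = size t -> x u = y u) ->
  hochschild_D0 n x t = hochschild_D0 n y t.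
Proof.
move=> e; rewrite /hochschild_D0 e //; congr (_ + _); apply: eq_bigr => i _.
rewrite e // size_cat /= size_drop size_takel ?(ltnW (ltn_ord i)) //.
by have := ltn_ord i; lia.
Qed.

Lemma hochschild_d_local n (x y : hfun N) t :
  (forall u, (size u <= size t)%N -> x u = y u) ->
  hochschild_d n x t = hochschild_d n y t.
Proof.
move=> e; rewrite -[LHS]/(hochschild_D0 n x t + hochschild_D1 n x t).
rewrite -[RHS]/(hochschild_D0 n y t + hochschild_D1 n y t); congr (_ + _).
  by apply: hochschild_D0_local => u su; apply: e; rewrite su.
by apply: hochschild_D1_local => u su; apply: e; exact: ltnW.
Qed.

Lemma hochschild_D1_0 n t : hochschild_D1 n (0 : hfun N) t = 0.
Proof.
have dl := @hochschild_d_linear F A N n.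
have := congr1 (fun x : hfun N => x t) (lin0' dl).
rewrite -[hochschild_d n 0 t]/(hochschild_D0 n 0 t + hochschild_D1 n 0 t).
rewrite /hochschild_D0 (lin0' (@bm_d_linear F A N _)) big1 ?add0r //.
by move=> i _; rewrite scaler0.
Qed.

Lemma bdeg_hd (t : seq (helt A)) (i : 'I_(size t)) :
  bdeg (take i t ++ hd (nth hone t i) :: drop i.+1 t) = bdeg t - 1 :> int.
Proof.
rewrite -[X in _ = bdeg X - 1](cat_take_drop i t) (drop_nth hone (ltn_ord i)).
by rewrite !bdeg_cat !bdeg_cons /=; ring.
Qed.

(** On a cochain which vanishes on short words, the differential of the shortest
    words is the internal one; so a contraction of [N] improves a cocycle step by
    step in the length of words. *)
Lemma hochschild_acyclic n (x : hfun N) : ncochain n x -> hochschild_d n x = 0 ->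
  exists2 y, ncochain (n + 1) y & hochschild_d (n + 1) y = x.
Proof.
move=> cx dx; have [s [sp sl sE]] := contraction.
have s0 j : s j 0 = 0.
  have := sl j (-1) 0 0 (piece0 _ _) (piece0 _ _).
  by rewrite scaler0 addr0 scaleN1r addNr.
have sZ j (c : F) u : u \in piece N j -> s j (c *: u) = c *: s j u.
  by move=> uj; rewrite -[c *: u]addr0 sl ?s0 ?addr0 //; exact: piece0.
have ssum j m (c : 'I_m -> F) (u : 'I_m -> N) : (forall i, u i \in piece N j) ->
    s j (\sum_(i < m) c i *: u i) = \sum_(i < m) c i *: s j (u i).
  move=> uj; elim: m c u uj => [|m IH] c u uj; first by rewrite !big_ord0 s0.
  rewrite !big_ord_recl sl //; first by rewrite IH.
  by elim/big_ind: _ => *; [exact: piece0 | exact: pieceD | exact: pieceZ].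
pose S (z : hfun N) : hfun N := fun t => s (n + bdeg t) (z t).
have cS z : ncochain n z -> ncochain (n + 1) (S z).
  move=> [zl zp]; split=> [u v k a b e da db ev|t]; rewrite /S.
    rewrite (zl u v k a b e da db ev) sl; first by rewrite !bdeg_cat !bdeg_cons da db.
      by apply: piece_cast (zp _) _; rewrite !bdeg_cat !bdeg_cons da.
    by apply: piece_cast (zp _) _; rewrite !bdeg_cat !bdeg_cons db.
  by apply: piece_cast (sp _ _ (zp t)) _; ring.
have step k z : ncochain n z -> hochschild_d n z = 0 -> zero_below k z ->
    zero_below k.+1 (z - hochschild_d (n + 1) (S z)).
  move=> [zl zp] dz zk t tk; apply/eqP; rewrite hfunE hfunN subr_eq0; apply/eqP.
  rewrite -[RHS]/(hochschild_D0 (n + 1) (S z) t + hochschild_D1 (n + 1) (S z) t).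
  have small u : (size u < size t)%N -> z u = 0.
    by move=> ut; apply: zk; exact: leq_trans ut _.
  rewrite (@hochschild_D1_local _ _ 0) => [|u ut]; last by rewrite /S small.
  rewrite hochschild_D1_0 addr0 /hochschild_D0 /S.
  have e0 : bm_d (n + bdeg t) (z t) = - \sum_(i < size t)
      sgn F (n + bdeg (take i t)) *: z (take i t ++ hd (nth hone t i) :: drop i.+1 t).
    apply/eqP; rewrite -addr_eq0; apply/eqP.
    have := congr1 (fun x : hfun N => x t) dz.
    rewrite -[hochschild_d n z t]/(hochschild_D0 n z t + hochschild_D1 n z t).
    by rewrite (@hochschild_D1_local _ _ 0) // hochschild_D1_0 addr0.
  rewrite -[LHS](sE _ _ (zp t)) e0 (_ : n + bdeg t + 1 = n + 1 + bdeg t); last by ring.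
  congr (_ + _); rewrite -scaleN1r sZ ?scaleN1r.
    rewrite ssum => [|i]; last by apply: piece_cast (zp _) _; rewrite bdeg_hd; ring.
    rewrite -sumrN; apply: eq_bigr => i _; rewrite bdeg_hd sgnZN.
    rewrite (_ : n + bdeg t - 1 = n + (bdeg t - 1)); last by ring.
    by apply: sgnZ_par; psolve.
  elim/big_ind: _ => [|? ?|i _]; [exact: piece0 | exact: pieceD | apply: pieceZ].
  by apply: piece_cast (zp _) _; rewrite bdeg_hd; ring.
(* [Y k] is correct on the words of length less than [k], and stable on them *)
pose Y := fix Y k : hfun N :=
  if k is k'.+1 then Y k' + S (x - hochschild_d (n + 1) (Y k')) else 0.
have dl := @hochschild_d_linear F A N (n + 1).
have rest k : [/\ ncochain (n + 1) (Y k),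
    ncochain n (x - hochschild_d (n + 1) (Y k)) &
    zero_below k (x - hochschild_d (n + 1) (Y k))].
  elim: k => [|k [cY cr zr]].
    split=> //; first by apply/ncochainP; exact: (@piece0 _ (hochschild_space N)).
    by rewrite /= (lin0' dl) subr0.
  have cY' : ncochain (n + 1) (Y k.+1) by apply: ncochainD => //; exact: cS.
  split=> //.
    apply: ncochainB => //.
    by apply: ncochain_cast (hochschild_d_cochain cY') _; ring.
  rewrite -[Y k.+1]/(Y k + S (x - hochschild_d (n + 1) (Y k))) (linD' dl).
  rewrite opprD addrA; apply: step => //.
  rewrite (linB' (@hochschild_d_linear F A N n)) dx sub0r.
  by rewrite -[X in hochschild_d X (hochschild_d _ _)](addrK 1 n) hochschild_dd // oppr0.
have stable k t : (size t < k)%N -> Y k t = Y (size t).+1 t.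
  elim: k => [//|k IH]; rewrite ltnS leq_eqVlt => /orP[/eqP <- //|tk].
  rewrite -IH //= hfunE; have [_ _ zr] := rest k.
  by rewrite /S zr // s0 addr0.
exists (fun t => Y (size t).+1 t : N).
  split=> [u v k a b e da db ev|t].
    rewrite !size_cat /=; have [[Yl _] _ _] := rest (size u + (size v).+1).+1.
    exact: Yl.
  by have [[_ Yp] _ _] := rest (size t).+1; exact: Yp.
apply/funext => t; have [_ _ zr] := rest (size t).+1.
have /eqP := zr t (ltnSn _); rewrite hfunE hfunN subr_eq0 => /eqP ->.
by apply: hochschild_d_local => u ut; symmetry; exact: stable.
Qed.

End Acyclic.

(** * The mapping cone of a quasi-isomorphism *)

Section Cone.
Variables (F : fieldType) (A : dgAlgebra F) (M N : dgBimodule A) (d : int).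
Variable Theta : M -> N.
Hypothesis Theta_map : is_bimodule_map d Theta.
Implicit Types (j n : int) (p q : (M * N)%type) (a b : helt A).

Definition cone_sort : lmodType F := (M * N)%type.

Definition cone_piece j : {pred cone_sort} :=
  fun p => (p.1 \in piece M j) && (p.2 \in piece N (j + d + 1)).

Lemma cone_piece_closed j : submod_closed (cone_piece j).
Proof.
split=> [|c p q /andP[p1 p2] /andP[q1 q2]].
  by apply/andP; split; apply: piece0.
by apply/andP; split; apply: pieceP.
Qed.

Definition cone_space : gradedSpace F := GradedSpace cone_piece_closed.

Definition cone_d j (p : cone_sort) : cone_sort :=
  (bm_d j p.1, Theta p.1 + sgn F (d + 1) *: bm_d (j + d + 1) p.2).

Definition cone_l a j (p : cone_sort) : cone_sort :=
  (bm_l a j p.1, sgn F ((d + 1) * deg a) *: bm_l a (j + d + 1) p.2).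

Definition cone_r j (p : cone_sort) a : cone_sort :=
  (bm_r j p.1 a, bm_r (j + d + 1) p.2 a).

Lemma cone_eq (p q : cone_sort) : p.1 = q.1 -> p.2 = q.2 -> p = q.
Proof. by case: p q => [? ?] [? ?] /= -> ->. Qed.

(** The mapping cone of [Theta] is again a bimodule, the action on its second
    summand being twisted by the sign of the degree [d + 1] by which that
    summand is shifted. *)
Definition cone : dgBimodule A.
Proof.
apply: (@DGBimodule F A cone_space cone_d cone_l cone_r).
- move=> j c p q; apply: cone_eq; rewrite /= ?bm_d_linear // (bmap_linear Theta_map).
  linear_coefs; ring.
- move=> a j c p q; apply: cone_eq; rewrite /= bm_l_linear //.
  linear_coefs; ring.
- by move=> a j c p q; apply: cone_eq; rewrite /= (bm_r_linear a).
- move=> j p /andP[p1 p2] c a b e da db ev; apply: cone_eq; rewrite /=.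
    exact: (bm_l_homog p1).
  rewrite (bm_l_homog p2 da db ev) da db; linear_coefs; ring.
- move=> j p /andP[p1 p2] c a b e da db ev; apply: cone_eq; rewrite /=.
    exact: (bm_r_homog p1).
  exact: (bm_r_homog p2).
- move=> j p /andP[p1 p2]; apply/andP; split; first exact: bm_d_piece.
  apply: pieceD; first by apply: piece_cast (bmap_piece Theta_map p1) _; ring.
  by apply: pieceZ; apply: piece_cast (bm_d_piece p2) _; ring.
- move=> a j p /andP[p1 p2]; apply/andP; split; first exact: bm_l_piece.
  by apply: pieceZ; apply: piece_cast (bm_l_piece a p2) _; ring.
- move=> a j p /andP[p1 p2]; apply/andP; split; first exact: bm_r_piece.
  by apply: piece_cast (bm_r_piece a p2) _; ring.
- move=> j p /andP[p1 p2]; apply: cone_eq; rewrite /=; first exact: bm_dd.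
  rewrite (_ : j - 1 + d + 1 = j + d + 1 - 1); last by ring.
  rewrite (linD' (@bm_d_linear F A N _)) (linZ' (@bm_d_linear F A N _)) (bm_dd p2).
  rewrite (_ : j + d + 1 - 1 = j + d); last by ring.
  rewrite (bmap_d Theta_map p1); linear_sgn.
- move=> j p /andP[p1 p2]; apply: cone_eq; rewrite /= ?mulr0 ?sgnZ0; exact: bm_l1.
- by move=> j p /andP[p1 p2]; apply: cone_eq; rewrite /= bm_r1.
- move=> a b j p /andP[p1 p2]; apply: cone_eq; rewrite /=; first exact: bm_lA.
  rewrite (bm_lA a b p2) (linZ' (@bm_l_linear F A N _ _)).
  rewrite (_ : deg b + j + d + 1 = deg b + (j + d + 1)); last by ring.
  linear_sgn.
- move=> a b j p /andP[p1 p2]; apply: cone_eq; rewrite /= bm_rA //.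
  by congr bm_r; ring.
- move=> a b j p /andP[p1 p2]; apply: cone_eq; rewrite /=; first exact: bm_lr.
  rewrite (linZ' (@bm_r_linear F A N _ _)).
  rewrite (_ : deg a + j + d + 1 = deg a + (j + d + 1)); last by ring.
  rewrite (_ : j + deg b + d + 1 = j + d + 1 + deg b); last by ring.
  by rewrite (bm_lr a b p2).
- move=> a j p /andP[p1 p2]; apply: cone_eq; rewrite /=; first exact: bm_dl.
  rewrite (bmap_l Theta_map a p1) (linZ' (@bm_d_linear F A N _)).
  rewrite (_ : deg a + j + d + 1 = deg a + (j + d + 1)); last by ring.
  rewrite (bm_dl a p2) (linD' (@bm_l_linear F A N _ _)) (linZ' (@bm_l_linear F A N _ _)).
  rewrite (_ : j - 1 + d + 1 = j + d); last by ring.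
  rewrite (_ : j + d + 1 - 1 = j + d); last by ring.
  linear_sgn.
- move=> a j p /andP[p1 p2]; apply: cone_eq; rewrite /=; first exact: bm_dr.
  rewrite (bmap_r Theta_map a p1).
  rewrite (_ : j + deg a + d + 1 = j + d + 1 + deg a); last by ring.
  rewrite (bm_dr a p2) (linD' (@bm_r_linear F A N _ _)) (linZ' (@bm_r_linear F A N _ _)).
  rewrite (_ : j - 1 + d + 1 = j + d); last by ring.
  rewrite (_ : j + d + 1 - 1 = j + d); last by ring.
  linear_sgn.
Defined.

Definition cone_fst (z : hfun cone) : hfun M := fun t => (z t : cone_sort).1.
Definition cone_snd (z : hfun cone) : hfun N := fun t => (z t : cone_sort).2.
Definition cone_pair (x : hfun M) (y : hfun N) : hfun cone :=
  fun t => ((x t, y t) : cone_sort).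

Lemma cone_sum1 m (G : 'I_m -> cone_sort) : (\sum_(i < m) G i).1 = \sum_(i < m) (G i).1.
Proof. by apply: (big_morph (fun p : cone_sort => p.1)). Qed.

Lemma cone_sum2 m (G : 'I_m -> cone_sort) : (\sum_(i < m) G i).2 = \sum_(i < m) (G i).2.
Proof. by apply: (big_morph (fun p : cone_sort => p.2)). Qed.

Lemma cone_ncochain n x y : ncochain n x -> ncochain (n + d + 1) y ->
  ncochain n (cone_pair x y).
Proof.
move=> [xl xp] [yl yp]; split=> [s t c a b e da db ev|t].
  by apply: cone_eq; [exact: xl | exact: yl].
apply/andP; split=> //=; apply: piece_cast (yp t) _; ring.
Qed.

Lemma cone_fst_ncochain n z : ncochain n z -> ncochain n (cone_fst z).
Proof.
move=> [zl zp]; split=> [s t c a b e da db ev|t]; last by have /andP[] := zp t.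
by rewrite /cone_fst (zl s t c a b e da db ev).
Qed.

Lemma cone_snd_ncochain n z : ncochain n z -> ncochain (n + d + 1) (cone_snd z).
Proof.
move=> [zl zp]; split=> [s t c a b e da db ev|t].
  by rewrite /cone_snd (zl s t c a b e da db ev).
by have /andP[_ p2] := zp t; apply: piece_cast p2 _; ring.
Qed.

Lemma hochschild_d_fst n z :
  cone_fst (hochschild_d n z) = hochschild_d n (cone_fst z).
Proof.
apply/funext => t.
rewrite -[LHS]/(((hochschild_D0 n z t + hochschild_D1 n z t) : cone_sort).1).
rewrite -[RHS]/(hochschild_D0 n (cone_fst z) t + hochschild_D1 n (cone_fst z) t).
rewrite -[LHS]/((hochschild_D0 n z t : cone_sort).1 + (hochschild_D1 n z t : cone_sort).1).
congr (_ + _).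
  by rewrite /hochschild_D0 -[LHS]/(_ + (_ : cone_sort).1) cone_sum1.
case: t => [//|a u]; rewrite /hochschild_D1.
rewrite -[LHS]/(- _ - (_ : cone_sort).1 + _) cone_sum1.
by [].
Qed.

Lemma hochschild_d_snd n z t :
  cone_snd (hochschild_d n z) t =
  Theta (cone_fst z t) + sgn F (d + 1) *: hochschild_d (n + d + 1) (cone_snd z) t.
Proof.
rewrite -[LHS]/(((hochschild_D0 n z t + hochschild_D1 n z t) : cone_sort).2).
rewrite -[hochschild_d _ _ t]/(hochschild_D0 (n + d + 1) (cone_snd z) t
  + hochschild_D1 (n + d + 1) (cone_snd z) t).
rewrite -[LHS]/((hochschild_D0 n z t : cone_sort).2 + (hochschild_D1 n z t : cone_sort).2).
rewrite scalerDr addrA; congr (_ + _).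
  rewrite /hochschild_D0 -[LHS]/(_ + (_ : cone_sort).2) cone_sum2.
  rewrite -[LHS]/(Theta (cone_fst z t) + sgn F (d + 1) *: bm_d (n + bdeg t + d + 1) (cone_snd z t) + _).
  rewrite -addrA; congr (_ + _); rewrite scalerDr scaler_sumr; congr (_ + _).
    by congr (_ *: bm_d _ _); ring.
  apply: eq_bigr => i _; rewrite -[LHS]/(_ *: cone_snd z _).
  linear_sgn.
case: t => [|a u]; rewrite /hochschild_D1; first by rewrite scaler0.
rewrite -[LHS]/(- _ - (_ : cone_sort).2 + _) cone_sum2.
rewrite scalerDr scalerBr scaler_sumr; congr (_ - _ + _).
- rewrite -[LHS]/(- (_ *: (_ *: bm_l a (n + bdeg u + d + 1) (cone_snd z u)))).
  rewrite (_ : n + bdeg u + d + 1 = n + d + 1 + bdeg u); last by ring.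
  linear_sgn.
- apply: eq_bigr => i _; rewrite -[LHS]/(_ *: cone_snd z _).
  linear_sgn.
- rewrite -[LHS]/(_ *: bm_r (n + bdeg (belast a u) + d + 1) (cone_snd z (belast a u)) (last a u)).
  rewrite (_ : n + bdeg (belast a u) + d + 1 = n + d + 1 + bdeg (belast a u)); last by ring.
  linear_sgn.
Qed.

End Cone.

Section ConeAcyclic.
Variables (F : fieldType) (A : dgAlgebra F) (M N : dgBimodule A) (d : int).
Variable Theta : M -> N.
Hypothesis Theta_map : is_bimodule_map d Theta.

Lemma bm_cycleP (L : dgBimodule A) n (x : L) :
  x \in cycle (bm_complex L) n <-> x \in piece L n /\ bm_d n x = 0.
Proof.
have -> : (x \in cycle (bm_complex L) n) = (x \in piece L n) && (bm_d n x == 0) by [].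
by split=> [/andP[px /eqP dx]|[-> /eqP]].
Qed.

Lemma bmap_induced n : induced1 (Theta : bm_complex M -> bm_complex N)
  (@homology_map F (bm_complex M) (bm_complex N) n (n + d) Theta).
Proof.
have lT := bmap_linear Theta_map.
have cT z : z \in cycle (bm_complex M) n -> Theta z \in cycle (bm_complex N) (n + d).
  move=> /bm_cycleP[pz dz]; apply/bm_cycleP; split; first exact: bmap_piece.
  by rewrite (bmap_d Theta_map pz) dz (lin0' lT) scaler0.
apply: homology_map_induced => // z w cz cw [y py dy].
apply: (proj2 (hclass_eq (cT z cz) (cT w cw))).
exists (sgn F d *: Theta y).
  by apply: pieceZ; apply: (@piece_cast _ N) (bmap_piece Theta_map py) _; ring.
rewrite /= (linZ' (@bm_d_linear F A N _)) (_ : n + d + 1 = n + 1 + d); last by ring.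
rewrite (bmap_d Theta_map py); move: dy => /= ->.
rewrite (linB' lT); linear_sgn.
Qed.

(** For a cycle [(x, y)], injectivity in homology makes [x] a boundary, and
    surjectivity then corrects its primitive so that [y] is reached. *)
Lemma cone_acyclic : @is_quasi_iso F (bm_complex M) (bm_complex N) d Theta ->
  acyclic (cone Theta_map).
Proof.
move=> qi j [x y] /andP[/= px py] [dx dy]; have lT := bmap_linear Theta_map.
have ld i := @bm_d_linear F A N i.
have cx : x \in cycle (bm_complex M) j by apply/bm_cycleP.
have c0 : (0 : M) \in cycle (bm_complex M) j.
  by apply/bm_cycleP; split; [exact: piece0 | rewrite (lin0' (@bm_d_linear F A M _))].
have [cTx Tx] := bmap_induced cx; have [cT0 T0] := bmap_induced c0.
have eT : hclass (bm_complex N) (j + d) (Theta x) = hclass (bm_complex N) (j + d) (Theta 0).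
  apply: (proj2 (hclass_eq cTx cT0)); exists (sgn F d *: y); first exact: pieceZ.
  rewrite /= (linZ' (ld _)) (lin0' lT) subr0.
  have -> : Theta x = - (sgn F (d + 1) *: bm_d (j + d + 1) y) by apply/eqP; rewrite -addr_eq0 dy.
  linear_sgn.
have /(hclass_eq cx c0)[x' px' dx'] : hclass (bm_complex M) j x = hclass (bm_complex M) j 0.
  by apply: (bij_inj (qi j)); rewrite Tx T0 eT.
move: dx'; rewrite subr0 /= => dx'.
have cy : y - Theta x' \in cycle (bm_complex N) (j + 1 + d).
  have py' : y \in piece N (j + 1 + d) by apply: piece_cast py _; ring.
  apply/bm_cycleP; split; first exact: (pieceB py' (bmap_piece Theta_map px')).
  rewrite (linB' (ld _)) (bmap_d Theta_map px') dx' (_ : j + 1 + d = j + d + 1); last by ring.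
  apply: (@scalerI _ _ (sgn F (d + 1))).
    by rewrite expfz_neq0 // oppr_eq0 oner_eq0.
  rewrite scaler0 -[RHS]dy; linear_sgn.
have [z ez] : exists z, @homology_map F (bm_complex M) (bm_complex N) (j + 1) (j + 1 + d) Theta z =
    hclass (bm_complex N) (j + 1 + d) (y - Theta x').
  by have [g _ gK] := qi (j + 1); exists (g (hclass (bm_complex N) (j + 1 + d) (y - Theta x'))); rewrite gK.
have [z' cz' zE] := hclassP z; have [cTz Tz] := bmap_induced cz'.
have eyz : hclass (bm_complex N) (j + 1 + d) (y - Theta x') =
    hclass (bm_complex N) (j + 1 + d) (Theta z') by rewrite -ez zE Tz.
have [w pw dw] := proj1 (hclass_eq cy cTz) eyz.
have /bm_cycleP[pz' dz'] := cz'.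
exists ((x' + z', sgn F (d + 1) *: w) : cone_sort M N).
  apply/andP; split; first exact: pieceD.
  by apply: pieceZ; apply: piece_cast pw _; ring.
apply: cone_eq; rewrite /=.
  by rewrite (linD' (@bm_d_linear F A M _)) dx' dz' addr0.
rewrite (linZ' (ld _)) (linD' lT).
move: dw; rewrite /= => ->; linear_sgn.
Qed.

End ConeAcyclic.

Section ThetaBijective.
Variables (F : fieldType) (A : dgAlgebra F) (d : int).
Local Notation S := (self_bimodule A).
Local Notation Dual := (dual_bimodule A).
Variable Theta : S -> Dual.
Hypothesis Theta_map : is_bimodule_map d Theta.
Local Notation theta n f := (theta_cochain d Theta n (f : hochschild S) : hfun Dual).
Implicit Types (n : int).

Lemma theta_cycle n (f : hochschild S) : f \in cycle (hochschild S) n ->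
  theta n f \in cycle (hochschild Dual) (n + d).
Proof.
move=> /cycleP[/cochain_self cf df]; apply/cycleP; split.
  exact: (theta_ncochain Theta_map cf).
by rewrite (theta_d Theta_map cf) df (lin0' (theta_linear Theta_map _)).
Qed.

Lemma theta_induced n : induced1 (theta_cochain d Theta n) (@HH_theta F A d Theta n).
Proof.
apply: homology_map_induced => [z|z w cz cw [y /ncochainP /cochain_self py dy]].
  exact: theta_cycle.
apply: (proj2 (hochschild_homologous (theta_cycle cz) (theta_cycle cw))).
have cty := theta_ncochain Theta_map py.
exists (theta (n + 1) y); first by apply: ncochain_cast cty _; ring.
rewrite (_ : n + d + 1 = n + 1 + d); last by ring.
rewrite (theta_d Theta_map py) addrK.
move: dy; rewrite -[pc_d (n + 1) y]/(hochschild_d (n + 1) y) => ->.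
exact: (linB' (theta_linear Theta_map n)).
Qed.

(** Solves simultaneously for a primitive of [x] and for a homotopy between its
    image and [y]; injectivity on cohomology is the case of a given [y],
    surjectivity the case [x = 0]. *)
Lemma cone_cocycle (qi : acyclic (cone Theta_map)) n (x : hfun S) (y : hfun Dual) :
  ncochain n x -> ncochain (n + d + 1) y -> hochschild_d n x = 0 ->
  (forall t, Theta (x t) + sgn F (d + 1) *: hochschild_d (n + d + 1) y t = 0) ->
  exists a b, [/\ ncochain (n + 1) a, ncochain (n + 1 + d + 1) b,
    hochschild_d (n + 1) a = x &
    forall t, Theta (a t) + sgn F (d + 1) *: hochschild_d (n + 1 + d + 1) b t = y t].
Proof.
move=> cx cy dx dy.
have cp := cone_ncochain Theta_map cx cy.
have [|z cz dz] := hochschild_acyclic qi cp.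
  apply/funext => t; apply: cone_eq.
    rewrite -[LHS]/(cone_fst (hochschild_d n (cone_pair Theta_map x y)) t).
    by rewrite hochschild_d_fst dx.
  rewrite -[LHS]/(cone_snd (hochschild_d n (cone_pair Theta_map x y)) t).
  by rewrite hochschild_d_snd dy.
exists (cone_fst z), (cone_snd z); split.
- exact: cone_fst_ncochain.
- exact: cone_snd_ncochain.
- by rewrite -hochschild_d_fst dz.
- by move=> t; rewrite -hochschild_d_snd dz.
Qed.

Lemma HH_theta_bij :
  @is_quasi_iso F (bm_complex S) (bm_complex Dual) d Theta ->
  forall n, bijective (@HH_theta F A d Theta n).
Proof.
move=> qi n; have ac : acyclic (cone Theta_map) := cone_acyclic qi.
have lth := theta_linear Theta_map n.
have dS i := @hochschild_d_linear F A S i; have dD i := @hochschild_d_linear F A Dual i.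
have inj : injective (@HH_theta F A d Theta n).
  move=> x y; have [f cf ->] := hclassP x; have [g cg ->] := hclassP y.
  have [ctf ->] := theta_induced cf; have [ctg ->] := theta_induced cg.
  move=> /(hochschild_homologous ctf ctg)[v cv dv].
  have /cycleP[cf' df] := cf; have /cycleP[cg' dg] := cg.
  apply: (proj2 (hochschild_homologous cf cg)).
  have [||||a [b [ca _ da _]]] := @cone_cocycle ac n (f - g)
    (sgn F (d + d * n) *: v); last by exists a.
  - exact: ncochainB.
  - exact: ncochainZ.
  - by rewrite (linB' (dS n)) df dg subrr.
  - move=> t; rewrite (linZ' (dD _)) dv -(linB' lth).
    rewrite -[X in _ + _ *: X]/(sgn F (d + d * n) *: (sgn F (d * n) *: Theta ((f - g : hfun S) t))).
    linear_sgn.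
have surj y : exists x, @HH_theta F A d Theta n x = y.
  have [w cw ->] := hclassP y; have /cycleP[cw' dw] := cw.
  have [||||a [b [ca cb da db]]] := @cone_cocycle ac (n - 1) 0 w.
  - by apply/ncochainP; exact: (@piece0 _ (hochschild_space S)).
  - by apply: ncochain_cast cw' _; ring.
  - by rewrite (lin0' (dS _)).
  - move=> t; rewrite (_ : n - 1 + d + 1 = n + d); last by ring.
    by rewrite dw scaler0 addr0 (lin0' (bmap_linear Theta_map)).
  rewrite subrK in ca cb da db.
  have ca' : sgn F (d * n) *: a \in cycle (hochschild S) n.
    apply/cycleP; split; first exact: ncochainZ.
    by rewrite (linZ' (dS _)) da scaler0.
  exists (hclass (hochschild S) n (sgn F (d * n) *: a)).
  have [cta ->] := theta_induced ca'.
  apply: (proj2 (hochschild_homologous cta cw)).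
  exists (sgn F d *: b); first by apply: ncochainZ; apply: ncochain_cast cb _; ring.
  apply/funext => t; rewrite (linZ' (dD _)) (linZ' lth) !hfunE.
  rewrite -[theta n a t]/(sgn F (d * n) *: Theta (a t)) -db; linear_sgn.
have [g gK] := choice surj; exists g => // x; exact: inj.
Qed.

End ThetaBijective.

(** * The Gerstenhaber algebra *)

Section ClassCalculus.
Variables (F : fieldType) (C C' : precomplex F).
Implicit Types (z w : C) (n m : int).

Lemma cycle_cast n m z : z \in cycle C n -> n = m -> z \in cycle C m.
Proof. by move=> + <-. Qed.

Lemma cycleD n z w : z \in cycle C n -> w \in cycle C n -> z + w \in cycle C n.
Proof. exact: rpredD. Qed.

Lemma cycleZ n c z : z \in cycle C n -> c *: z \in cycle C n.
Proof. exact: rpredZ. Qed.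

Lemma cycle0 n : (0 : C) \in cycle C n.
Proof. exact: rpred0. Qed.

Lemma cycleN n z : z \in cycle C n -> - z \in cycle C n.
Proof. by rewrite -scaleN1r; exact: cycleZ. Qed.

Lemma hclass0 n : hclass C n 0 = 0.
Proof.
have := hclass_lin (-1) (cycle0 n) (cycle0 n).
by rewrite scaler0 addr0 scaleN1r addNr.
Qed.

Lemma hclassD n z w : z \in cycle C n -> w \in cycle C n ->
  hclass C n (z + w) = hclass C n z + hclass C n w.
Proof. by move=> cz cw; have := hclass_lin 1 cz cw; rewrite !scale1r. Qed.

Lemma hclassZ n c z : z \in cycle C n -> hclass C n (c *: z) = c *: hclass C n z.
Proof. by move=> cz; have := hclass_lin c cz (cycle0 n); rewrite hclass0 !addr0. Qed.

Lemma hclassN n z : z \in cycle C n -> hclass C n (- z) = - hclass C n z.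
Proof. by move=> cz; rewrite -!scaleN1r hclassZ. Qed.

Lemma hclass_comb n a b c x y z : x \in cycle C n -> y \in cycle C n -> z \in cycle C n ->
  a *: (x - b *: y - c *: z) \in cycle C n /\
  a *: (hclass C n x - b *: hclass C n y - c *: hclass C n z) =
    hclass C n (a *: (x - b *: y - c *: z)).
Proof.
move=> cx cy cz; have cy' := cycleN (cycleZ b cy); have cz' := cycleN (cycleZ c cz).
have cxy := cycleD cx cy'; have cR := cycleD cxy cz'.
split; first exact: cycleZ.
rewrite (hclassZ a cR) (hclassD cxy cz') (hclassD cx cy').
by rewrite (hclassN (cycleZ b cy)) (hclassN (cycleZ c cz)) (hclassZ b cy) (hclassZ c cz).
Qed.

Lemma gcast_hclass i j (e : i = j) z :
  gcast (G := fun n => homology C n) e (hclass C i z) = hclass C j z.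
Proof. by case: j / e. Qed.

Lemma induced1_linear n m (phi : C -> C') (h : homology C n -> homology C' m) :
  (forall c z w, z \in cycle C n -> w \in cycle C n ->
     phi (c *: z + w) = c *: phi z + phi w) ->
  induced1 phi h -> linear h.
Proof.
move=> lphi ih c x y; have [z cz ->] := hclassP x; have [w cw ->] := hclassP y.
have [c1 e1] := ih _ cz; have [c2 e2] := ih _ cw.
have [_ e3] := ih _ (cycleD (cycleZ c cz) cw).
by rewrite -(hclass_lin c cz cw) e1 e2 e3 lphi // (hclass_lin c c1 c2).
Qed.

End ClassCalculus.

Section GerstenhaberLaws.
Variables (F : fieldType) (A : dgAlgebra F).
Local Notation CA := (seq (helt A) -> A).
Local Notation S := (self_bimodule A).
Local Notation C := (hochschild S).
Local Notation cl n f := (hclass C n (f : C)).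
Local Notation cocycle n f := ((f : C) \in cycle C n).
Implicit Types (f g h : CA) (n m k i j : int).

Lemma cocycleP n f : cocycle n f <-> cochain n f /\ hochschild_d n (f : hfun S) = 0.
Proof. by rewrite cycleP; split=> -[/cochain_self ? ?]. Qed.

Lemma HH_cupE n m f g : cocycle n f -> cocycle m g ->
  cocycle (n + m) (acup m f g) /\ HH_cup (cl n f) (cl m g) = cl (n + m) (acup m f g).
Proof. by move=> cf cg; rewrite -hochschild_cupE; exact: acup_induced. Qed.

Lemma HH_bracketE n m f g : cocycle n f -> cocycle m g ->
  cocycle (n + m + 1) (bracket n m f g) /\
  HH_bracket (cl n f) (cl m g) = cl (n + m + 1) (bracket n m f g).
Proof. by move=> cf cg; rewrite -bracketE; exact: bracket_induced. Qed.

Lemma acup_linl m c f f' g t :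
  acup m (fun t => c *: f t + f' t) g t = c *: acup m f g t + acup m f' g t.
Proof.
rewrite /acup -cutsZ -cutsD; apply: eq_cuts => u v.
rewrite dga_mul_linear_l; linear_coefs; ring.
Qed.

Lemma acup_linr m c f g g' t :
  acup m f (fun t => c *: g t + g' t) t = c *: acup m f g t + acup m f g' t.
Proof.
rewrite /acup -cutsZ -cutsD; apply: eq_cuts => u v.
rewrite dga_mul_linear_r; linear_coefs; ring.
Qed.

Lemma HH_cup_linl n m (b : HH S m) : linear (fun a : HH S n => HH_cup a b).
Proof.
have [g cg ->] := hclassP b.
apply: (@induced1_linear F C C n (n + m) (fun f : C => acup m f g : C) (fun a => HH_cup a (cl m g))) => [c f f' _ _|f cf].
  by apply/funext => t; exact: acup_linl.
exact: HH_cupE.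
Qed.

Lemma HH_cup_linr n m (a : HH S n) : linear (fun b : HH S m => HH_cup a b).
Proof.
have [f cf ->] := hclassP a.
apply: (@induced1_linear F C C m (n + m) (fun g : C => acup m f g : C) (fun b => HH_cup (cl n f) b)) => [c g g' _ _|g cg].
  by apply/funext => t; exact: acup_linr.
exact: HH_cupE.
Qed.

Lemma HH_bracket_linl n m (b : HH S m) : linear (fun a : HH S n => HH_bracket a b).
Proof.
have [g cg ->] := hclassP b.
apply: (@induced1_linear F C C n (n + m + 1) (fun f : C => bracket n m f g : C) (fun a => HH_bracket a (cl m g))) => [c f f'|f cf].
  move=> /cocycleP[cf _] /cocycleP[cf' _]; move/cocycleP: cg => [cg _].
  exact: bracket_linl.
exact: HH_bracketE.
Qed.

Lemma HH_bracket_linr n m (a : HH S n) : linear (fun b : HH S m => HH_bracket a b).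
Proof.
have [f cf ->] := hclassP a.
apply: (@induced1_linear F C C m (n + m + 1) (fun g : C => bracket n m f g : C) (fun b => HH_bracket (cl n f) b)) => [c g g'|g cg].
  move=> /cocycleP[cg _] /cocycleP[cg' _]; move/cocycleP: cf => [cf _].
  rewrite bracketC (bracketC n m f g) (bracketC n m f g') bracket_linl //.
  apply/funext => t; rewrite !hfunE; linear_coefs; ring.
exact: HH_bracketE.
Qed.

Lemma HH_cupA i j k (a : HH S i) (b : HH S j) (c : HH S k) (e : i + (j + k) = i + j + k) :
  gcast (G := fun n => HH S n) e (HH_cup a (HH_cup b c)) = HH_cup (HH_cup a b) c.
Proof.
have [f cf ->] := hclassP a; have [g cg ->] := hclassP b; have [h ch ->] := hclassP c.
have [cfg ->] := HH_cupE cf cg; have [cgh ->] := HH_cupE cg ch.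
have [_ ->] := HH_cupE cf cgh; have [_ ->] := HH_cupE cfg ch.
move/cocycleP: cf => [cf _]; move/cocycleP: cg => [cg _]; move/cocycleP: ch => [ch _].
by rewrite gcast_hclass (acupA cf cg ch).
Qed.

Lemma HH_cup1l i (a : HH S i) (e : 0 + i = i) :
  gcast (G := fun n => HH S n) e (HH_cup (@HH_one F A) a) = a.
Proof.
have [f cf ->] := hclassP a.
have [_ ->] := HH_cupE (one_cycle A) cf.
by rewrite gcast_hclass acup1l.
Qed.

Lemma HH_cup1r i (a : HH S i) (e : i + 0 = i) :
  gcast (G := fun n => HH S n) e (HH_cup a (@HH_one F A)) = a.
Proof.
have [f cf ->] := hclassP a.
have [_ ->] := HH_cupE cf (one_cycle A).
by rewrite gcast_hclass acup1r.
Qed.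

Lemma HH_cupC i j (a : HH S i) (b : HH S j) (e : j + i = i + j) :
  HH_cup a b = sgn F (i * j) *: gcast (G := fun n => HH S n) e (HH_cup b a).
Proof.
have [f cf ->] := hclassP a; have [g cg ->] := hclassP b.
have [cfg ->] := HH_cupE cf cg; have [cgf ->] := HH_cupE cg cf.
have cgf' := cycle_cast cgf e; rewrite gcast_hclass -(hclassZ _ cgf').
apply: (proj2 (hochschild_homologous cfg (cycleZ _ cgf'))).
exact: (acup_commutes cf cg).
Qed.

Lemma HH_bracketC i j (a : HH S i) (b : HH S j) (e : j + i + 1 = i + j + 1) :
  HH_bracket a b =
    - (sgn F ((i + 1) * (j + 1)) *: gcast (G := fun n => HH S n) e (HH_bracket b a)).
Proof.
have [f cf ->] := hclassP a; have [g cg ->] := hclassP b.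
have [cfg ->] := HH_bracketE cf cg; have [cgf ->] := HH_bracketE cg cf.
have cgf' := cycle_cast cgf e.
rewrite gcast_hclass -scaleNr -(hclassZ _ cgf').
by congr (hclass _ _ _); exact: bracketC.
Qed.

Lemma HH_jacobi i j k (a : HH S i) (b : HH S j) (c : HH S k)
    (e1 : i + j + 1 + k + 1 = i + (j + k + 1) + 1)
    (e2 : j + (i + k + 1) + 1 = i + (j + k + 1) + 1) :
  HH_bracket a (HH_bracket b c) =
    gcast (G := fun n => HH S n) e1 (HH_bracket (HH_bracket a b) c)
    + sgn F ((i + 1) * (j + 1)) *:
      gcast (G := fun n => HH S n) e2 (HH_bracket b (HH_bracket a c)).
Proof.
have [f cf ->] := hclassP a; have [g cg ->] := hclassP b; have [h ch ->] := hclassP c.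
have [cfg ->] := HH_bracketE cf cg; have [cgh ->] := HH_bracketE cg ch.
have [cfh ->] := HH_bracketE cf ch.
have [_ ->] := HH_bracketE cf cgh; have [c1 ->] := HH_bracketE cfg ch.
have [c2 ->] := HH_bracketE cg cfh.
have c1' := cycle_cast c1 e1; have c2' := cycle_cast c2 e2.
rewrite !gcast_hclass -(hclassZ _ c2') -(hclassD c1' (cycleZ _ c2')).
move/cocycleP: cf => [cf _]; move/cocycleP: cg => [cg _]; move/cocycleP: ch => [ch _].
by congr (hclass _ _ _); apply/funext => t; exact: bracket_jacobi.
Qed.

(** Bracketing from the other side is a strict derivation by [ins_acup]; the rest
    is the boundary of the double insertion. *)
Lemma HH_poisson i j k (a : HH S i) (b : HH S j) (c : HH S k)
    (e1 : i + j + 1 + k = i + (j + k) + 1)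
    (e2 : j + (i + k + 1) = i + (j + k) + 1) :
  HH_bracket a (HH_cup b c) =
    gcast (G := fun n => HH S n) e1 (HH_cup (HH_bracket a b) c)
    + sgn F ((i + 1) * j) *:
      gcast (G := fun n => HH S n) e2 (HH_cup b (HH_bracket a c)).
Proof.
have [f cf ->] := hclassP a; have [g cg ->] := hclassP b; have [h ch ->] := hclassP c.
have [cfg ->] := HH_bracketE cf cg; have [cgh ->] := HH_cupE cg ch.
have [cfh ->] := HH_bracketE cf ch.
have [c0 ->] := HH_bracketE cf cgh; have [c1 ->] := HH_cupE cfg ch.
have [c2 ->] := HH_cupE cg cfh.
have c1' := cycle_cast c1 e1; have c2' := cycle_cast c2 e2.
rewrite !gcast_hclass -(hclassZ _ c2') -(hclassD c1' (cycleZ _ c2')).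
apply: (proj2 (hochschild_homologous c0 (cycleD c1' (cycleZ _ c2')))).
move/cocycleP: cf => [cf df]; move/cocycleP: cg => [cg dg]; move/cocycleP: ch => [ch dh].
have cb := brace_cochain cf cg ch.
have ei : i + j + k + 1 + 1 = i + (j + k) + 1 + 1 by ring.
exists (- sgn F (i + k + 1 + k * j) *: (brace j g k h f : hfun S)).
  by apply: ncochainZ; apply/cochain_self; exact: cochain_cast cb ei.
rewrite (linZ' (@hochschild_d_linear F A S _)) -ei; apply/funext => t.
rewrite !hfunE (hochschild_d_brace t cf cg ch df dg dh).
have e3 : bracket i (j + k) f (acup k g h) t = ins (j + k) (acup k g h) f t
    - sgn F ((i + 1) * (j + k + 1)) *: (sgn F ((i + 1) * k) *: acup k (ins i f g) h t
       + acup (k + i + 1) g (ins i f h) t).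
  by rewrite /bracket (ins_acup t cg ch cf).
have e4 : acup k (bracket i j f g) h t = acup k (ins j g f) h t
    - sgn F ((i + 1) * (j + 1)) *: acup k (ins i f g) h t.
  rewrite [RHS]addrC -scaleNr -acup_linl; apply: eq_acup => // u.
  by rewrite /bracket scaleNr addrC.
have e5 : acup (i + k + 1) g (bracket i k f h) t = acup (i + k + 1) g (ins k h f) t
    - sgn F ((i + 1) * (k + 1)) *: acup (k + i + 1) g (ins i f h) t.
  rewrite (_ : k + i + 1 = i + k + 1); last by ring.
  rewrite [RHS]addrC -scaleNr -acup_linr; apply: eq_acup => // u.
  by rewrite /bracket scaleNr addrC.
rewrite e3 e4 e5; linear_sgn.
Qed.

Lemma HH_gerstenhaber : @is_gerstenhaber F (fun n => HH S n)
  (@HH_one F A) (@HH_cup F A) (@HH_bracket F A).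
Proof.
split.
- exact: HH_cup_linl.
- exact: HH_cup_linr.
- exact: HH_cupA.
- exact: HH_cup1l.
- exact: HH_cup1r.
- exact: HH_cupC.
- exact: HH_bracket_linl.
- exact: HH_bracket_linr.
- exact: HH_bracketC.
- exact: HH_jacobi.
- exact: HH_poisson.
Qed.

End GerstenhaberLaws.

(** * The Batalin-Vilkovisky algebra *)

Section LeftAction.
Variables (F : fieldType) (A : dgAlgebra F) (N : dgBimodule A).
Local Notation CA := (seq (helt A) -> A).
Implicit Types (n m k : int).

Lemma lcup0l n m (x : hfun N) : ncochain m x -> lcup n m (0 : hfun (self_bimodule A)) x = 0.
Proof.
move=> [_ xp]; apply/funext => t; rewrite /lcup cuts_zero // => u v.
by rewrite /letter (@slot0 _ _ _ (fun a => bm_l a _ (x v))) ?scaler0 //; exact: bm_l_homog.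
Qed.

Lemma lcup_hclass n m k (f : CA) (x y : hfun N) : n + m = k ->
  (f : hochschild (self_bimodule A)) \in cycle (hochschild (self_bimodule A)) n ->
  x \in cycle (hochschild N) m -> y \in cycle (hochschild N) m ->
  hclass (hochschild N) m x = hclass (hochschild N) m y ->
  [/\ lcup n m f x \in cycle (hochschild N) k, lcup n m f y \in cycle (hochschild N) k
    & hclass (hochschild N) k (lcup n m f x) = hclass (hochschild N) k (lcup n m f y)].
Proof.
move=> <- /cocycleP[cf df] cx cy xy; have /cycleP[_ dx] := cx.
have lf i : linear (lcup n i f : hfun N -> hfun N) by exact: lcup_linear.
have cyc z : z \in cycle (hochschild N) m -> lcup n m f z \in cycle (hochschild N) (n + m).
  move=> /cycleP[cz dz]; apply/cycleP; split; first exact: lcup_cochain.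
  by rewrite (hochschild_d_lcup cf cz) df dz (lcup0l _ cz) (lin0' (lf _)) scaler0 addr0.
split; [exact: cyc | exact: cyc |].
apply: (proj2 (hochschild_homologous (cyc _ cx) (cyc _ cy))).
have [z cz dz] := proj1 (hochschild_homologous cx cy) xy.
exists (sgn F n *: lcup n (m + 1) f z).
  by apply: ncochainZ; apply: ncochain_cast (lcup_cochain cf cz) _; ring.
rewrite (linZ' (@hochschild_d_linear F A N _)) (_ : n + m + 1 = n + (m + 1)); last by ring.
rewrite (hochschild_d_lcup cf cz) df dz (lcup0l _ cz) add0r addrK (linB' (lf _)).
by apply/funext => t; rewrite !hfunE; linear_sgn.
Qed.

End LeftAction.

(** Linearity is checked after the injective map [T'], where the choice involved in
    [HH_theta_inv] is no longer visible. *)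
Lemma linear_lift (F : fieldType) (U V U' V' : lmodType F) (T : U -> V)
    (T' : U' -> V') (B : V -> V') (D : U -> U') :
  linear T -> linear T' -> injective T' -> linear B ->
  (forall x, T' (D x) = B (T x)) -> linear D.
Proof.
by move=> lT lT' injT' lB e c x y; apply: injT'; rewrite lT' !e lT lB.
Qed.

Section BatalinVilkovisky.
Variables (F : fieldType) (A : dgAlgebra F) (d : int).
Local Notation CA := (seq (helt A) -> A).
Local Notation S := (self_bimodule A).
Local Notation Dual := (dual_bimodule A).
Variable Theta : S -> Dual.
Hypothesis Theta_map : is_bimodule_map d Theta.
Hypothesis Theta_quasi_iso : @is_quasi_iso F (bm_complex S) (bm_complex Dual) d Theta.
Local Notation theta n f := (theta_cochain d Theta n (f : hochschild S) : hfun Dual).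
Local Notation C := (hochschild S).
Local Notation D := (hochschild Dual).
Local Notation cl n f := (hclass C n (f : C)).
Local Notation cocycle n f := ((f : C) \in cycle C n).
Implicit Types (n i j : int).

Let bij n : bijective (@HH_theta F A d Theta n) :=
  HH_theta_bij Theta_map Theta_quasi_iso n.

Lemma HH_theta_linear n : linear (@HH_theta F A d Theta n).
Proof.
apply: (@induced1_linear F C D n (n + d) (theta_cochain d Theta n)).
  by move=> c z w _ _; exact: (theta_linear Theta_map).
exact: theta_induced.
Qed.

Lemma HH_connes_linear n : linear (@HH_connes F A n).
Proof.
apply: (@induced1_linear F D D n (n + 1) (@connes_coboundary F A n)).
  by move=> c z w _ _; exact: connes_linear.
exact: connes_induced.
Qed.

Lemma HH_theta_delta n (x : HH S n) : HH_theta d Theta (HH_delta d Theta x) =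
  gcast (G := fun k => HH Dual k) (addrAC n d 1) (HH_connes (HH_theta d Theta x)).
Proof.
rewrite /HH_delta /HH_theta_inv; case: xgetP => [y _ -> //|no].
by have [g _ gK] := bij (n + 1); case: (no _ (gK _)).
Qed.

Lemma HH_delta_linear n : linear (@HH_delta F A d Theta n).
Proof.
have lB : linear (fun z : HH Dual (n + d) =>
    gcast (G := fun k => HH Dual k) (addrAC n d 1) (HH_connes z)).
  by case: _ / (addrAC n d 1); exact: HH_connes_linear.
exact: (linear_lift (@HH_theta_linear n) (@HH_theta_linear (n + 1))
  (bij_inj (bij (n + 1))) lB (@HH_theta_delta n)).
Qed.

Lemma HH_delta_square n (a : HH S n) : HH_delta d Theta (HH_delta d Theta a) = 0.
Proof.
apply: (bij_inj (bij _)); rewrite (lin0' (@HH_theta_linear _)) !HH_theta_delta.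
have [w cw ->] := hclassP (HH_theta d Theta a).
have [cBw ->] := connes_induced cw.
rewrite (gcast_hclass (addrAC n d 1) (connes_coboundary (n + d) w)).
have [_ ->] := connes_induced (cycle_cast cBw (addrAC n d 1)); rewrite gcast_hclass.
have -> : connes_coboundary (n + 1 + d) (connes_coboundary (n + d) w) = 0.
  by rewrite (_ : n + 1 + d = n + d + 1) ?connes_square //; ring.
exact: hclass0.
Qed.

Lemma HH_delta_class n (f : CA) : cocycle n f -> exists x : CA,
  [/\ cocycle (n + 1) x, HH_delta d Theta (cl n f) = cl (n + 1) x,
      connes1 (n + d) (theta n f) \in cycle D (n + 1 + d)
    & hclass D (n + 1 + d) (theta (n + 1) x) =
      hclass D (n + 1 + d) (connes1 (n + d) (theta n f))].
Proof.
move=> cf; have [x cx ex] := hclassP (HH_delta d Theta (cl n f)).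
have [ct et] := theta_induced Theta_map cf.
have [_ ec] := connes_induced ct; have [c1 e1] := connes1_homologous ct.
have [_ ex'] := theta_induced Theta_map cx.
exists x; split; [exact: cx | exact: ex | exact: cycle_cast c1 (addrAC n d 1) |].
rewrite -ex' -ex HH_theta_delta et ec e1; exact: gcast_hclass.
Qed.

(** Everything is compared after [HH_theta], which turns products into the action
    on dual coefficients by [theta_lcup]; the first product is commuted beforehand,
    because [bv_homotopy] acts from the left only. *)
Lemma HH_bv_bracket i j (a : HH S i) (b : HH S j)
    (e1 : i + 1 + j = i + j + 1) (e2 : i + (j + 1) = i + j + 1) :
  HH_bracket a b = sgn F i *:
    (HH_delta d Theta (HH_cup a b)
     - gcast (G := fun n => HH S n) e1 (HH_cup (HH_delta d Theta a) b)
     - sgn F i *: gcast (G := fun n => HH S n) e2 (HH_cup a (HH_delta d Theta b))).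
Proof.
have [f cf ->] := hclassP a; have [g cg ->] := hclassP b.
have [cfg ->] := HH_cupE cf cg; have [cbr ->] := HH_bracketE cf cg.
have [x [cx -> cP eP]] := HH_delta_class cfg.
have [y [cy -> cQ eQ]] := HH_delta_class cf.
have [z [cz -> cT eT]] := HH_delta_class cg.
have e3 : j + (i + 1) = i + 1 + j by ring.
have e4 : j + (i + 1) = i + j + 1 by ring.
rewrite (HH_cupC _ _ e3).
have [cgy ->] := HH_cupE cg cy; have [cfz ->] := HH_cupE cf cz.
rewrite gcast_hclass -(hclassZ _ (cycle_cast cgy e3)) !gcast_hclass.
have cgy' := cycle_cast cgy e4; have cfz' := cycle_cast cfz e2.
rewrite (hclassZ _ cgy'); apply: (bij_inj (bij _)).
have [ctbr ->] := theta_induced Theta_map cbr.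
have lH := @HH_theta_linear (i + j + 1).
rewrite (linZ' lH) !(linB' lH) !(linZ' lH).
have [_ ->] := theta_induced Theta_map cx.
have [_ ->] := theta_induced Theta_map cgy'.
have [_ ->] := theta_induced Theta_map cfz'.
have [_ cty] := theta_induced Theta_map cy.
have cty' := theta_cycle Theta_map cy; have ctz' := theta_cycle Theta_map cz.
have eQd : j + (i + 1 + d) = i + j + 1 + d by ring.
have eTd : i + (j + 1 + d) = i + j + 1 + d by ring.
have [_ cQ' eQ'] := lcup_hclass eQd cg cty' cQ eQ.
have [_ cT' eT'] := lcup_hclass eTd cf ctz' cT eT.
move/cocycleP: cf => [cf df]; move/cocycleP: cg => [cg dg].
move/cocycleP: cy => [cy _]; move/cocycleP: cz => [cz _].
rewrite -e4 -(theta_lcup Theta_map cg cy) e4 eQ'.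
rewrite -e2 -(theta_lcup Theta_map cf cz) e2 eT' eP.
have [cR ->] := hclass_comb (sgn F i) (sgn F ((i + 1) * j)) (sgn F i) cP cQ' cT'.
apply: (proj2 (hochschild_homologous ctbr cR)).
have [W cW dW] := bv_homotopy Theta_map cf cg df dg.
exists W; first exact: cW.
rewrite dW (addrAC i 1 d) (addrAC j 1 d).
apply/funext => t; rewrite !hfunE; linear_sgn.
Qed.

Lemma theta_batalin_vilkovisky : @is_batalin_vilkovisky F (fun n => HH S n)
  (@HH_one F A) (@HH_cup F A) (@HH_bracket F A) (@HH_delta F A d Theta).
Proof.
split.
- exact: HH_gerstenhaber.
- exact: HH_delta_linear.
- exact: HH_delta_square.
- exact: HH_bv_bracket.
Qed.

End BatalinVilkovisky.

Theorem theorem17 (F : fieldType) (A : dgAlgebra F) (d : int)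
    (Theta : self_bimodule A -> dual_bimodule A)
    (Theta_bimodule_map : is_bimodule_map d Theta)
    (Theta_quasi_iso : @is_quasi_iso F (bm_complex (self_bimodule A))
                         (bm_complex (dual_bimodule A)) d Theta) :
  [/\ HH_operations_induced d Theta,
      forall n : int, bijective (@HH_theta F A d Theta n)
    & @is_batalin_vilkovisky F (fun n => HH (self_bimodule A) n)
        (@HH_one F A) (@HH_cup F A) (@HH_bracket F A)
        (@HH_delta F A d Theta)].
Proof.
split.
- split.
  + exact: one_cycle.
  + exact: acup_induced.
  + exact: bracket_induced.
  + exact: connes_induced.
  + exact: theta_induced.
- exact: HH_theta_bij.
- exact: theta_batalin_vilkovisky.
Qed.
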